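(* Let $j\ge 3$ be an odd integer such that $\mathbb{Q}(z_j)$ does not contain any proper real subfield other than $\mathbb{Q}$. Then for all $s/t\in\mathbb{Q}\smallsetminus\mathbb{Z}$ with $t$ odd, $\mathrm{Stab}_{\Gamma_j}(H_{s/t})$ is a non-elementary Fuchsian group of infinite covolume.
   Context: $K_j$ is the twist knot with exactly $j$ half-twists, and $\Gamma_j=\pi_1(S^3\smallsetminus K_j)=\langle a,b\mid b=w_jaw_j^{-1}\rangle$, with $a,b$ meridians, where $w_j=(a^{-1}b^{-1}ab)^{(j-1)/2}a^{-1}b^{-1}$ for $j$ odd and $w_j=(a^{-1}bab^{-1})^{j/2}$ for $j$ even. For $j\ge 2$ the discrete faithful representation $\rho_j:\Gamma_j\to\mathrm{SL}_2(\mathbb{C})$ of the complete finite-volume hyperbolic structure is normalized by $\rho_j(a)=\begin{pmatrix}1&1\\ 0&1\end{pmatrix}$, $\rho_j(b)=\begin{pmatrix}1&0\\ z_j&1\end{pmatrix}$; this defines $z_j\in\mathbb{C}$, and $\mathbb{Q}(z_j)$ is the trace field. $\Gamma_j$ acts on the upper half-space $\mathbb{H}^3$ via $\rho_j$. The longitude commuting with $a$ is $\ell_j=a\overline{w}_jb^2w_ja$ for $j$ odd and $\ell_j=\overline{w}_jw_j$ for $j$ even, where $\overline{w}_j$ is $w_j$ spelled backwards; $\ell_j$ acts as translation by $\tau_j=2-4/z_j$, and $a$ as translation by $1$. For $s/t\in\mathbb{Q}$, $H_{s/t}$ denotes the hyperplane of $\mathbb{H}^3$ containing $\infty$ in its boundary,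 whose line at infinity passes through $s/t\in\mathbb{R}$ and has slope $-2/1$, i.e. is $\{s/t+r(\tau_j-2):r\in\mathbb{R}\}$ (the direction of translation of $a^{-2}\ell_j$). A Fuchsian subgroup is a discrete subgroup preserving a hyperplane of $\mathbb{H}^3$; its covolume is the area of the quotient of that hyperplane. A real subfield is a subfield contained in $\mathbb{R}$. *)

(* Defs.v *)
From HB Require Import structures.
From mathcomp Require Import all_boot all_order all_algebra.
From mathcomp Require Import complex.
From mathcomp Require Import all_classical all_reals all_analysis.

Set Implicit Arguments.
Unset Strict Implicit.
Unset Printing Implicit Defensive.

Import Order.TTheory GRing.Theory Num.Theory.
Import numFieldNormedType.Exports.

Local Open Scope classical_set_scope.
Local Open Scope ring_scope.
Local Open Scope complex_scope.
Local Open Scope quotient_scope.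

Section Presentation.
Variable gen : choiceType.

(* The letter (x, false) stands for x and (x, true) for its inverse. *)
Definition word : Type := seq (gen * bool).

Definition inv_letter (l : gen * bool) : gen * bool := (l.1, ~~ l.2).

Definition inv_word (u : word) : word := rev (map inv_letter u).

Inductive pres_eq (rels : set (word * word)) : word -> word -> Prop :=
| pres_refl u : pres_eq rels u u
| pres_sym u v : pres_eq rels u v -> pres_eq rels v u
| pres_trans u v w : pres_eq rels u v -> pres_eq rels v w -> pres_eq rels u w
| pres_cat u u' v v' :
    pres_eq rels u u' -> pres_eq rels v v' -> pres_eq rels (u ++ v) (u' ++ v')
| pres_cancel l : pres_eq rels [:: l; inv_letter l] [::]
| pres_rel u v : rels (u, v) -> pres_eq rels u v.

Variable rels : set (word * word).

Definition pres_eqb : rel word := fun u v => `[< pres_eq rels u v >].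

Lemma pres_eqb_equiv : equiv_class_of pres_eqb.
Proof.
split=> [u|u v|v u w].
- by apply/asboolP; exact: pres_refl.
- by apply/asboolP/asboolP; exact: pres_sym.
- by move=> /asboolP uv /asboolP vw; apply/asboolP; exact: pres_trans uv vw.
Qed.

Canonical pres_equiv := EquivRelPack pres_eqb_equiv.

(* The group with generators gen and defining relations u = v for
   (u, v) in rels. *)
Definition presented : Type := {eq_quot pres_equiv}.

HB.instance Definition _ := Choice.on presented.

Definition pres_class (u : word) : presented := \pi_{eq_quot pres_equiv} u.

Lemma pres_classP u v : reflect (pres_class u = pres_class v) (pres_eqb u v).
Proof. exact: (iffP (eqmodP _ _ _)). Qed.

Definition pres_repr (x : presented) : word := repr x.

Lemma pres_reprK x : pres_class (pres_repr x) = x.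
Proof. exact: reprK. Qed.

Lemma pres_repr_eq u : pres_eq rels (pres_repr (pres_class u)) u.
Proof. by apply/asboolP/pres_classP; rewrite pres_reprK. Qed.

Definition pres_one : presented := pres_class [::].
Definition pres_mul (x y : presented) : presented :=
  pres_class (pres_repr x ++ pres_repr y).
Definition pres_inv (x : presented) : presented :=
  pres_class (inv_word (pres_repr x)).

Lemma pres_mulE u v : pres_mul (pres_class u) (pres_class v) = pres_class (u ++ v).
Proof.
by apply/pres_classP/asboolP; apply: pres_cat; exact: pres_repr_eq.
Qed.

Lemma inv_letterK : involutive inv_letter.
Proof. by case=> x b; rewrite /inv_letter /= negbK. Qed.

Lemma inv_wordK : involutive inv_word.
Proof.
by move=> u; rewrite /inv_word map_rev revK -map_comp map_id_in // => l _ /=;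
  rewrite inv_letterK.
Qed.

Lemma pres_eq_mulV u : pres_eq rels (u ++ inv_word u) [::].
Proof.
elim: u => [|l u IHu]; first exact: pres_refl.
rewrite /inv_word map_cons rev_cons -cats1 -/(inv_word u).
apply: (@pres_trans _ _ ([:: l] ++ [::] ++ [:: inv_letter l])).
  rewrite -cat1s -catA; apply: pres_cat; first exact: pres_refl.
  by rewrite catA; apply: pres_cat => //; exact: pres_refl.
exact: pres_cancel.
Qed.

Lemma pres_mulA : associative pres_mul.
Proof.
move=> x y t; rewrite -[x]pres_reprK -[y]pres_reprK -[t]pres_reprK.
by rewrite !pres_mulE catA.
Qed.

Lemma pres_mul1 : left_id pres_one pres_mul.
Proof. by move=> x; rewrite -[x]pres_reprK pres_mulE. Qed.

Lemma pres_mulr1 : right_id pres_one pres_mul.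
Proof. by move=> x; rewrite -[x]pres_reprK pres_mulE cats0. Qed.

Lemma pres_mulrV : right_inverse pres_one pres_inv pres_mul.
Proof.
move=> x; rewrite -{1}[x]pres_reprK pres_mulE.
by apply/pres_classP/asboolP; exact: pres_eq_mulV.
Qed.

Lemma pres_mulV : left_inverse pres_one pres_inv pres_mul.
Proof.
move=> x; rewrite -{2}[x]pres_reprK pres_mulE.
apply/pres_classP/asboolP.
by have := pres_eq_mulV (inv_word (pres_repr x)); rewrite inv_wordK.
Qed.

HB.instance Definition _ := isGroup.Build presented
  pres_mulA pres_mul1 pres_mulr1 pres_mulV pres_mulrV.

End Presentation.

(* The generators a and b are encoded as false and true. *)
Definition la : bool * bool := (false, false).
Definition lb : bool * bool := (true, false).
Definition lA : bool * bool := (false, true).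
Definition lB : bool * bool := (true, true).

(* For odd j, j./2 is (j - 1) / 2. *)
Definition twist_word (j : nat) : word bool :=
  if odd j then flatten (nseq j./2 [:: lA; lB; la; lb]) ++ [:: lA; lB]
  else flatten (nseq j./2 [:: lA; lb; la; lB]).

Definition twist_rels (j : nat) : set (word bool * word bool) :=
  [set ([:: lb], twist_word j ++ [:: la] ++ inv_word (twist_word j))].

(* The group of the twist knot with j half-twists, through its two-generator
   presentation < a, b | b = w_j a w_j^-1 >. *)
Definition twist_group (j : nat) : groupType := presented (twist_rels j).

Definition mer_a (j : nat) : twist_group j := pres_class (twist_rels j) [:: la].
Definition mer_b (j : nat) : twist_group j := pres_class (twist_rels j) [:: lb].

Section Hyperbolic.
Variable R : realType.

Definition subfield (F : set R[i]) : Prop := divring_closed (mem F).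

Definition Qadjoin (z : R[i]) : set R[i] := smallest subfield [set z].

Definition Qc : set R[i] := range (ratr : rat -> R[i]).

Definition Rc : set R[i] := [set x | x \is Num.real].

(* The triple (x, y, t) with 0 < t is the point (x + i y, t) of H^3. *)
Definition point : Type := (R * R * R)%type.

Definition H3 : set point := [set p | 0 < p.2].

Definition sqnorm (x : R[i]) : R := complex.Re (x * conjc x).

(* Poincare extension to H^3 of the Moebius transformation given by a matrix
   of determinant 1. *)
Definition hact (g : 'M[R[i]]_2) (p : point) : point :=
  let z := p.1.1 +i* p.1.2 in
  let t := p.2 in
  let cz := g 1 0 * z + g 1 1 in
  let n := sqnorm cz + sqnorm (g 1 0) * t ^+ 2 in
  let w := (g 0 0 * z + g 0 1) * conjc cz
           + g 0 0 * conjc (g 1 0) * (t ^+ 2)%:C in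
  (complex.Re w / n, complex.Im w / n, t / n).

(* Action on the sphere at infinity; None is the point at infinity. *)
Definition mobius (g : 'M[R[i]]_2) (x : option R[i]) : option R[i] :=
  match x with
  | None => if g 1 0 == 0 then None else Some (g 0 0 / g 1 0)
  | Some z => if g 1 0 * z + g 1 1 == 0 then None
              else Some ((g 0 0 * z + g 0 1) / (g 1 0 * z + g 1 1))
  end.

(* For u != 0, this maps {(r, y) | 0 < y} with the metric (dr^2 + dy^2) / y^2
   isometrically onto the vertical half-plane over the line z0 + R u. *)
Definition vparam (z0 u : R[i]) (q : R * R) : point :=
  let z := z0 + q.1%:C * u in (complex.Re z, complex.Im z, Num.sqrt (sqnorm u) * q.2).

Definition vplane (z0 u : R[i]) : set point :=
  vparam z0 u @` [set q | 0 < q.2].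

Definition hemisphere (c : R[i]) (r : R) : set point :=
  [set p | 0 < p.2 /\ sqnorm ((p.1.1 +i* p.1.2) - c) + p.2 ^+ 2 = r ^+ 2].

Definition hyperplane (P : set point) : Prop :=
  (exists z0 u, u != 0 /\ P = vplane z0 u) \/
  (exists c r, 0 < r /\ P = hemisphere c r).

Local Notation leb := (@lebesgue_measure R).

Definition hvolume (D : set point) : \bar R :=
  (\int[(leb \x leb) \x leb]_(p in D) (p.2 ^- 3)%:E)%E.

(* Hyperbolic area of a subset D of vplane z0 u, read through vparam. *)
Definition vplane_area (z0 u : R[i]) (D : set point) : \bar R :=
  (\int[leb \x leb]_(q in vparam z0 u @^-1` D) (q.2 ^- 2)%:E)%E.

Definition SL2_subgroup (G : set 'M[R[i]]_2) : Prop :=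
  [/\ forall g, G g -> \det g = 1,
      G 1%:M,
      forall g h, G g -> G h -> G (g *m h)
    & forall g, G g -> G (invmx g)].

Definition discrete (G : set 'M[(R[i] : numFieldType)]_2) : Prop :=
  G `<=` isolated G.

Definition orbit (T : Type) (act : 'M[R[i]]_2 -> T -> T)
    (G : set 'M[R[i]]_2) (x : T) : set T :=
  [set act g x | g in G].

Definition elementary (G : set 'M[R[i]]_2) : Prop :=
  (exists2 p, H3 p & finite_set (orbit hact G p)) \/
  (exists x, finite_set (orbit mobius G x)).

Definition fuchsian (G : set 'M[R[i]]_2) : Prop :=
  [/\ SL2_subgroup G, discrete G &
      exists2 P, hyperplane P & forall g, G g -> hact g @` P = P].

Definition fundamental_domain (G : set 'M[R[i]]_2) (X D : set point) : Prop :=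
  [/\ measurable D, D `<=` X &
      forall p, X p -> exists! q, D q /\ orbit hact G p q].

(* The quotient of X by G has measure v, mu being the G-invariant measure
   on X. *)
Definition covolume_is (G : set 'M[R[i]]_2) (X : set point)
    (mu : set point -> \bar R) (v : \bar R) : Prop :=
  exists2 D, fundamental_domain G X D & mu D = v.

Definition mx2 (x y z t : R[i]) : 'M[R[i]]_2 :=
  \matrix_(i, k) if i == 0 then (if k == 0 then x else y)
                 else (if k == 0 then z else t).

(* rho is the normalized holonomy of the complete structure and z is z_j;
   these are determined up to complex conjugation. *)
Record hyperbolic_rep (j : nat) (z : R[i])
    (rho : twist_group j -> 'M[R[i]]_2) : Prop := {
  rep_morph : {morph rho : x y / (x * y)%g >-> x *m y};
  rep_a : rho (mer_a j) = mx2 1 1 0 1;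
  rep_b : rho (mer_b j) = mx2 1 0 z 1;
  rep_faithful : injective rho;
  rep_discrete : discrete (range rho);
  rep_finite_volume :
    exists2 v, covolume_is (range rho) H3 hvolume v & (v < +oo)%E
}.

(* The longitude commuting with a acts as the translation by tau z. *)
Definition tau (z : R[i]) : R[i] := 2 - 4 / z.

(* Its line at infinity is q + R (tau z - 2), the direction of translation of
   a^-2 times the longitude. *)
Definition Hplane (z : R[i]) (q : rat) : set point :=
  vplane (ratr q) (tau z - 2).

Definition Hplane_area (z : R[i]) (q : rat) : set point -> \bar R :=
  vplane_area (ratr q) (tau z - 2).

Definition stabilizer (j : nat) (rho : twist_group j -> 'M[R[i]]_2)
    (P : set point) : set (twist_group j) :=
  [set g | hact (rho g) @` P = P].

End Hyperbolic.

(* Main.v *)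
(* The peripheral translation by u = -4/z and, since t is odd, a parabolic fixing
   s/t stabilize the plane H over s/t + R u, so its stabilizer G is not elementary.

   Up to sign the image of the knot group contains Gamma_0(4), which acts on the
   plane over R. Some translate of the latter crosses H along a geodesic with an
   end that is irrational on R. The continued fraction of this end shows that
   the geodesic returns infinitely often to a compact set modulo Gamma_0(4), and
   since the holonomy is discrete, infinitely many of the return points carry
   disjoint balls of a fixed size in H/G. Otherwise two returns would produce an
   element of G fixing both ends of the geodesic. The matrices of the elements of
   G in the coordinates of H are rational, because the real elements of Q(z) are;
   so these ends would be roots of a rational quadratic polynomial, and Re z and
   |z|^2 would be rational. This is excluded by the Riley polynomial, an integral
   monic polynomial with constant term 1 that vanishes at z: its factor would be
   X^2 + m X + 1, and comparing signs and values at 1 modulo 3 leaves no m. Hence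
   H/G has infinite area. *)

Require Import Defs.
From HB Require Import structures.
From mathcomp Require Import all_boot all_order all_algebra archimedean.
From mathcomp Require Import complex.
From mathcomp Require Import all_classical all_reals all_analysis.
From mathcomp Require Import measurable_realfun.
From mathcomp Require Import ring lra zify.

Set Implicit Arguments.
Unset Strict Implicit.
Unset Printing Implicit Defensive.

Import Order.TTheory GRing.Theory Num.Theory.
Import numFieldNormedType.Exports.

Local Open Scope classical_set_scope.
Local Open Scope ring_scope.
Local Open Scope complex_scope.

(** * Matrices, continued fractions and Gamma_0(4) *)

(** The real subgroup comes from a cancellation: the twist word sends infinity to 0, and it
    conjugates the translation by 4/z to the lower unipotent matrix with entry 4. As the peripheral
    word evaluates to minus a translation, the natural group is the image together with its
    negatives, and discreteness must first be extended to it. Oddness of t enters twice: it makes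
    s/t an image of 0 under Gamma_0(4), and it keeps s/t away from the half-integers, where the
    quadratic equation of the crossing loses its constant term. Two obstacles shape the end. A ball
    centred at a return point need not embed in the quotient, since an element of the stabilizer may
    move the centre very little without being trivial; the centre is therefore chosen among finitely
    many points of a horizontal segment, using that the condition of being fixed is quadratic along
    it. And an area is attached to a measurable set meeting every orbit exactly once, so such a set
    has to be constructed, and so that it contains all the balls. *)

Lemma ord2P (i : 'I_2) : i = 0 \/ i = 1.
Proof. by case: i => [[|[|l]] hl]; [left|right|]; try exact/val_inj. Qed.

Section Matrices2.
Variable K : comPzRingType.

Definition mk (a b c d : K) : 'M[K]_2 :=
  \matrix_(i, k) if i == 0 then (if k == 0 then a else b)
                 else (if k == 0 then c else d).

Lemma mk00 a b c d : mk a b c d 0 0 = a. Proof. by rewrite mxE. Qed.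
Lemma mk01 a b c d : mk a b c d 0 1 = b. Proof. by rewrite mxE. Qed.
Lemma mk10 a b c d : mk a b c d 1 0 = c. Proof. by rewrite mxE. Qed.
Lemma mk11 a b c d : mk a b c d 1 1 = d. Proof. by rewrite mxE. Qed.
Definition mkE := (mk00, mk01, mk10, mk11).

Lemma mx2P (M N : 'M[K]_2) : M 0 0 = N 0 0 -> M 0 1 = N 0 1 ->
  M 1 0 = N 1 0 -> M 1 1 = N 1 1 -> M = N.
Proof.
move=> h00 h01 h10 h11; apply/matrixP => i k.
by case: (ord2P i) => ->; case: (ord2P k) => ->.
Qed.

Lemma mk_eta (M : 'M[K]_2) : M = mk (M 0 0) (M 0 1) (M 1 0) (M 1 1).
Proof. by apply: mx2P; rewrite mkE. Qed.

Lemma mul2E (M N : 'M[K]_2) i k : (M *m N) i k = M i 0 * N 0 k + M i 1 * N 1 k.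
Proof.
rewrite mxE big_ord_recl big_ord1; congr (_ * _ + _ * _).
  by congr (M i _); exact/val_inj.
by congr (N _ k); exact/val_inj.
Qed.

Lemma mk_mul a b c d a' b' c' d' : mk a b c d *m mk a' b' c' d' =
  mk (a * a' + b * c') (a * b' + b * d') (c * a' + d * c') (c * b' + d * d').
Proof. by apply: mx2P; rewrite mul2E !mkE. Qed.

Lemma det2 (M : 'M[K]_2) : \det M = M 0 0 * M 1 1 - M 0 1 * M 1 0.
Proof.
rewrite (expand_det_row _ 0) big_ord_recl big_ord1 /cofactor !det_mx11 !mxE /=.
rewrite expr0 !mul1r expr1 mulN1r mulrN.
by congr (_ * M _ _ - M _ _ * M _ _); exact/val_inj.
Qed.

Lemma det_mk a b c d : \det (mk a b c d) = a * d - b * c.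
Proof. by rewrite det2 !mkE. Qed.

Lemma mk_scalar x : mk x 0 0 x = x%:M.
Proof. by apply: mx2P; rewrite mkE mxE. Qed.

Lemma mk1 : mk 1 0 0 1 = 1%:M.
Proof. exact: mk_scalar. Qed.

Lemma scale_mk x a b c d : x *: mk a b c d = mk (x * a) (x * b) (x * c) (x * d).
Proof. by apply: mx2P; rewrite mxE !mkE. Qed.

Lemma opp_mk a b c d : - mk a b c d = mk (- a) (- b) (- c) (- d).
Proof. by apply: mx2P; rewrite mxE !mkE. Qed.

End Matrices2.

Lemma map_mk (K L : comPzRingType) (f : K -> L) a b c d :
  map_mx f (mk a b c d) = mk (f a) (f b) (f c) (f d).
Proof. by apply: mx2P; rewrite mxE !mkE. Qed.

Lemma invmx_mk (K : comUnitRingType) (a b c d : K) : a * d - b * c = 1 ->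
  invmx (mk a b c d) = mk d (- b) (- c) a.
Proof.
move=> h; have hu : mk a b c d \in unitmx by rewrite unitmxE det_mk h unitr1.
have e : mk a b c d *m mk d (- b) (- c) a = 1%:M.
  by rewrite mk_mul -mk1 -h; congr mk; ring.
by rewrite -[LHS]mulmx1 -e mulKmx.
Qed.

Lemma intertwine_inv (K : fieldType) n (h A Y : 'M[K]_n) i : h \in unitmx ->
  Y \in unitmx -> i != 0 -> h *m A = i *: (A *m Y) ->
  invmx h *m A = i^-1 *: (A *m invmx Y).
Proof.
move=> uh uY i0 e; apply: (can_inj (mulKmx uh)); rewrite mulKVmx // -scalemxAr mulmxA e.
by rewrite -scalemxAl scalerA mulVf // scale1r mulmxK.
Qed.

Lemma intertwine_div (K : fieldType) n (g h A X Y : 'M[K]_n) i : h \in unitmx ->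
  Y \in unitmx -> i != 0 -> g *m A = i *: (A *m X) -> h *m A = i *: (A *m Y) ->
  invmx h *m g *m A = A *m (invmx Y *m X).
Proof.
move=> uh uY i0 e e'; rewrite -mulmxA e -scalemxAr mulmxA (intertwine_inv uh uY i0 e').
by rewrite -scalemxAl scalerA mulfV // scale1r mulmxA.
Qed.

Section ContinuedFraction.
Variable R : archiRealFieldType.

Definition nonrational (y : R) : Prop := forall x : rat, y <> ratr x.

Lemma gauss_step (y : R) : nonrational y ->
  exists a : int, exists2 x : R, 1 < x & y = a%:~R + x^-1.
Proof.
move=> hy; exists (Num.floor y).
have fr : 0 < y - (Num.floor y)%:~R.
  rewrite subr_gt0 lt_def (floor_le y) andbT.
  by apply/eqP => h; apply: (hy (Num.floor y)%:~R); rewrite ratr_int.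
exists (y - (Num.floor y)%:~R)^-1; last by rewrite invrK addrC subrK.
by rewrite invf_gt1 // ltrBlDl; have := floorD1_gt y; rewrite intrD.
Qed.

(** Here [x] is the complete quotient and [p / q], [p' / q'] are consecutive convergents. The
    induction starts after two steps, so that [1 <= q'] and each new denominator [a * q + q']
    exceeds [q]; this gives [n.+1 <= q]. *)
Lemma convergent_states (y : R) : nonrational y -> forall n : nat,
  exists (p p' q q' : int) (x : R),
    [/\ `|p * q' - p' * q| = 1, (n.+1 : int) <= q, 1 <= q' <= q, 1 < x &
        y * (q%:~R * x + q'%:~R) = p%:~R * x + p'%:~R].
Proof.
move=> hy; elim=> [|n [p [p' [q [q' [x [hd hq /andP[hq1 hqq] hx hyx]]]]]]].
  have [a0 [x0 x01 ya]] := gauss_step hy.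
  have hx0 : nonrational x0.
    move=> r rE; apply: (hy (a0%:~R + r^-1)).
    by rewrite ya rE rmorphD /= fmorphV ratr_int.
  have [a1 [x1 x11 x0a]] := gauss_step hx0.
  have a1_ge : 1 <= a1.
    have : 0 < a1%:~R :> R.
      have : x1^-1 < 1 by rewrite invf_lt1 //; lra.
      lra.
    by rewrite ltr0z; lia.
  exists (a0 * a1 + 1), a0, a1, 1, x1; split=> //.
  - have -> : (a0 * a1 + 1) * 1 - a0 * a1 = 1 :> int by ring.
    by rewrite normr1.
  rewrite ya x0a; rewrite !(intrD, intrM) /=.
    have h1 : x1 != 0 by lra.
    have h2 : a1%:~R + x1^-1 != 0 :> R by rewrite -x0a; lra.
    have h3 : a1%:~R * x1 + 1 != 0 :> R.
      by have : (a1%:~R + x1^-1) * x1 != 0 by [rewrite mulf_neq0]; rewrite mulrDl mulVf.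
    by field; rewrite h1 h3.
have hxi : nonrational x.
  move=> r rE.
  have q0 : (q%:~R * r + q'%:~R : rat) != 0.
    have : (q%:~R * x + q'%:~R : R) != 0.
      have : 1 <= q%:~R :> R by rewrite ler1z; lia.
      have : 1 <= q'%:~R :> R by rewrite ler1z.
      by nra.
    rewrite rE -!(ratr_int R) -rmorphM -rmorphD /=.
    by apply: contra_neq => ->; rewrite rmorph0.
  apply: (hy ((p%:~R * r + p'%:~R) / (q%:~R * r + q'%:~R))).
  rewrite fmorph_div /= !(rmorphD, rmorphM) /= !ratr_int -rE -hyx mulfK //.
  rewrite rE -!(ratr_int R) -rmorphM -rmorphD /=.
  by rewrite fmorph_eq0.
have [a [x1 x11 xa]] := gauss_step hxi.
have a_ge : 1 <= a.
  have : 0 < a%:~R :> R.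
    have : x1^-1 < 1 by rewrite invf_lt1 //; lra.
    lra.
  by rewrite ltr0z; lia.
exists (a * p + p'), p, (a * q + q'), q, x1; split=> //.
- by rewrite -hd -normrN; congr (`| _ |); ring.
- by nia.
- by apply/andP; split; nia.
have x10 : x1 != 0 by rewrite gt_eqF // (lt_trans ltr01).
have e1 : x * x1 = a%:~R * x1 + 1 by rewrite xa mulrDl mulVf.
have -> : y * ((a * q + q')%:~R * x1 + q%:~R) = y * (q%:~R * x + q'%:~R) * x1.
  by rewrite !(intrD, intrM); ring: e1.
by rewrite hyx !(intrD, intrM); ring: e1.
Qed.

(** Both bounds are read off y = (p x + p') / (q x + q') with x > 1. The determinant of consecutive
    convergents is 1 or -1; negating [p'] and [q'] normalizes it, at the price of the sign of
    [q']. *)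
Lemma good_convergents (y : R) : nonrational y -> forall n : nat,
  exists p p' q q' : int,
    [/\ p * q' - p' * q = 1, (n.+1 : int) <= q, `|q'| <= q,
        `|q%:~R * y - p%:~R| <= (q%:~R)^-1 & `|q'%:~R * y - p'%:~R| <= (q%:~R)^-1].
Proof.
move=> hy n; have [p [p' [q [q' [x [hd hq /andP[hq1 hqq] hx hyx]]]]]] :=
  convergent_states hy n.
have q1 : 1 <= q%:~R :> R by rewrite ler1z; lia.
have q'1 : 1 <= q'%:~R :> R by rewrite ler1z.
have den0 : 0 < q%:~R * x + q'%:~R by nra.
have hdR : `|p%:~R * q'%:~R - p'%:~R * q%:~R| = 1 :> R.
  by rewrite -!intrM -intrB -intr_norm hd.
have yE : y = (p%:~R * x + p'%:~R) / (q%:~R * x + q'%:~R).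
  by rewrite -hyx mulfK // gt_eqF.
have den0' : q%:~R * x + q'%:~R != 0 by rewrite gt_eqF.
have e1 : `|q%:~R * y - p%:~R| <= (q%:~R)^-1.
  have -> : q%:~R * y - p%:~R =
     - (p%:~R * q'%:~R - p'%:~R * q%:~R) / (q%:~R * x + q'%:~R) by rewrite yE; field.
  rewrite normrM normrN hdR mul1r normfV gtr0_norm // lef_pV2 ?posrE //; nra.
have e2 : `|q'%:~R * y - p'%:~R| <= (q%:~R)^-1.
  have -> : q'%:~R * y - p'%:~R =
     (p%:~R * q'%:~R - p'%:~R * q%:~R) * (x / (q%:~R * x + q'%:~R)).
    by rewrite yE; field.
  rewrite normrM hdR mul1r ger0_norm; last by rewrite divr_ge0 ?ltW //; lra.
  by rewrite ler_pdivrMr // ler_pdivlMl; nra.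
have [h|h] : p * q' - p' * q = 1 \/ p * q' - p' * q = -1 by lia.
  by exists p, p', q, q'; split => //; lia.
exists p, (- p'), q, (- q'); split => //; [nia|lia|].
by rewrite !rmorphN /= mulNr -opprD normrN.
Qed.

End ContinuedFraction.

(** Euclidean descent on [|c|]: reduce [a] modulo [c], then [c] modulo [4 * a']. The result
    satisfies |c'| <= 2 |a'| <= |c|, and the first inequality is strict because [a'] is odd while 4
    divides [c']. So translations, their lower analogues with entry in 4Z and -1 generate
    Gamma_0(4). *)
Lemma Gamma04_ind (K : comPzRingType) (S : 'M[K]_2 -> Prop) :
  (forall M N, S M -> S N -> S (M *m N)) ->
  (forall n : int, S (mk 1 n%:~R 0 1)) ->
  (forall n : int, S (mk 1 0 (4 * n)%:~R 1)) ->
  S (mk (-1) 0 0 (-1)) ->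
  forall a b c d : int, a * d - b * c = 1 -> (4 %| c)%Z ->
  S (mk a%:~R b%:~R c%:~R d%:~R).
Proof.
move=> SM ST SL Sm a b c d.
have [k hk] : exists k : nat, (`|c| < k)%N by exists (`|c|.+1).
elim: k a b c d hk => // k IH a b c d hk hdet h4.
have [c0|c0] := eqVneq c 0.
  have : (a = 1 /\ d = 1) \/ (a = -1 /\ d = -1).
    have ad1 : a * d = 1 by rewrite -hdet c0 mulr0 subr0.
    have : `|a|%N = 1%N.
      by apply/eqP; rewrite -dvdn1; apply/dvdnP; exists `|d|%N; lia.
    move=> a1; have [aE|aE] : a = 1 \/ a = -1 by lia.
      by left; subst a; lia.
    by right; subst a; lia.
  case=> -[-> ->]; rewrite c0; first exact: ST.
  have -> : mk (-1)%:~R b%:~R 0%:~R (-1)%:~R =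
     mk (-1) 0 0 (-1) *m mk 1 (- b)%:~R 0 1 :> 'M[K]_2.
    by rewrite mk_mul; congr mk; ring.
  by apply: SM.
have [a' [n [aE ha]]] : exists a' n : int, a = a' + n * c /\ (2 * `|a'| <= `|c|)%N.
  have := divz_eq a c; have := modz_ge0 a c0; have := ltz_mod a c0.
  set r := (a %% c)%Z; set m := (a %/ c)%Z => h1 h2 h3.
  have [hr|hr] := leP (2 * r) `|c|.
    by exists r, m; split; [rewrite h3; ring|lia].
  have [cp|cn] := ltP 0 c.
    by exists (r - c), (m + 1); split; [rewrite h3; ring|lia].
  by exists (r + c), (m - 1); split; [rewrite h3; ring|lia].
pose b' := b - n * d.
have hdet' : a' * d - b' * c = 1 by rewrite -hdet aE /b'; ring.
have aodd : (2 %| a')%Z = false.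
  apply/negP => /dvdzP[x xE]; move/dvdzP: h4 => [w wE].
  by move: hdet'; rewrite xE wE; lia.
have a0 : a' != 0 by apply/eqP => a0; rewrite a0 in aodd.
have [c' [m [cE hc]]] : exists c' m : int, c = c' + 4 * m * a' /\ (`|c'| <= 2 * `|a'|)%N.
  have a40 : 4 * a' != 0 by lia.
  have := divz_eq c (4 * a'); have := modz_ge0 c a40; have := ltz_mod c a40.
  set r := (c %% _)%Z; set m := (c %/ _)%Z => h1 h2 h3.
  have [hr|hr] := leP (2 * r) `|4 * a'|.
    by exists r, m; split; [rewrite h3; ring|lia].
  have [cp|cn] := ltP 0 a'.
    by exists (r - 4 * a'), (m + 1); split; [rewrite h3; ring|lia].
  by exists (r + 4 * a'), (m - 1); split; [rewrite h3; ring|lia].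
pose d' := d - 4 * m * b'.
have hdet'' : a' * d' - b' * c' = 1 by rewrite -hdet' cE /d'; ring.
have -> : mk a%:~R b%:~R c%:~R d%:~R = mk 1 n%:~R 0 1 *m
   (mk 1 0 (4 * m)%:~R 1 *m mk a'%:~R b'%:~R c'%:~R d'%:~R) :> 'M[K]_2.
  rewrite !mk_mul aE cE /d' /b'; congr mk; rewrite !(intrD, intrB, intrM) /=; ring.
apply: (SM) => //; apply: (SM) => //; apply: IH => //.
  have h4' : (4 %| c')%Z.
    by move/dvdzP: h4 => [w wE]; apply/dvdzP; exists (w - m * a'); lia.
  have : (`|c'| <> 2 * `|a'|)%N.
    move=> e; move/dvdzP: h4' => [w wE]; move/negP: aodd; apply.
    have [h|h] : a' = 2 * w \/ a' = 2 * - w by lia.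
      by rewrite h dvdz_mulr.
    by rewrite h dvdz_mulr.
  move: cE; have : (`|c'| <= `|c|)%N by lia.
  by lia.
by move/dvdzP: h4 => [w wE]; apply/dvdzP; exists (w - m * a'); lia.
Qed.

(** Bounded coset representatives of Gamma_0(4) in SL_2(Z): multiplied on the right by the inverse
    of the representative, the matrix with columns [(p, q)] and [(p', q')] falls into Gamma_0(4).
    Squares of odd numbers are 1 modulo 4, so the residue of [q * q'] is the right entry for either
    parity of [q]. *)
Lemma Gamma04_coset (q q' p p' : int) : p * q' - p' * q = 1 ->
  exists a b c d : int, [/\ a * d - b * c = 1,
    (`|a| <= 3)%N && (`|b| <= 3)%N, (`|c| <= 3)%N && (`|d| <= 3)%N &
    (4 %| q * d - q' * c)%Z].
Proof.
move=> hdet.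
have odd_sq (m : int) : ~~ (2 %| m)%Z -> (4 %| m * m - 1)%Z.
  move=> hm; have := divz_eq m 2; have := modz_ge0 m (isT : 2 != 0 :> int).
  have := ltz_mod m (isT : 2 != 0 :> int).
  set w := (m %/ 2)%Z => h1 h2 h3.
  have mE : m = w * 2 + 1.
    have : (m %% 2)%Z <> 0 by move=> e; move/negP: hm; apply; apply/dvdzP; exists w; lia.
    by lia.
  by apply/dvdzP; exists (w * w + w); rewrite mE; ring.
pose r := ((q * q') %% 4)%Z.
have r0 : 0 <= r by exact: modz_ge0.
have r4 : r < 4 by exact: ltz_mod.
have rE : q * q' = (q * q' %/ 4)%Z * 4 + r by exact: divz_eq.
have [q2|q2] := boolP (2 %| q)%Z.
  have q'2 : ~~ (2 %| q')%Z.
    apply/negP => /dvdzP[w wE]; move/dvdzP: q2 => [v vE].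
    by move: hdet; rewrite wE vE; lia.
  have /dvdzP[v vE] := odd_sq _ q'2.
  exists 1, 0, r, 1; split; [lia|lia|lia|].
  apply/dvdzP; exists (- (q * v) + q' * (q * q' %/ 4)%Z).
  have -> : r = q * q' - (q * q' %/ 4)%Z * 4 by rewrite [X in X - _]rE addrAC subrr add0r.
  have -> : q * 1 - q' * (q * q' - (q * q' %/ 4)%Z * 4) =
    q - q * (q' * q' - 1 + 1) + q' * (q * q' %/ 4)%Z * 4 by ring.
  by rewrite vE; ring.
have /dvdzP[v vE] := odd_sq _ q2.
exists 0, (-1), 1, r; split; [lia|lia|lia|].
apply/dvdzP; exists (q' * v - q * (q * q' %/ 4)%Z).
have -> : r = q * q' - (q * q' %/ 4)%Z * 4 by rewrite [X in X - _]rE addrAC subrr add0r.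
have -> : q * (q * q' - (q * q' %/ 4)%Z * 4) - q' * 1 =
   (q * q - 1 + 1) * q' - q * (q * q' %/ 4)%Z * 4 - q' by ring.
by rewrite vE; ring.
Qed.

(** * The image of the knot group *)

Lemma subfieldP (R : realType) (F : set R[i]) : subfield F <->
  [/\ F 1, forall x y, F x -> F y -> F (x - y) &
      forall x y, F x -> F y -> F (x / y)].
Proof.
have fP (x : R[i]) : (x \in pred_of_mem (mem F)) <-> F x.
  by rewrite -[X in _ <-> X](in_setE F x).
split=> -[F1 FB FM].
  by split=> [|x y /fP hx /fP hy|x y /fP hx /fP hy]; apply/fP; [|exact: FB|exact: FM].
by split=> [|x y /fP hx /fP hy|x y /fP hx /fP hy]; apply/fP; [|exact: FB|exact: FM].
Qed.

Lemma subfield_closed (R : realType) (F : set R[i]) : subfield F ->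
  [/\ F 0, forall x, F x -> F (- x), forall x y, F x -> F y -> F (x + y) &
      forall x y, F x -> F y -> F (x * y)].
Proof.
move=> /subfieldP[F1 FB FM].
have F0 : F 0 by rewrite -(subrr 1); exact: FB.
have FN x : F x -> F (- x) by move=> hx; rewrite -sub0r; exact: FB.
split=> // x y hx hy; first by rewrite -[y]opprK; apply: FB => //; exact: FN.
have [->|y0] := eqVneq y 0; first by rewrite mulr0.
by rewrite -[y]invrK; apply: (FM) => //; rewrite -[y^-1]mul1r; exact: (FM).
Qed.

Lemma subfield_rat (R : realType) (F : set R[i]) (q : rat) : subfield F -> F (ratr q).
Proof.
move=> hF; have [F1 _ FV] := (subfieldP F).1 hF.
have [F0 FN FD FM] := subfield_closed hF.
have Fnat (n : nat) : F n%:R by elim: n => [//|n IH]; rewrite -natr1; exact: FD.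
have Fint (n : int) : F n%:~R by case: n => n; [|apply: FN]; exact: Fnat.
by rewrite /ratr; apply: FV.
Qed.

Section Representation.
Variables (R : realType) (j : nat) (z : R[i]) (rho : twist_group j -> 'M[R[i]]_2).
Hypothesis hrho : hyperbolic_rep z rho.
Local Notation C := R[i].

Definition ev (u : word bool) : 'M[C]_2 := rho (pres_class (twist_rels j) u).

Lemma ev_cat u v : ev (u ++ v) = ev u *m ev v.
Proof. by rewrite /ev -pres_mulE; exact: (rep_morph hrho). Qed.

Lemma ev_eq u v : pres_eq (twist_rels j) u v -> ev u = ev v.
Proof. by move=> h; congr rho; apply/pres_classP/asboolP. Qed.

Lemma ev_a : ev [:: la] = mk 1 1 0 1.
Proof. exact: (rep_a hrho). Qed.

Lemma ev_b : ev [:: lb] = mk 1 0 z 1.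
Proof. exact: (rep_b hrho). Qed.

(** [rep_morph] only speaks of products; the empty word goes to 1 because the image of [a] is
    invertible. *)
Lemma ev_nil : ev [::] = 1%:M.
Proof.
have := ev_cat [::] [:: la]; rewrite cat0s ev_a => e.
have hu : mk 1 1 0 1 \in @unitmx C 2.
  by rewrite unitmxE det_mk mulr0 subr0 mulr1 unitr1.
by rewrite -[ev _]mulmx1 -(mulmxV hu) mulmxA -e.
Qed.

Lemma ev_letterV l : ev [:: l] *m ev [:: inv_letter l] = 1%:M.
Proof. by rewrite -ev_cat -ev_nil; apply: ev_eq; exact: pres_cancel. Qed.

Lemma ev_A : ev [:: lA] = mk 1 (-1) 0 1.
Proof.
have := ev_letterV la; rewrite ev_a => e; rewrite -[LHS]mul1mx.
have -> : 1%:M = mk 1 (-1) 0 1 *m mk 1 1 0 1 :> 'M[C]_2.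
  by rewrite mk_mul -mk1; congr mk; ring.
by rewrite -mulmxA [_ *m ev _]e mulmx1.
Qed.

Lemma ev_B : ev [:: lB] = mk 1 0 (- z) 1.
Proof.
have := ev_letterV lb; rewrite ev_b => e; rewrite -[LHS]mul1mx.
have -> : 1%:M = mk 1 0 (- z) 1 *m mk 1 0 z 1 :> 'M[C]_2.
  by rewrite mk_mul -mk1; congr mk; ring.
by rewrite -mulmxA [_ *m ev _]e mulmx1.
Qed.

Lemma ev_ind (S : 'M[C]_2 -> Prop) : S 1%:M ->
  (forall M, S M -> S (mk 1 1 0 1 *m M)) ->
  (forall M, S M -> S (mk 1 (-1) 0 1 *m M)) ->
  (forall M, S M -> S (mk 1 0 z 1 *m M)) ->
  (forall M, S M -> S (mk 1 0 (- z) 1 *m M)) -> forall u, S (ev u).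
Proof.
move=> S1 Sa SA Sb SB; elim=> [|l u IH]; first by rewrite ev_nil.
rewrite -cat1s ev_cat; case: l => -[] [].
- by rewrite -/lB ev_B; exact: SB.
- by rewrite -/lb ev_b; exact: Sb.
- by rewrite -/lA ev_A; exact: SA.
- by rewrite -/la ev_a; exact: Sa.
Qed.

Lemma rangeE M : range rho M <-> exists u, M = ev u.
Proof.
split=> [[x _ <-]|[u ->]]; last by exists (pres_class (twist_rels j) u).
by exists (pres_repr x); rewrite /ev pres_reprK.
Qed.

Lemma det_ev u : \det (ev u) = 1.
Proof.
apply: (ev_ind (S := fun M => \det M = 1)) => [|M h|M h|M h|M h]; rewrite ?det1 // det_mulmx det_mk h; ring.
Qed.

Lemma ev_inv u : ev (inv_word u) = invmx (ev u).
Proof.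
have e : ev u *m ev (inv_word u) = 1%:M.
  by rewrite -ev_cat -ev_nil; apply: ev_eq; exact: pres_eq_mulV.
by rewrite -[RHS]mulmx1 -e mulKmx // unitmxE det_ev unitr1.
Qed.

Lemma ev_subfield (F : set C) : subfield F -> F z -> forall u i k, F (ev u i k).
Proof.
move=> hF Fz; have [F1 _ _] := (subfieldP F).1 hF.
have [F0 FN FD FM] := subfield_closed hF.
have step a b c d (M : 'M[C]_2) : F a -> F b -> F c -> F d ->
    (forall i k, F (M i k)) -> forall i k, F ((mk a b c d *m M) i k).
  move=> ha hb hc hd hM i k; rewrite mul2E; apply: FD; apply: FM => //.
    by rewrite mxE; case: ifP => _.
  by rewrite mxE; case: ifP => _.
apply: (ev_ind (S := fun M => forall i k, F (M i k))) => [i k|M|M|M|M]; try by apply: step => //; exact: FN.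
by rewrite mxE; case: (i == k).
Qed.

(** Transposition along the second diagonal. *)
Definition theta (M : 'M[C]_2) := mk (M 1 1) (M 0 1) (M 1 0) (M 0 0).

Lemma theta_mul M N : theta (M *m N) = theta N *m theta M.
Proof. by rewrite /theta mk_mul !mul2E; congr mk; ring. Qed.

(* Reversal of words fixes both generators and their inverses, hence acts on
   matrices as the anti-automorphism theta. *)
Lemma ev_rev u : ev (rev u) = theta (ev u).
Proof.
elim: u => [|l u IH].
  by rewrite ev_nil; apply: mx2P; rewrite !mkE !mxE.
rewrite rev_cons -cats1 ev_cat IH -[l :: u]cat1s ev_cat theta_mul; congr (_ *m _).
by case: l => -[] []; rewrite -/la -/lb -/lA -/lB ?ev_a ?ev_A ?ev_b ?ev_B;
  rewrite /theta !mkE.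
Qed.

Hypothesis oddj : odd j.

Definition comm_word : word bool := [:: lA; lB; la; lb].

Lemma ev_comm : ev comm_word = mk (1 + z + z ^+ 2) z (- z ^+ 2) (1 - z).
Proof.
rewrite /comm_word -[[:: _; _; _; _]]/([:: lA] ++ [:: lB] ++ [:: la] ++ [:: lb]).
rewrite !ev_cat ev_A ev_B ev_a ev_b !mk_mul; congr mk; ring.
Qed.

Lemma ev_AB : ev [:: lA; lB] = mk (1 + z) (-1) (- z) 1.
Proof.
rewrite -[[:: _; _]]/([:: lA] ++ [:: lB]) ev_cat ev_A ev_B !mk_mul; congr mk; ring.
Qed.

Lemma twist_wordE k : ev (flatten (nseq k comm_word) ++ [:: lA; lB]) =
  ev comm_word ^+ k *m mk (1 + z) (-1) (- z) 1.
Proof.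
rewrite ev_cat ev_AB; congr (_ *m _).
elim: k => [|k IH]; first by rewrite ev_nil.
by rewrite /= exprS -mulmxE -IH -ev_cat.
Qed.

Lemma ev_twist_comm :
  ev (twist_word j) *m mk 1 1 0 1 = mk 1 0 z 1 *m ev (twist_word j).
Proof.
have /ev_eq e : pres_eq (twist_rels j) [:: lb]
   (twist_word j ++ [:: la] ++ inv_word (twist_word j)) by exact: pres_rel.
rewrite -ev_b e !ev_cat ev_a ev_inv -!mulmxA mulVmx ?mulmx1 //.
by rewrite unitmxE det_ev unitr1.
Qed.

(** The entry (0, 1) of w a = b w says that [w 0 0] vanishes, which is Riley's equation. The
    remaining entries are then multiples of one number [P], and the determinant gives the equation
    for [P]. In particular w sends infinity to 0. *)
Lemma ev_twist : exists2 P : C, P ^+ 2 * z = -1 &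
  ev (twist_word j) = mk 0 (- P) (- (z * P)) ((2 + z) * P).
Proof.
have := ev_twist_comm; have := det_ev (twist_word j).
have : ev (twist_word j) = ev comm_word ^+ j./2 *m mk (1 + z) (-1) (- z) 1.
  by rewrite /twist_word oddj -twist_wordE.
(* By Cayley-Hamilton a power of the commutator matrix X, of trace 2 + z^2 and determinant 1, has
   the form p X + q. *)
have [p [q ->]] : exists p q, ev comm_word ^+ j./2 =
   mk (p * (1 + z + z ^+ 2) + q) (p * z) (- (p * z ^+ 2)) (p * (1 - z) + q).
  elim: (j./2) => [|k [p [q IH]]].
    by exists 0, 1; apply: etrans (esym (mk1 _)) _; congr mk; ring.
  exists (p * (2 + z ^+ 2) + q), (- p).
  by rewrite exprSr IH ev_comm -mulmxE mk_mul; congr mk; ring.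
move=> ->; rewrite mk_mul; set a := (X in mk X _ _ _); set b := (X in mk _ X _ _).
set c := (X in mk _ _ X _); set d := (X in mk _ _ _ X) => hdet.
rewrite !mk_mul => hcomm.
have a0 : a = 0.
  by have := congr1 (fun M : 'M[C]_2 => M 0 1) hcomm; rewrite !mkE !mulr1 !mul1r mul0r addr0 => /eqP; rewrite -subr_eq0 addrK => /eqP.
exists (p * (1 + z ^+ 2) + q).
  have bE : b = - (p * (1 + z ^+ 2) + q) by rewrite /b; ring.
  have cE : c = - (z * (p * (1 + z ^+ 2) + q)) by rewrite /c; ring.
  by move: hdet; rewrite det_mk a0 bE cE mul0r => h; rewrite -[in RHS]h; ring.
rewrite -{1}a0; apply: mx2P; rewrite !mkE //; try by rewrite /b /c; ring.
have -> : d = (2 + z) * (p * (1 + z ^+ 2) + q) - a by rewrite /d /a; ring.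
by rewrite a0 subr0.
Qed.

Lemma z_neq0 : z != 0.
Proof.
have [P hP _] := ev_twist; apply: contra_eq_neq hP => ->.
by rewrite mulr0 eq_sym oppr_eq0 oner_eq0.
Qed.

End Representation.

(** * Size of matrices and discreteness up to sign *)

Section ComplexSize.
Variable R : realType.
Implicit Types x y : R[i].

(** The l1 norm of R^2: submultiplicative, and with values in [R], whereas the modulus on [R[i]]
    takes its values in [R[i]]. *)
Definition cn x : R := `|complex.Re x| + `|complex.Im x|.

Lemma cn_ge0 x : 0 <= cn x. Proof. by rewrite addr_ge0. Qed.

Lemma cnD x y : cn (x + y) <= cn x + cn y.
Proof.
case: x y => [a b] [c d]; rewrite /cn /=.
by have := ler_normD a c; have := ler_normD b d; lra.
Qed.

Lemma cnN x : cn (- x) = cn x.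
Proof. by case: x => a b; rewrite /cn /= !normrN. Qed.

Lemma cnM x y : cn (x * y) <= cn x * cn y.
Proof.
case: x y => [a b] [c d]; rewrite /cn /=.
have h1 := ler_normB (a * c) (b * d); have h2 := ler_normD (a * d) (b * c).
rewrite !normrM in h1 h2; lra.
Qed.

Lemma cn_real (x : R) : cn x%:C = `|x|.
Proof. by rewrite /cn /= normr0 addr0. Qed.

Lemma cnM_le x y a b : cn x <= a -> cn y <= b -> cn (x * y) <= a * b.
Proof.
move=> hx hy; apply: le_trans (cnM x y) _.
by apply: ler_pM => //; exact: cn_ge0.
Qed.

Lemma ler_norm_cn x (e : R) : cn x < e -> `|x| < e%:C.
Proof.
move=> h; rewrite normc_def ltcR; apply: le_lt_trans h.
rewrite -[leRHS]ger0_norm ?cn_ge0 // -sqrtr_sqr ler_sqrt ?sqr_ge0 // /cn.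
rewrite -[complex.Re x ^+ 2]real_normK ?num_real //.
rewrite -[complex.Im x ^+ 2]real_normK ?num_real //.
have := normr_ge0 (complex.Re x); have := normr_ge0 (complex.Im x); nra.
Qed.

Definition bnd (B : R) (M : 'M[R[i]]_2) := forall i k, cn (M i k) <= B.

Lemma bnd_mul B B' M N : bnd B M -> bnd B' N -> bnd (2 * B * B') (M *m N).
Proof.
move=> hM hN i k; rewrite mul2E; apply: le_trans (cnD _ _) _.
have -> : 2 * B * B' = B * B' + B * B' by ring.
by apply: lerD; apply: cnM_le.
Qed.

(** The number of the cell of length [e] in a subdivision of [-B, B]. *)
Definition gridcode (B e : R) (x : R) : 'I_(Num.truncn (2 * B / e)).+1 :=
  inord (Num.truncn ((x + B) / e)).

Lemma gridcodeP (B e x y : R) : 0 < e -> `|x| <= B -> `|y| <= B ->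
  gridcode B e x = gridcode B e y -> `|x - y| < e.
Proof.
move=> e0 hx hy /(congr1 val).
have tr v : `|v| <= B -> (Num.truncn ((v + B) / e) <= Num.truncn (2 * B / e))%N /\
   0 <= (v + B) / e.
  rewrite ler_norml => /andP[h1 h2]; split; last first.
    by apply: divr_ge0; [lra|exact: ltW].
  by apply: le_truncn; rewrite ler_pM2r ?invr_gt0 //; lra.
have [hx1 hx2] := tr _ hx; have [hy1 hy2] := tr _ hy.
rewrite /gridcode /= !inordK ?ltnS // => eqt.
have := truncn_itv hx2; have := truncn_itv hy2; rewrite eqt.
set m := Num.truncn _ => /andP[h1 h2] /andP[h3 h4].
rewrite ler_pdivlMr // in h1; rewrite ler_pdivlMr // in h3.
rewrite ltr_pdivrMr // in h2; rewrite ltr_pdivrMr // in h4.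
by rewrite -natr1 in h2 h4; rewrite ltr_norml; apply/andP; split; lra.
Qed.

End ComplexSize.

Section ProjectiveImage.
Variables (R : realType) (j : nat) (z : R[i]) (rho : twist_group j -> 'M[R[i]]_2).
Hypothesis hrho : hyperbolic_rep z rho.
Local Notation C := R[i].
Local Notation ev := (ev rho).

(** The full preimage in SL_2 of the projective image. The peripheral word evaluates to minus a
    translation and Gamma_0(4) contains -1, so signs have to be allowed. *)
Definition Gp (M : 'M[C]_2) := exists u, M = ev u \/ M = - ev u.

Lemma Gp_ev u : Gp (ev u). Proof. by exists u; left. Qed.

Lemma Gp_opp M : Gp M -> Gp (- M).
Proof. by case=> u [->|->]; exists u; [right|left; rewrite opprK]. Qed.

Lemma Gp_mul M N : Gp M -> Gp N -> Gp (M *m N).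
Proof.
case=> u hu [v hv]; exists (u ++ v); rewrite (ev_cat hrho).
by case: hu hv => -> [] ->; rewrite ?mulNmx ?mulmxN ?opprK; [left|right|right|left].
Qed.

Lemma Gp_det M : Gp M -> \det M = 1.
Proof.
have d u := det_ev hrho u.
by case=> u [->|->] //; rewrite det2 !mxE !mulrNN -det2.
Qed.

Lemma Gp_unit M : Gp M -> M \in unitmx.
Proof. by move=> /Gp_det h; rewrite unitmxE h unitr1. Qed.

Lemma Gp_inv M : Gp M -> Gp (invmx M).
Proof.
have e u : invmx (- ev u) = - invmx (ev u).
  have hu : ev u \in unitmx by apply: Gp_unit; exact: Gp_ev.
  have hNu : - ev u \in unitmx by apply/Gp_unit/Gp_opp/Gp_ev.
  by rewrite -[RHS]mulmx1 -(mulmxV hNu) mulmxA mulNmx mulmxN mulVmx // opprK mul1mx.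
case=> u hu; exists (inv_word u); rewrite (ev_inv hrho).
by case: hu => ->; [left|right; rewrite e].
Qed.

Definition wpow (n : nat) (u : word bool) : word bool := flatten (nseq n u).
Definition wpowz (n : int) (u : word bool) : word bool :=
  match n with Posz m => wpow m u | Negz m => wpow m.+1 (inv_word u) end.

Lemma ev_wpowz (u : word bool) (x : C) : ev u = mk 1 x 0 1 ->
  forall n : int, ev (wpowz n u) = mk 1 (x * n%:~R) 0 1.
Proof.
have pw (v : word bool) (y : C) m : ev v = mk 1 y 0 1 -> ev (wpow m v) = mk 1 (y * m%:R) 0 1.
  move=> hv; elim: m => [|m IH].
    by rewrite /wpow /= (ev_nil hrho) -mk1 mulr0.
  by rewrite /wpow /= (ev_cat hrho) -/(wpow m v) IH hv mk_mul -natr1; congr mk; ring.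
move=> hu [m|m]; first exact: pw.
have hi : ev (inv_word u) = mk 1 (- x) 0 1.
  by rewrite (ev_inv hrho) hu invmx_mk ?oppr0 // mulr0 subr0 mulr1.
by rewrite [LHS](pw _ _ _ hi) NegzE mulrNz mulNr mulrN.
Qed.

(** This is the abelianization of the knot group, both sides of the relation having exponent sum
    1. *)
Definition expo (u : word bool) : int := \sum_(l <- u) (if l.2 then -1 else 1).

Lemma expo_cat u v : expo (u ++ v) = expo u + expo v.
Proof. by rewrite /expo big_cat. Qed.

Lemma expo_inv u : expo (inv_word u) = - expo u.
Proof.
rewrite /expo /inv_word (perm_big _ (permEl (perm_rev _))) /= big_map -sumrN.
by apply: eq_bigr => -[x []] _ /=; rewrite ?opprK.
Qed.

Lemma expo_rev u : expo (rev u) = expo u.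
Proof. by rewrite /expo (perm_big _ (permEl (perm_rev _))). Qed.

Lemma expo_wpowz n u : expo (wpowz n u) = n * expo u.
Proof.
have pw v m : expo (wpow m v) = m%:Z * expo v.
  elim: m => [|m IH]; first by rewrite /expo /wpow /= big_nil mul0r.
  by rewrite /wpow /= expo_cat -/(wpow m v) IH; lia.
case: n => m; first exact: pw.
by rewrite [LHS]pw expo_inv NegzE mulrN mulNr.
Qed.

Lemma expo_pres_eq u v : pres_eq (twist_rels j) u v -> expo u = expo v.
Proof.
elim=> {u v} //.
- by move=> u v w _ -> _ ->.
- by move=> u u' v v' _ hu _ hv; rewrite !expo_cat hu hv.
- by case=> x []; rewrite /expo /= !big_cons big_nil.
- move=> u v [-> ->].
  by rewrite -[la :: _]cat1s !expo_cat expo_inv /expo !big_cons !big_nil /=; lia.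
Qed.

Lemma ev_inj_expo u v : ev u = ev v -> expo u = expo v.
Proof.
by move=> /(rep_faithful hrho) /pres_classP/asboolP; exact: expo_pres_eq.
Qed.

(** Discreteness passes to the negatives: if N = -[ev u] is close to 1, then N^2 lies in the image
    and is close to 1, so N^2 = 1. With determinant 1 this leaves N = 1 and N = -1, and -1 is not
    close to 1. *)
Lemma near1_trivial : exists2 d : R, 0 < d & forall M, Gp M ->
  (forall i k, cn (M i k - (1%:M : 'M[C]_2) i k) < d) -> M = 1%:M.
Proof.
have : range rho 1%:M by apply/rangeE; exists [::]; rewrite (ev_nil hrho).
move=> /(rep_discrete hrho) [_ [V]].
move=> /nbhs_ballP[e0 /= e00 hV] hVA.
have [e [e0' eE]] : exists e : R, 0 < e /\ e%:C = e0.
  move: e00; rewrite ltcE /= => /andP[/eqP h1 h2].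
  by exists (complex.Re e0); split => //; case: (e0) h1 => a b /= ->.
have disc u : (forall i k, cn (ev u i k - (1%:M : 'M[C]_2) i k) < e) -> ev u = 1%:M.
  move=> hu; have : (V `&` range rho) (ev u).
    split; last by apply/rangeE; exists u.
    apply: hV; split=> // i k; rewrite -eE /ball /= -normrN opprB.
    exact: ler_norm_cn.
  by rewrite hVA.
(* With N - 1 at most e/8 and N + 1 at most 3 entrywise, N^2 - 1 = (N - 1)(N + 1) is at most 2 (e/8)
   3 < e. The cap 1 yields the bound 3 and excludes N = -1. *)
exists (Num.min 1 (e / 8)); first by rewrite lt_min ltr01 /= divr_gt0.
move=> M [u [->|->]] hM; first by apply: disc => i k; apply: lt_le_trans (hM i k) _;
  rewrite ge_min; apply/orP; right; lra.
have [N NE] : exists N, N = - ev u by eexists.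
rewrite -NE in hM *.
have hN i k : cn (N i k - (1%:M : 'M[C]_2) i k) < 1 /\ cn (N i k - (1%:M : 'M[C]_2) i k) < e / 8.
  by have := hM i k; rewrite lt_min => /andP[].
have NN : N *m N = ev (u ++ u) by rewrite (ev_cat hrho) NE mulNmx mulmxN opprK.
have NN1 : N *m N = 1%:M.
  rewrite NN; apply: disc => i k; rewrite -NN.
  have -> : (N *m N) i k - (1%:M : 'M[C]_2) i k = ((N - 1%:M) *m (N + 1%:M)) i k.
    rewrite mulmxDr mulmxBl !mulmx1 !mul1mx addrA subrK.
    by rewrite [RHS]mxE [(- _ : 'M[C]_2) i k]mxE.
  have h1 : bnd (e / 8) (N - 1%:M).
    move=> a b; rewrite [(N - _) a b]mxE [(- _ : 'M[C]_2) a b]mxE.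
    by have [_ /ltW] := hN a b.
  have h2 : bnd 3 (N + 1%:M).
    move=> a b; rewrite [(N + _) a b]mxE.
    have -> : N a b + (1%:M : 'M[C]_2) a b = (N a b - (1%:M : 'M[C]_2) a b) + 2 * (1%:M : 'M[C]_2) a b by ring.
    apply: le_trans (cnD _ _) _; have [h _] := hN a b.
    suff : cn (2 * (1%:M : 'M[C]_2) a b) <= 2 by lra.
    rewrite mxE; case: (a == b) => /=; last by rewrite mulr0 (cn_real 0) normr0.
    by rewrite mulr1 -(rmorph_nat (real_complex R)) cn_real ger0_norm.
  by have := bnd_mul h1 h2 i k; lra.
have hdet : \det N = 1 by rewrite NE; apply: Gp_det; apply/Gp_opp/Gp_ev.
have hNu : N \in unitmx by rewrite unitmxE hdet unitr1.
have invN : invmx N = N by rewrite -[LHS]mulmx1 -NN1 mulKmx.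
rewrite det2 in hdet.
have e1 : N = mk (N 1 1) (- N 0 1) (- N 1 0) (N 0 0).
  by rewrite -{1}invN {1}[N]mk_eta invmx_mk.
have c2 (x : C) : x = - x -> x = 0.
  by move=> /eqP; rewrite -subr_eq0 opprK -mulr2n mulrn_eq0 /= => /eqP.
have b0 : N 0 1 = 0 by apply: c2; rewrite {1}e1 mkE.
have d0 : N 1 0 = 0 by apply: c2; rewrite {1}e1 mkE.
have ad : N 0 0 = N 1 1 by rewrite {1}e1 mkE.
have : N 0 0 = 1 \/ N 0 0 = -1.
  have : (N 0 0 - 1) * (N 0 0 + 1) == 0.
    have aa : N 0 0 * N 0 0 = 1 by rewrite {2}ad -hdet b0 mul0r subr0.
    have -> : (N 0 0 - 1) * (N 0 0 + 1) = N 0 0 * N 0 0 - 1 by ring.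
    by rewrite aa subrr.
  by rewrite mulf_eq0 subr_eq0 addr_eq0 => /orP[/eqP|/eqP]; [left|right].
case=> h.
  by rewrite [N]mk_eta -ad b0 d0 h mk1.
have [] := hN 0 0; rewrite h mxE /= => + _.
have -> : -1 - 1%:R = (- 2)%:C :> C.
  by rewrite -[1%:R]/1 -opprD rmorphN /= rmorph_nat.
by rewrite cn_real normrN normr_nat ltNge ler1n.
Qed.

End ProjectiveImage.

(** * Parabolic elements and the subgroup Gamma_0(4) *)

Section ParabolicElements.
Variables (R : realType) (j : nat) (z : R[i]) (rho : twist_group j -> 'M[R[i]]_2).
Hypothesis hrho : hyperbolic_rep z rho.
Hypothesis oddj : odd j.
Local Notation C := R[i].
Local Notation ev := (ev rho).
Local Notation Gp := (Gp rho).

Lemma bnd_inv (B : R) (M : 'M[C]_2) : \det M = 1 -> bnd B M -> bnd B (invmx M).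
Proof.
rewrite det2 => hd hM; rewrite [M]mk_eta invmx_mk // => i k; rewrite mxE.
by do 2![case: ifP => _]; rewrite ?cnN.
Qed.

(** A discrete group has finitely many elements of bounded size: if all entries of [M] and [N] lie
    in the same cells, then [invmx N *m M] is so close to 1 that [near1_trivial] applies. An
    injective code with values in a finite type is what the later pigeonhole arguments use. *)
Lemma bounded_code (B : R) : exists (T : finType) (code : 'M[C]_2 -> T),
  forall M N, Gp M -> Gp N -> bnd B M -> bnd B N -> code M = code N -> M = N.
Proof.
have [d d0 hd] := near1_trivial hrho.
have [B1 [B10 hB]] : exists B1, 0 < B1 /\ B <= B1.
  by exists (`|B| + 1); have := ler_norm B; have := normr_ge0 B; lra.
(* Entries in the same cells differ by less than 2 e, and multiplication by the inverse costs a
   factor 2 B1, which leaves d / 2. *)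
pose e := d / (8 * B1).
have e0 : 0 < e by rewrite divr_gt0 // mulr_gt0.
pose g := gridcode B1 e.
exists {ffun 'I_2 * 'I_2 * bool -> 'I_(Num.truncn (2 * B1 / e)).+1},
  (fun M => [ffun p => g (if p.2 then complex.Re (M p.1.1 p.1.2)
                          else complex.Im (M p.1.1 p.1.2))]).
move=> M N hM hN bM bN hc.
have bM1 i k : cn (M i k) <= B1 by apply: le_trans (bM i k) hB.
have bN1 i k : cn (N i k) <= B1 by apply: le_trans (bN i k) hB.
have hdiff : bnd (2 * e) (M - N).
  move=> i k.
  have hre : `|complex.Re (M i k) - complex.Re (N i k)| < e.
    apply: (@gridcodeP _ B1) => //.
    - by apply: le_trans (bM1 i k); rewrite /cn lerDl.
    - by apply: le_trans (bN1 i k); rewrite /cn lerDl.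
    - by have := congr1 (fun f : {ffun _ -> _} => f (i, k, true)) hc; rewrite !ffunE.
  have him : `|complex.Im (M i k) - complex.Im (N i k)| < e.
    apply: (@gridcodeP _ B1) => //.
    - by apply: le_trans (bM1 i k); rewrite /cn lerDr.
    - by apply: le_trans (bN1 i k); rewrite /cn lerDr.
    - by have := congr1 (fun f : {ffun _ -> _} => f (i, k, false)) hc; rewrite !ffunE.
  rewrite mxE [(- N) i k]mxE /cn; move: hre him.
  by case: (M i k) (N i k) => [a b] [a' b'] /= h1 h2; lra.
have uN := Gp_unit hrho hN.
have : invmx N *m M = 1%:M.
  apply: hd => [|i k]; first by apply: (Gp_mul hrho) => //; exact: (Gp_inv hrho).
  have -> : (invmx N *m M) i k - (1%:M : 'M[C]_2) i k = (invmx N *m (M - N)) i k.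
    by rewrite mulmxBr mulVmx // [RHS]mxE [(- _ : 'M[C]_2) i k]mxE.
  apply: le_lt_trans (bnd_mul (bnd_inv (Gp_det hrho hN) bN1) hdiff i k) _.
  have -> : 2 * B1 * (2 * e) = d / 2 by rewrite /e; field; lra.
  by lra.
by move=> h; rewrite -[M]mul1mx -(mulmxV uN) -mulmxA h mulmx1.
Qed.

Lemma Gp_powU (x : C) : Gp (mk 1 x 0 1) -> forall n : int, Gp (mk 1 (x * n%:~R) 0 1).
Proof.
move=> hx.
have pw (y : C) (m : nat) : Gp (mk 1 y 0 1) -> Gp (mk 1 (y * m%:R) 0 1).
  move=> hy; elim: m => [|m IH].
    by rewrite mulr0 mk1 -(ev_nil hrho); exact: Gp_ev.
  have -> : mk 1 (y * m.+1%:R) 0 1 = mk 1 y 0 1 *m mk 1 (y * m%:R) 0 1.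
    by rewrite mk_mul -natr1; congr mk; ring.
  exact: (Gp_mul hrho).
case=> m; first exact: pw.
rewrite NegzE mulrNz mulrN -mulNr; apply: pw.
have -> : mk 1 (- x) 0 1 = invmx (mk 1 x 0 1).
  by rewrite invmx_mk ?oppr0 // mulr0 subr0 mulr1.
exact: (Gp_inv hrho).
Qed.

Lemma Gp_T (n : int) : Gp (mk 1 n%:~R 0 1).
Proof.
by rewrite -[n%:~R]mul1r; apply: Gp_powU; rewrite -(ev_a hrho); exact: Gp_ev.
Qed.

(** By b w = w a, the longitude is a (rev w) w a^3. Since (rev w) w commutes with a, this word is
    the longitude times a^-4. *)
Definition ev_peripheral_word := rev (twist_word j) ++ twist_word j.

Lemma ev_peripheral : ev ev_peripheral_word = - mk 1 (- 2 - 4 / z) 0 1.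
Proof.
have z0 := z_neq0 hrho oddj.
have [P hP hW] := ev_twist hrho oddj.
rewrite (ev_cat hrho) (ev_rev hrho) hW /theta !mkE mk_mul opp_mk.
have PE : P * P = - z^-1 by rewrite -[LHS](mulfK z0) -expr2 hP mulN1r.
congr mk.
- by rewrite mulr0 add0r mulrN mulNr opprK mulrCA PE mulrN divff.
- transitivity (- (2 * (2 + z)) * (P * P)); first by ring.
  by rewrite PE; field.
- by ring.
- transitivity (z * (P * P)); first by ring.
  by rewrite PE mulrN divff.
Qed.

Lemma Gp_U (n : int) : Gp (mk 1 (4 / z * n%:~R) 0 1).
Proof.
apply: Gp_powU.
have -> : mk 1 (4 / z) 0 1 = invmx (mk 1 2%:~R 0 1 *m (- ev ev_peripheral_word)).
  have e : mk 1 2%:~R 0 1 *m (- ev ev_peripheral_word) = mk 1 (- (4 / z)) 0 1.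
    by rewrite ev_peripheral opprK mk_mul; congr mk; rewrite /=; ring.
  by rewrite e invmx_mk ?opprK ?oppr0 // mulr0 subr0 mulr1.
apply: (Gp_inv hrho); apply: (Gp_mul hrho) => //; first exact: Gp_T.
exact/Gp_opp/Gp_ev.
Qed.

(** Conjugation by w turns the translation by x into the lower unipotent matrix with entry z x,
    because (z P)^2 = -z. For x = 4 n / z the factor z cancels. *)
Lemma Gp_L (n : int) : Gp (mk 1 0 (4 * n)%:~R 1).
Proof.
have z0 := z_neq0 hrho oddj.
have [P hP hW] := ev_twist hrho oddj.
have -> : mk 1 0 (4 * n)%:~R 1 = ev (twist_word j) *m mk 1 (4 / z * n%:~R) 0 1
    *m invmx (ev (twist_word j)).
  have hd := det_ev hrho (twist_word j).
  rewrite hW in hd *; rewrite invmx_mk -?det_mk // !mk_mul intrM.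
  have PE : P * P = - z^-1 by rewrite -[LHS](mulfK z0) -expr2 hP mulN1r.
  congr mk.
  - transitivity (- z * (P * P)); last by ring.
    by rewrite PE mulrNN mulfV.
  - by ring.
  - transitivity (- (4 / z * n%:~R) * z * z * (P * P)); last by ring.
    by rewrite PE; field.
  - transitivity (- z * (P * P)); last by field.
    by rewrite PE mulrNN mulfV.
apply: (Gp_mul hrho) => //; last by apply: (Gp_inv hrho); exact: Gp_ev.
by apply: (Gp_mul hrho) => //; [exact: Gp_ev|exact: Gp_U].
Qed.

Lemma Gp_Gamma04 (a b c d : int) : a * d - b * c = 1 -> (4 %| c)%Z ->
  Gp (mk a%:~R b%:~R c%:~R d%:~R).
Proof.
apply: Gamma04_ind => [M N hM hN|n|n|]; [exact: (Gp_mul hrho)|exact: Gp_T|exact: Gp_L|].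
have -> : mk (-1) 0 0 (-1) = - ev [::].
  by rewrite (ev_nil hrho) -mk1 opp_mk oppr0.
exact/Gp_opp/Gp_ev.
Qed.

(** A parabolic fixing s/t. Coprimality of 4 s and t is what completes the column [(s, t)] to an
    element K of Gamma_0(4), with K 0 = s/t; since w sends infinity to 0, the conjugate of a by K w
    is the matrix wanted. *)
Lemma Gp_conj_parabolic (s t : int) : coprimez (4 * s) t ->
  Gp (mk (1 + s%:~R * t%:~R * z) (- (s%:~R ^+ 2 * z)) (t%:~R ^+ 2 * z)
         (1 - s%:~R * t%:~R * z)).
Proof.
move=> /coprimezP[[v u] /= huv].
have z0 := z_neq0 hrho oddj.
have [P hP hW] := ev_twist hrho oddj.
have hK : Gp (mk u%:~R s%:~R (- (4 * v))%:~R t%:~R).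
  by apply: Gp_Gamma04; [rewrite -[RHS]huv; ring|rewrite dvdzE abszN abszM dvdn_mulr].
have hd : u%:~R * t%:~R + 4 * v%:~R * s%:~R = 1 :> C.
  have := congr1 (fun n : int => n%:~R : C) huv; rewrite intrD !intrM -[RHS]/1 => e.
  by rewrite -[RHS]e; ring.
pose N := mk u%:~R s%:~R (- (4 * v))%:~R t%:~R *m ev (twist_word j).
have hN : Gp N by apply: (Gp_mul hrho) => //; exact: Gp_ev.
have -> : mk (1 + s%:~R * t%:~R * z) (- (s%:~R ^+ 2 * z)) (t%:~R ^+ 2 * z)
    (1 - s%:~R * t%:~R * z) = N *m mk 1 1 0 1 *m invmx N.
  have uN := Gp_unit hrho hN.
  have hdN := Gp_det hrho hN.
  have NE : N = mk (- (s%:~R * (z * P))) (s%:~R * (2 + z) * P - u%:~R * P)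
       (- (t%:~R * (z * P))) (t%:~R * (2 + z) * P + 4 * v%:~R * P).
    rewrite /N hW mk_mul; congr mk; ring.
  rewrite NE in hdN *; rewrite det_mk in hdN; rewrite invmx_mk // !mk_mul.
  have zP : (z * P) ^+ 2 = - z.
    by rewrite exprMn; transitivity (z * (P ^+ 2 * z)); [ring|rewrite hP; ring].
  congr mk.
  - transitivity (1 - s%:~R * t%:~R * (z * P) ^+ 2); first by rewrite zP; ring.
    by rewrite -[X in X - _]hdN; ring.
  - transitivity (s%:~R ^+ 2 * (z * P) ^+ 2); first by rewrite zP; ring.
    by ring.
  - transitivity (- (t%:~R ^+ 2 * (z * P) ^+ 2)); first by rewrite zP; ring.
    by ring.
  - transitivity (1 + s%:~R * t%:~R * (z * P) ^+ 2); first by rewrite zP; ring.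
    by rewrite -[X in X + _]hdN; ring.
apply: (Gp_mul hrho) => //; last exact: (Gp_inv hrho).
by apply: (Gp_mul hrho) => //; rewrite -(ev_a hrho); exact: Gp_ev.
Qed.

Lemma real_subfield : subfield (@Rc R).
Proof.
apply/subfieldP; rewrite /Rc /=; split=> [|x y|x y]; first exact: real1.
  exact: rpredB.
exact: rpred_div.
Qed.

(** For real z the square of the peripheral element is the translation by a real number [y], like a
    by 1. If [y] is irrational, these two generate arbitrarily small nonzero translations, against
    discreteness. If [y] is rational, a power of the one is a power of the other; the exponent sums,
    -8 and 1, give y = -8, hence z = 2, against P^2 z = -1 with P real. *)
Lemma z_nonreal : complex.Im z != 0.
Proof.
apply/eqP => z_real.
have z0 := z_neq0 hrho oddj.
have [P hP hW] := ev_twist hrho oddj.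
have Rz : @Rc R z by case: (z) z_real => a b /= ->; rewrite /Rc /= complex_real.
have /complex_realP[p PE] : @Rc R P.
  have := ev_subfield hrho real_subfield Rz (twist_word j) 0 1.
  by rewrite hW mkE /Rc /= rpredN.
have /complex_realP[x xE] := Rz.
have hpx : p ^+ 2 * x = -1.
  by apply: (@complexI R); rewrite rmorphM rmorphXn /= -PE -xE hP rmorphN.
have x0 : x != 0 by apply: contraNneq z0 => h; rewrite xE h.
pose y := - 4 - 8 / x.
pose v := ev_peripheral_word ++ ev_peripheral_word.
have hv : ev v = mk 1 y%:C 0 1.
  rewrite (ev_cat hrho) ev_peripheral mulmxN mulNmx opprK mk_mul; congr mk; try by ring.
  rewrite /y rmorphB rmorphN rmorphM fmorphV /= -xE !rmorph_nat; field.
  exact: z0.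
have [[r yE]|hy] := pselect (exists r : rat, y = ratr r).
  have yn : y * (denq r)%:~R = (numq r)%:~R.
    rewrite yE -{1}(divq_num_den r) fmorph_div /= !ratr_int mulfVK //.
    by rewrite intr_eq0 denq_neq0.
  have : ev (wpowz (denq r) v) = ev (wpowz (numq r) [:: la]).
    rewrite (ev_wpowz hrho hv) (ev_wpowz hrho (ev_a hrho)) mul1r.
    by rewrite -!(rmorph_int (real_complex R)) -rmorphM yn.
  move=> /(ev_inj_expo hrho); rewrite !expo_wpowz.
  have expo_w : expo (twist_word j) = -2.
    rewrite /twist_word oddj expo_cat.
    have -> : expo (flatten (nseq j./2 [:: lA; lB; la; lb])) = 0.
      elim: (j./2) => [|k IH] /=; first by rewrite /expo big_nil.
      by rewrite -cat1s -[lB :: _]cat1s -[la :: _]cat1s -[lb :: _]cat1s !expo_cat IH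
        /expo !big_cons !big_nil.
    by rewrite /expo !big_cons !big_nil.
  rewrite /v /ev_peripheral_word !expo_cat expo_rev expo_w {1}/expo big_cons big_nil /=.
  move=> hnd.
  have y8 : y = - 8.
    have d0 : (denq r)%:~R != 0 :> R by rewrite intr_eq0 denq_neq0.
    apply: (mulIf d0); rewrite yn.
    have -> : numq r = - 8 * denq r by lia.
    by rewrite intrM; congr (_ * _).
  have x2 : x = 2.
    have : 8 / x = 4 by move: y8; rewrite /y; lra.
    by move=> /(congr1 (fun u => u * x)); rewrite mulfVK //; lra.
  by move: hpx; rewrite x2; have := sqr_ge0 p; lra.
have [d d0 hd] := near1_trivial hrho.
have hyi : nonrational y by move=> r hr; case: hy; exists r.
pose n := Num.truncn d^-1.
have [a [a' [q [q' [_ hq _ hqy _]]]]] := good_convergents hyi n.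
have q_gt : d^-1 < q%:~R.
  have : n.+1%:R <= q%:~R :> R by rewrite -[n.+1%:R]/(n.+1%:~R) ler_int.
  by apply: lt_le_trans; exact: truncnS_gt.
have q0 : 0 < q%:~R :> R by apply: lt_trans q_gt; rewrite invr_gt0.
have hM : mk 1 ((q%:~R * y - a%:~R)%:C) 0 1 = 1%:M.
  apply: hd => [|i k].
    have -> : mk 1 ((q%:~R * y - a%:~R)%:C) 0 1 =
        mk 1 (y%:C * q%:~R) 0 1 *m mk 1 (- a)%:~R 0 1.
      rewrite mk_mul rmorphB rmorphM /= !rmorph_int rmorphN /=; congr mk; ring.
    apply: (Gp_mul hrho) => //; last exact: Gp_T.
    by apply: Gp_powU; rewrite -hv; exact: Gp_ev.
  apply: (@le_lt_trans _ _ (`|q%:~R * y - a%:~R|)); last first.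
    by apply: le_lt_trans hqy _; rewrite -[d]invrK ltf_pV2 ?posrE // invr_gt0.
  rewrite -mk1 !mxE; do 2![case: ifP => _];
    rewrite ?subrr ?subr0 ?(cn_real 0) ?normr0 ?normr_ge0 //.
  by rewrite cn_real.
have := congr1 (fun M : 'M[C]_2 => M 0 1) hM; rewrite -mk1 !mkE => -[] /eqP.
rewrite subr_eq0 => /eqP e.
case: hy; exists (a%:~R / q%:~R); rewrite fmorph_div /= !ratr_int -e mulrAC divff ?mul1r //.
by rewrite gt_eqF.
Qed.

End ParabolicElements.

(** * The trace field *)

Lemma Qadjoin_subfield (R : realType) (z : R[i]) : subfield (Qadjoin z).
Proof.
apply/subfieldP; split=> [F [/subfieldP[]]//|u v hu hv F hF|u v hu hv F hF].
  have /subfieldP[_ + _] := hF.1; apply; [exact: hu|exact: hv].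
have /subfieldP[_ _ +] := hF.1; apply; [exact: hu|exact: hv].
Qed.

Lemma ratrC (R : realType) (r : rat) : ratr r = (ratr r : R)%:C :> R[i].
Proof. by rewrite /ratr fmorph_div /= !rmorph_int. Qed.

Section RileyPolynomial.

(* riley k.+1 is the Riley polynomial of the twist knot with 2k+1 half-twists. *)
Fixpoint riley (n : nat) : {poly int} :=
  match n with
  | 0 => 1
  | n'.+1 => match n' with
             | 0 => 'X + 1
             | n''.+1 => ('X^2 + 2%:P) * riley n' - riley n''
             end
  end.

Lemma rileySS n : riley n.+2 = ('X^2 + 2%:P) * riley n.+1 - riley n.
Proof. by []. Qed.

Lemma riley_ind (Q : nat -> Prop) : Q 0%N -> Q 1%N ->
  (forall n, Q n -> Q n.+1 -> Q n.+2) -> forall n, Q n.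
Proof.
move=> Q0 Q1 QS n; suff [] : Q n /\ Q n.+1 by [].
by elim: n => [|n [h1 h2]]; split => //; apply: QS.
Qed.

Lemma riley_monic n : riley n.+1 \is monic /\ size (riley n.+1) = n.*2.+2.
Proof.
suff [] : [/\ riley n.+1 \is monic, size (riley n.+1) = n.*2.+2 &
           (size (riley n) <= n.*2.+2)%N] by [].
have m2 : ('X^2 + 2%:P : {poly int}) \is monic.
  by rewrite monicE lead_coefDl ?lead_coefXn // size_polyXn size_polyC.
have s2 : size ('X^2 + 2%:P : {poly int}) = 3%N.
  by rewrite size_polyDl ?size_polyXn // size_polyC.
elim: n => [|n [IH1 IH2 IH3]].
  have -> : riley 1 = 'X - (-1)%:P by rewrite polyCN opprK.
  by split; [exact: monicXsubC|exact: size_XsubC|rewrite size_poly1].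
have sM : size (('X^2 + 2%:P) * riley n.+1) = n.*2.+4.
  rewrite size_monicM ?s2 ?IH2 //; last by apply/monic_neq0.
have lt : (size (- riley n)%R < size (('X^2 + 2%:P) * riley n.+1)%R)%N.
  by rewrite sM size_polyN; apply: leq_ltn_trans IH3 _.
split; last by rewrite IH2; lia.
  rewrite rileySS monicE lead_coefDl // -monicE; by rewrite monicMl.
by rewrite rileySS size_polyDl // sM doubleS.
Qed.

Lemma riley0 n : (riley n).[0] = 1.
Proof.
by elim/riley_ind: n => [||n h1 h2]; rewrite ?rileySS ?hornerE ?h1 ?h2 //; ring.
Qed.

(** At 1 the recurrence reads f(n+2) = 3 f(n+1) - f(n), so modulo 3 the values are 1 and 2 up to
    sign. *)
Lemma riley1 n : ~~ (3 %| (riley n).[1])%Z.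
Proof.
elim/riley_ind: n => [||n h1 h2]; [by rewrite hornerE|by rewrite !hornerE|].
rewrite rileySS hornerD hornerN hornerM hornerD hornerXn hornerC expr1n.
set a := (riley n).[1]; set b := (riley n.+1).[1].
apply: contra h1 => /dvdzP[m hm]; apply/dvdzP.
by exists (b - m); lia.
Qed.

Variable R : realType.
Implicit Types z : R[i].

Definition rileyC n z : R[i] := (map_poly intr (riley n)).[z].

Lemma rileyC0 z : rileyC 0 z = 1.
Proof. by rewrite /rileyC /= rmorph1 hornerE. Qed.

Lemma rileyC1 z : rileyC 1 z = 1 + z.
Proof. by rewrite /rileyC /= rmorphD rmorph1 /= map_polyX !hornerE addrC. Qed.

Lemma rileyCSS n z : rileyC n.+2 z = (2 + z ^+ 2) * rileyC n.+1 z - rileyC n z.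
Proof.
rewrite /rileyC rileySS rmorphB rmorphM rmorphD /= map_polyXn map_polyC /=.
by rewrite hornerD hornerN hornerM hornerD hornerXn hornerC [z ^+ 2 + _]addrC.
Qed.

(* Im (f_{n+1} conj f_n) has the sign of Im z when Re z >= 0, because then
   Im (2 + z^2) does not have the opposite sign. *)
Lemma rileyC_neq0 z n : complex.Im z != 0 -> 0 <= complex.Re z -> rileyC n.+1 z != 0.
Proof.
move=> hi hr.
suff h : 0 < complex.Im z * complex.Im (rileyC n.+1 z * conjc (rileyC n z)).
  by apply/eqP => e; move: h; rewrite e mul0r /= mulr0 ltxx.
elim: n => [|n IH].
  rewrite rileyC0 rileyC1; case: z hi {hr} => x y /= hi.
  by rewrite !(mulr0, oppr0, mulr1, add0r) -expr2 exprn_even_gt0.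
rewrite rileyCSS; move: IH.
case: (rileyC n.+1 z) (rileyC n z) => [a b] [c d].
case: z hi hr => x y /= hi hr h.
set t := (X in _ < X).
have -> : t = y * (b * c - a * d) + 2 * x * y ^+ 2 * (a ^+ 2 + b ^+ 2).
  by rewrite /t; ring.
have := sqr_ge0 a; have := sqr_ge0 b; have := sqr_ge0 y => h1 h2 h3.
apply: ltr_pwDl; first by lra.
by apply: mulr_ge0; [apply: mulr_ge0 => //; lra|lra].
Qed.

End RileyPolynomial.

Section TraceField.
Variables (R : realType) (j : nat) (z : R[i]) (rho : twist_group j -> 'M[R[i]]_2).
Hypothesis hrho : hyperbolic_rep z rho.
Hypothesis oddj : odd j.
Local Notation C := R[i].

(** The polynomial computes the entry [w 0 0], which vanishes by [ev_twist]: its recurrence is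
    Cayley-Hamilton for the commutator, of trace 2 + z^2. *)
Lemma riley_root : rileyC j./2.+1 z = 0.
Proof.
have [P _ hW] := ev_twist hrho oddj.
have : ev rho (twist_word j) 0 0 = rileyC j./2.+1 z.
  have -> : ev rho (twist_word j) =
     ev rho comm_word ^+ j./2 *m mk (1 + z) (-1) (- z) 1.
    by rewrite /twist_word oddj -(twist_wordE hrho).
  rewrite (ev_comm hrho); set X := mk _ _ _ _.
  have X2 : X *m X = (2 + z ^+ 2) *: X - 1%:M.
    by rewrite mk_mul scale_mk -mk1 opp_mk; apply: mx2P; rewrite [RHS]mxE !mkE; ring.
  elim/riley_ind: (j./2) => [||n h1 h2].
  - by rewrite expr0 mul1mx rileyC1 mkE.
  - by rewrite expr1 mk_mul mkE rileyCSS rileyC1 rileyC0; ring.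
  - have XS : X ^+ n.+2 = (2 + z ^+ 2) *: X ^+ n.+1 - X ^+ n.
      by rewrite ![X ^+ _.+1]exprS mulrA -[X * X]/(X *m X) X2 mulrBl mul1r scalerAl.
    rewrite rileyCSS -h1 -h2 XS mulmxBl -scalemxAl; move: (X ^+ n.+1 *m _) (X ^+ n *m _).
    by move=> A B; rewrite mxE [X in X + _]mxE [X in _ + X]mxE.
by rewrite hW mkE => <-.
Qed.

(** The polynomial [p] = X^2 - 2 a X + b with root z divides the Riley polynomial; by Gauss's lemma
    its coefficients are integers and its constant term is a unit, so b = 1. Now Re z < 0 by
    [rileyC_neq0] and |Re z| < |z| = 1, so the integer -2 a lies strictly between 0 and 2. But X^2 +
    X + 1 takes the value 3 at 1, against [riley1]. *)
Lemma not_quadratic (a b : rat) : complex.Re z = ratr a ->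
  complex.Re z ^+ 2 + complex.Im z ^+ 2 = ratr b -> False.
Proof.
move=> hre hnorm.
have him := z_nonreal hrho oddj.
have re_lt0 : complex.Re z < 0.
  by rewrite ltNge; apply/negP => h; have := rileyC_neq0 (j./2) him h;
    rewrite riley_root eqxx.
set f := riley j./2.+1.
pose p : {poly rat} := 'X^2 - (2 * a) *: 'X + b%:P.
have zz : z ^+ 2 - ratr (2 * a) * z + ratr b = 0.
  have rC := ratrC R.
  have e2 : ratr (2 * a) = 2 * ratr a :> R by rewrite rmorphM /= ratr_nat.
  rewrite !rC e2 -hre -hnorm; case: (z) => x y /=.
  by apply/eqP; rewrite eq_complex /=; apply/andP; split; apply/eqP; rewrite ?expr2 /=; ring.
have sp : size p = 3%N.
  rewrite /p -addrA size_polyDl size_polyXn //.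
  apply: leq_ltn_trans (size_polyD _ _) _; rewrite gtn_max size_polyN.
  rewrite (leq_ltn_trans (size_scale_leq _ _)) ?size_polyX //.
  by rewrite (leq_ltn_trans (size_polyC_leq1 _)).
have p_root : (map_poly ratr p).[z] = 0.
  rewrite /p !rmorphD rmorphN /= map_polyXn map_polyZ map_polyX map_polyC /= !hornerE.
  exact: zz.
have p_dvd : p %| map_poly intr f.
  set F := map_poly intr f.
  have F_root : (map_poly ratr F).[z] = 0.
    rewrite -riley_root /rileyC /F -map_poly_comp; congr _.[z].
    by apply: eq_map_poly => n /=; rewrite ratr_int.
  apply/eqP; have sr : (size (F %% p)%R < 3)%N by rewrite -sp ltn_modp -size_poly_eq0 sp.
  have : (map_poly ratr (F %% p)).[z] = 0.
    have := F_root; rewrite {1}(divp_eq F p) rmorphD rmorphM /= hornerD hornerM p_root.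
    by rewrite mulr0 add0r.
  (* A remainder of degree at most 1 with rational coefficients that vanishes at the nonreal z is
     0. *)
  have -> : F %% p = ((F %% p)`_0)%:P + (F %% p)`_1 *: 'X.
    apply/polyP => -[|[|n]]; rewrite !coefE /= ?(mulr0, mulr1, addr0, add0r) //.
    by rewrite nth_default //; move: sr; rewrite ltnS => /leq_trans; apply.
  set c := (F %% p)`_0; set d := (F %% p)`_1.
  rewrite rmorphD /= map_polyZ map_polyX map_polyC /= !hornerE.
  have rC := ratrC R.
  rewrite !rC; case: (z) him => x y /= hy /eqP; rewrite eq_complex /= => /andP[/eqP h1 /eqP h2].
  have d0 : d = 0.
    move/eqP: h2; rewrite mul0r addr0 add0r mulf_eq0 (negPf hy) orbF.
    by rewrite fmorph_eq0 => /eqP.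
  move/eqP: h1; rewrite d0 rmorph0 !mul0r subr0 addr0 fmorph_eq0 => /eqP ->.
  by rewrite polyC0 scale0r addr0.
have [p1 [c c0 pE] [r fE]] := dvdpP_rat_int p_dvd.
have [fm fs] := riley_monic j./2.
have pc k : p`_k = c * (p1`_k)%:~R.
  by rewrite pE coefZ coef_map.
have p2 : p`_2 = 1 by rewrite /p !coefE /= !(mulr0, subr0, addr0).
have p1c : p`_1 = - (2 * a) by rewrite /p !coefE /= !(mulr1, sub0r, addr0).
have p0c : p`_0 = b by rewrite /p !coefE /= !(mulr0, subr0, add0r).
have sp1 : size p1 = 3%N.
  by rewrite -sp pE size_scale // size_map_inj_poly //; exact: intr_inj.
have lead1 : p1`_2 * lead_coef r = 1.
  have := fm; rewrite -/f fE monicE lead_coefM => /eqP <-.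
  by rewrite /lead_coef sp1.
have const1 : p1`_0 * r`_0 = 1.
  by have := riley0 j./2.+1; rewrite -/f fE hornerM !horner_coef0.
have unit1 (m n : int) : m * n = 1 -> m = 1 \/ m = -1.
  move=> mn; have : `|m|%N = 1%N.
    by apply/eqP; rewrite -dvdn1; apply/dvdnP; exists `|n|%N; lia.
  by lia.
have b0 : 0 < b.
  by rewrite -(ltr0q R) -hnorm ltr_wpDl ?sqr_ge0 // exprn_even_gt0.
have [e [e1 ce]] : exists e : int, (e = 1 \/ e = -1) /\ c = e%:~R /\ p1`_2 = e.
  have := pc 2; rewrite p2; have [h|h] := unit1 _ _ lead1; rewrite h => hc.
    by exists 1; split; [left|split=> //; rewrite hc mulr1].
  exists (-1); split; [by right|split=> //].
  by rewrite mulrN1z mulrN mulr1 in hc *; rewrite hc opprK.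
case: ce => ce e2.
have b1 : b = 1 /\ p1`_0 = e.
  have := pc 0; rewrite p0c ce.
  by case: e1 => ->; have [->|->] := unit1 _ _ const1; rewrite ?(mulr1, mul1r) => hb;
    rewrite hb in b0 *.
case: b1 => b1 e0.
have a1 : - (2 * a) = 1 /\ p1`_1 = e.
  have := pc 1; rewrite p1c ce.
  have : 0 < - (2 * a) < 2.
    have ha : a < 0 by rewrite -(ltrq0 R) -hre.
    have ha2 : a ^+ 2 < 1.
      have h1 : complex.Re z ^+ 2 + complex.Im z ^+ 2 = 1 by rewrite hnorm b1 rmorph1.
      have : complex.Re z ^+ 2 < 1 by rewrite -[ltRHS]h1 ltrDl exprn_even_gt0.
      by rewrite hre -rmorphXn /= -[1](rmorph1 (@ratr R)) ltr_rat.
    by apply/andP; split; nra.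
  move=> /andP[h1 h2] h3; rewrite h3 -intrM in h1 h2 *.
  have k1 : 0 < e * p1`_1 by move: h1; rewrite ltr0z.
  have k2 : e * p1`_1 < 2 by move: h2; rewrite -[X in _ < X]/(2%:~R) ltr_int.
  have ep : e * p1`_1 = 1 by lia.
  by rewrite ep; split=> //; move: ep; case: e1 => ->; lia.
case: a1 => _ e1'.
have : (3 %| (riley j./2.+1).[1])%Z.
  rewrite -/f fE hornerM; apply: dvdz_mulr.
  rewrite horner_coef sp1 !big_ord_recl big_ord0 /= !expr1n !mulr1 e0 e1' e2.
  by apply/dvdzP; exists e; ring.
by apply/negP; exact: riley1.
Qed.

(** The assumption on subfields is applied to the intersection of Q(z) with R, which is proper
    because z is not real. *)
Lemma real_Qadjoin_rat (x : C) :
  (forall F : set C, subfield F -> F `<=` Qadjoin z ->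
     F <> Qadjoin z -> F `<=` @Rc R -> F = @Qc R) ->
  Qadjoin z x -> complex.Im x = 0 -> exists r : rat, complex.Re x = ratr r.
Proof.
move=> hreal hx him; have hQ := @Qadjoin_subfield R z.
have /subfieldP[Q1 QB QD] := hQ; have /subfieldP[R1 RB RD] := @real_subfield R.
have e : Qadjoin z `&` @Rc R = @Qc R.
  apply: hreal.
  - apply/subfieldP; split=> [//|u v [h1 h2] [h3 h4]|u v [h1 h2] [h3 h4]].
      by split; [exact: QB|exact: RB].
    by split; [exact: QD|exact: RD].
  - by move=> u [].
  - move=> h; have : (Qadjoin z `&` @Rc R) z by rewrite h => F [_]; apply.
    case=> _; rewrite /Rc /=; have := z_nonreal hrho oddj.
    by case: (z) => u v /=; rewrite complex_real => /negPf ->.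
  - by move=> u [].
have : (Qadjoin z `&` @Rc R) x.
  by split=> //; case: x him {hx} => u v /= ->; rewrite /Rc /= complex_real.
rewrite e => -[r _ <-]; exists r.
by rewrite ratrC.
Qed.

End TraceField.

(** * Vertical half-planes and their stabilizers *)

Section HalfPlane.
Variable R : realType.
Implicit Types (m n : 'M[R]_2) (p q : R * R).

Definition hden m p : R := (m 1 0 * p.1 + m 1 1) ^+ 2 + (m 1 0 * p.2) ^+ 2.

(* The action of GL_2(R) on the upper half-plane, matrices of negative
   determinant acting by antiholomorphic maps. *)
Definition hp m p : R * R :=
  (((m 0 0 * p.1 + m 0 1) * (m 1 0 * p.1 + m 1 1) + m 0 0 * m 1 0 * p.2 ^+ 2)
     / hden m p,
   `|\det m| * p.2 / hden m p).

Lemma hden_gt0 m p : \det m != 0 -> 0 < p.2 -> 0 < hden m p.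
Proof.
rewrite det2 /hden => hd hp; have [c0|c0] := eqVneq (m 1 0) 0.
  rewrite c0 !mul0r add0r expr0n addr0 exprn_even_gt0 //=.
  by apply: contra_neq hd => ->; rewrite c0; ring.
by rewrite ltr_wpDl ?sqr_ge0 // exprn_even_gt0 //= mulf_neq0 // gt_eqF.
Qed.

Lemma hp_gt0 m p : \det m != 0 -> 0 < p.2 -> 0 < (hp m p).2.
Proof.
by move=> hd ht; rewrite /= divr_gt0 ?hden_gt0 // mulr_gt0 ?normr_gt0.
Qed.

Lemma hp1 p : hp 1%:M p = p.
Proof.
rewrite /hp /hden det1 normr1 -mk1 !mkE; case: p => x y /=.
by rewrite !(mul0r, mul1r, mulr0, addr0, add0r, expr0n, expr1n, divr1, mulr1).
Qed.

Lemma hpM m n p : \det m != 0 -> \det n != 0 -> 0 < p.2 ->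
  hp (m *m n) p = hp m (hp n p).
Proof.
move=> hm hn ht; have d1 := hden_gt0 hn ht.
have d3 : 0 < hden (m *m n) p by rewrite hden_gt0 // det_mulmx mulf_neq0.
have d10 : hden n p != 0 by rewrite gt_eqF.
have d30 : hden (m *m n) p != 0 by rewrite gt_eqF.
pose X := (n 0 0 * p.1 + n 0 1) * (n 1 0 * p.1 + n 1 1) + n 0 0 * n 1 0 * p.2 ^+ 2.
pose T := `|\det n| * p.2.
have T2 : T ^+ 2 = (n 0 0 * n 1 1 - n 0 1 * n 1 0) ^+ 2 * p.2 ^+ 2.
  by rewrite /T exprMn real_normK ?num_real // det2.
have e1 : hden (m *m n) p * hden n p =
    (m 1 0 * X + m 1 1 * hden n p) ^+ 2 + (m 1 0 * T) ^+ 2.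
  by rewrite exprMn T2 /X /hden !mul2E; ring.
have e2 : (((m *m n) 0 0 * p.1 + (m *m n) 0 1) * ((m *m n) 1 0 * p.1 + (m *m n) 1 1)
      + (m *m n) 0 0 * (m *m n) 1 0 * p.2 ^+ 2) * hden n p =
    (m 0 0 * X + m 0 1 * hden n p) * (m 1 0 * X + m 1 1 * hden n p) + m 0 0 * m 1 0 * T ^+ 2.
  by rewrite T2 /X /hden !mul2E; ring.
have e3 : hden m (hp n p) = hden (m *m n) p / hden n p.
  apply: (mulIf (mulf_neq0 d10 d10)); rewrite [RHS]mulrA mulfVK // e1.
  by rewrite /hden -/(hden n p) /= -/X -/T; field.
have e4 : (m 0 0 * (X / hden n p) + m 0 1) * (m 1 0 * (X / hden n p) + m 1 1)
      + m 0 0 * m 1 0 * (T / hden n p) ^+ 2 =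
    (((m *m n) 0 0 * p.1 + (m *m n) 0 1) * ((m *m n) 1 0 * p.1 + (m *m n) 1 1)
      + (m *m n) 0 0 * (m *m n) 1 0 * p.2 ^+ 2) / hden n p.
  apply: (mulIf (mulf_neq0 d10 d10)); rewrite [RHS]mulrA mulfVK // e2.
  by field.
rewrite {1}/hp {1}/hp e3 /= -/X -/T e4 det_mulmx normrM; congr (_, _).
  by field; rewrite d10.
by rewrite /T; field; rewrite d10.
Qed.

(* dd p q = 2 (cosh d(p, q) - 1) *)
Definition dd p q : R := ((p.1 - q.1) ^+ 2 + (p.2 - q.2) ^+ 2) / (p.2 * q.2).

Lemma dd_hp m p q : \det m != 0 -> 0 < p.2 -> 0 < q.2 ->
  dd (hp m p) (hp m q) = dd p q.
Proof.
move=> hm hp0 hq0.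
have H0 : hden m p != 0 by rewrite gt_eqF ?hden_gt0.
have K0 : hden m q != 0 by rewrite gt_eqF ?hden_gt0.
have d0 : `|\det m| != 0 by rewrite normr_eq0.
have p0 : p.2 != 0 by rewrite gt_eqF.
have q0 : q.2 != 0 by rewrite gt_eqF.
have d2 : `|\det m| ^+ 2 = (m 0 0 * m 1 1 - m 0 1 * m 1 0) ^+ 2.
  by rewrite real_normK ?num_real // det2.
pose X := (m 0 0 * p.1 + m 0 1) * (m 1 0 * p.1 + m 1 1) + m 0 0 * m 1 0 * p.2 ^+ 2.
pose Y := (m 0 0 * q.1 + m 0 1) * (m 1 0 * q.1 + m 1 1) + m 0 0 * m 1 0 * q.2 ^+ 2.
have e : (X * hden m q - Y * hden m p) ^+ 2 +
    `|\det m| ^+ 2 * (p.2 * hden m q - q.2 * hden m p) ^+ 2 =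
   `|\det m| ^+ 2 * ((p.1 - q.1) ^+ 2 + (p.2 - q.2) ^+ 2) * (hden m p * hden m q).
  by rewrite d2 /X /Y /hden; ring.
rewrite /dd /hp /= -/X -/Y.
apply: (mulIf (_ : `|\det m| ^+ 2 * (hden m p * hden m q) * (p.2 * q.2) != 0)).
  by rewrite !mulf_neq0 // expf_neq0.
transitivity ((X * hden m q - Y * hden m p) ^+ 2 +
    `|\det m| ^+ 2 * (p.2 * hden m q - q.2 * hden m p) ^+ 2).
  by field; rewrite H0 K0 d0 p0 q0.
by rewrite e; field; rewrite p0 q0.
Qed.

Lemma dd_near p q (e : R) : 0 < p.2 -> 0 < q.2 -> 0 < e <= 2^-1 ->
  dd p q <= e ^+ 2 -> q.2 = 1 -> `|p.1 - q.1| <= 2 * e /\ `|p.2 - q.2| <= 2 * e.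
Proof.
move=> hp0 hq0 /andP[e0 e1] hd q1; move: hd; rewrite /dd q1 mulr1 ler_pdivrMr // => hd.
have s1 := sqr_ge0 (p.1 - q.1); have s2 := sqr_ge0 (p.2 - 1).
have p4 : p.2 <= 4.
  rewrite leNgt; apply/negP => h.
  have : e ^+ 2 <= 4^-1 by rewrite expr2; nra.
  by move=> h2; nra.
have sq (x : R) : x ^+ 2 <= 4 * e ^+ 2 -> `|x| <= 2 * e.
  move=> h; rewrite -[leRHS]ger0_norm; last by lra.
  by rewrite -ler_sqr ?nnegrE // !real_normK ?num_real // exprMn; lra.
have h4 : e ^+ 2 * p.2 <= 4 * e ^+ 2 by have := sqr_ge0 e; nra.
by split; apply: sq; lra.
Qed.

End HalfPlane.

Section Hyperplanes.
Variable R : realType.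
Local Notation C := R[i].
Implicit Types (u zo : C) (g : 'M[C]_2) (m : 'M[R]_2).

Lemma sqnormE (x : C) : (sqnorm x)%:C = x * conjc x.
Proof.
by case: x => a b; rewrite /sqnorm /=; apply/eqP; rewrite eq_complex /= eqxx /=; apply/eqP; ring.
Qed.

Lemma sqnorm_gt0 (x : C) : x != 0 -> 0 < sqnorm x.
Proof.
by move=> x0; rewrite -ltcR sqnormE -sqr_normc exprn_gt0 // normr_gt0.
Qed.

Lemma sqnorm_ge0 (x : C) : 0 <= sqnorm x.
Proof. by rewrite -lecR sqnormE mulcJ_ge0. Qed.

Lemma complex_eta (x : C) : complex.Re x +i* complex.Im x = x.
Proof. by case: x. Qed.

Definition cmx m : 'M[C]_2 := map_mx (real_complex R) m.

(* Conjugation by frame zo u turns the half-plane vplane zo u into the standard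
   upper half-plane. *)
Definition frame zo u : 'M[C]_2 := mk u zo 0 1.

(** [M] is the matrix of [g] in the frame and may be complex, so [g] need not preserve the plane.
    This generality serves [stab_acts], where reality of [M] up to a factor is deduced from the
    formula. *)
Lemma hact_vparam_gen zo u g (M : 'M[C]_2) (p : R * R) :
  g *m frame zo u = frame zo u *m M ->
  let e := M 1 0 * p.1%:C + M 1 1 in
  let n := sqnorm e + sqnorm (M 1 0) * p.2 ^+ 2 in
  let w := (M 0 0 * p.1%:C + M 0 1) * conjc e + M 0 0 * conjc (M 1 0) * (p.2 ^+ 2)%:C in
  let Z := zo + u * (w / n%:C) in
  n != 0 ->
  hact g (vparam zo u p) = (complex.Re Z, complex.Im Z, Num.sqrt (sqnorm u) * (p.2 / n)).
Proof.
move=> hg e n w Z n0.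
have ent i k := congr1 (fun N : 'M[C]_2 => N i k) hg.
have := ent 0 0; have := ent 0 1; have := ent 1 0; have := ent 1 1.
rewrite !mul2E !mkE !(mulr1, mulr0, mul1r, mul0r, addr0, add0r).
move=> e11 e10 e01 e00.
rewrite /hact /vparam /= complex_eta.
set s := Num.sqrt _; set z := zo + p.1%:C * u.
have s2 : s ^+ 2 = sqnorm u by rewrite sqr_sqrtr // sqnorm_ge0.
have cz : g 1 0 * z + g 1 1 = e.
  by rewrite /e /z -e10 -e11; ring.
have az : g 0 0 * z + g 0 1 = u * (M 0 0 * p.1%:C + M 0 1) + zo * e.
  transitivity ((g 0 0 * u) * p.1%:C + (g 0 0 * zo + g 0 1)); first by rewrite /z; ring.
  by rewrite e00 e01 /e; ring.
have sM (x y : C) : sqnorm (x * y) = sqnorm x * sqnorm y.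
  by apply: complexI; rewrite rmorphM /= !sqnormE rmorphM /=; ring.
have nE : sqnorm e + sqnorm (g 1 0) * (s * p.2) ^+ 2 = n.
  by rewrite exprMn s2 mulrA -sM e10.
rewrite cz nE az.
have nC : n%:C = e * conjc e + M 1 0 * conjc (M 1 0) * (p.2 ^+ 2)%:C.
  by rewrite /n rmorphD rmorphM /= !sqnormE.
have nC0 : n%:C != 0 :> C by apply: contra n0 => /eqP/complexI/eqP.
have wE : (u * (M 0 0 * p.1%:C + M 0 1) + zo * e) * conjc e +
   g 0 0 * conjc (g 1 0) * ((s * p.2) ^+ 2)%:C = n%:C * Z.
  have -> : g 0 0 * conjc (g 1 0) * ((s * p.2) ^+ 2)%:C =
     (g 0 0 * u) * conjc (g 1 0 * u) * (p.2 ^+ 2)%:C.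
    by rewrite exprMn s2 rmorphM /= sqnormE rmorphM /=; ring.
  have -> : n%:C * Z = n%:C * zo + u * w.
    by rewrite /Z mulrDr mulrCA [_ * (w / _)]mulrC mulfVK.
  by rewrite e00 e10 nC /w; ring.
rewrite wE -mulrA; have re_mul (x : R) (y : C) : complex.Re (x%:C * y) = x * complex.Re y.
  by case: y => a b /=; ring.
have im_mul (x : R) (y : C) : complex.Im (x%:C * y) = x * complex.Im y.
  by case: y => a b /=; ring.
by rewrite re_mul im_mul ![n * _ / n]mulrAC !mulfV // !mul1r.
Qed.

Lemma vparam_inj zo u (p q : R * R) : u != 0 -> vparam zo u p = vparam zo u q -> p = q.
Proof.
move=> u0 [h1 h2 h3].
have s0 : Num.sqrt (sqnorm u) != 0 by rewrite sqrtr_eq0 -ltNge sqnorm_gt0.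
have : zo + p.1%:C * u = zo + q.1%:C * u.
  by rewrite -[LHS]complex_eta -[RHS]complex_eta h1 h2.
move=> /addrI /(mulIf u0) /complexI h4; move/(mulfI s0): h3.
by case: p q {h1 h2} h4 => [a b] [c d] /= -> ->.
Qed.

(* iota is 1 when g preserves the sides of the hyperplane, and i otherwise. *)
Definition acts_as zo u g (iota : C) m : Prop :=
  (iota = 1 \/ iota = 'i) /\ g *m frame zo u = iota *: (frame zo u *m cmx m).

Lemma acts_as_det zo u g iota m : u != 0 -> \det g = 1 -> acts_as zo u g iota m ->
  `|\det m| = 1.
Proof.
move=> u0 hg [hi /(congr1 determinant)].
rewrite detZ !det_mulmx hg det_mk mulr1 mulr0 subr0 mul1r det_map_mx => e.
have {e} : 1 = iota ^+ 2 * (\det m)%:C by apply: (mulfI u0); rewrite mulr1 [in LHS]e; ring.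
case: hi => ->; first by rewrite expr1n mul1r => -[] <-; rewrite normr1.
rewrite sqr_i mulN1r -rmorphN => -[] e.
by rewrite -normrN -e normr1.
Qed.

Lemma hact_vparam zo u g iota m (p : R * R) : u != 0 -> \det g = 1 ->
  acts_as zo u g iota m -> 0 < p.2 -> hact g (vparam zo u p) = vparam zo u (hp m p).
Proof.
move=> u0 hg ham ht; have hdet := acts_as_det u0 hg ham.
have dm0 : \det m != 0 by rewrite -normr_eq0 hdet oner_eq0.
case: ham => hi hgm.
have ii : iota * conjc iota = 1.
  case: hi => ->; first by rewrite conjc1 mulr1.
  by apply/eqP; rewrite eq_complex /=; apply/andP; split; apply/eqP; ring.
have := @hact_vparam_gen zo u g (iota *: cmx m) p.
rewrite hgm -scalemxAr => /(_ erefl) /=; rewrite !mxE.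
have sM (x y : C) : sqnorm (x * y) = sqnorm x * sqnorm y.
  by apply: complexI; rewrite rmorphM /= !sqnormE rmorphM /=; ring.
have si : sqnorm iota = 1 by apply: complexI; rewrite sqnormE ii.
have sR (x : R) : sqnorm x%:C = x ^+ 2.
  by apply: complexI; rewrite sqnormE conjc_real rmorphXn /= expr2.
have eE : iota * (m 1 0)%:C * p.1%:C + iota * (m 1 1)%:C = iota * (m 1 0 * p.1 + m 1 1)%:C.
  by rewrite rmorphD rmorphM /=; ring.
have fE : iota * (m 0 0)%:C * p.1%:C + iota * (m 0 1)%:C = iota * (m 0 0 * p.1 + m 0 1)%:C.
  by rewrite rmorphD rmorphM /=; ring.
rewrite eE fE !sM si !mul1r !sR -exprMn -/(hden m p).
have d0 : hden m p != 0 by rewrite gt_eqF ?hden_gt0.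
move=> /(_ d0) ->.
rewrite /vparam.
have -> : (iota * (m 0 0 * p.1 + m 0 1)%:C * conjc (iota * (m 1 0 * p.1 + m 1 1)%:C) +
   iota * (m 0 0)%:C * conjc (iota * (m 1 0)%:C) * (p.2 ^+ 2)%:C) / (hden m p)%:C =
   ((hp m p).1)%:C.
  have cj (x : R) : conjc (iota * x%:C) = conjc iota * x%:C by rewrite rmorphM; congr (_ * _); exact: conjc_real.
  rewrite !cj /hp /= fmorph_div rmorphD !rmorphM /=; congr (_ / _).
  rewrite -[RHS]mul1r -ii -!(rmorphM (real_complex R)); ring.
by rewrite [(hp m p).1%:C * u]mulrC /hp hdet mul1r.
Qed.

End Hyperplanes.

Section Stabilizers.
Variable R : realType.
Local Notation C := R[i].
Implicit Types (u : C) (g : 'M[C]_2) (m : 'M[R]_2).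

Lemma cmxM m n : cmx (m *m n) = cmx m *m cmx n.
Proof. exact: map_mxM. Qed.

Lemma hpN m (p : R * R) : hp (- m) p = hp m p.
Proof.
rewrite /hp /hden !det2 !mxE; congr (_ / _, _ / _); try by ring.
by congr (`| _ | * _); ring.
Qed.

Lemma frame_unit zo u : u != 0 -> frame zo u \in unitmx.
Proof. by move=> u0; rewrite unitmxE det_mk mulr1 mulr0 subr0 unitfE. Qed.

Lemma acts_as1 zo u : acts_as zo u 1%:M 1 1%:M.
Proof.
by split; [left|rewrite /cmx map_mx1 mul1mx mulmx1 scale1r].
Qed.

(** Two elements exchanging the sides give the factor i * i = -1; this sign is moved into the real
    matrix, where [hp] does not see it. *)
Lemma acts_as_mul zo u g h i k m n : acts_as zo u g i m -> acts_as zo u h k n ->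
  exists l s, acts_as zo u (g *m h) l s /\ forall p, hp s p = hp (m *m n) p.
Proof.
move=> [hi hg] [hk hh].
have e : (g *m h) *m frame zo u = (i * k) *: (frame zo u *m cmx (m *m n)).
  by rewrite -mulmxA hh -scalemxAr mulmxA hg -scalemxAl scalerA -mulmxA -cmxM mulrC.
have [hik|hik] : (i * k = 1 \/ i * k = 'i) \/ i * k = -1.
  by case: hi hk => -> [] ->; rewrite ?mul1r ?mulr1; [left; left|left; right|left; right|
    right; rewrite -expr2 sqr_i].
  by exists (i * k), (m *m n).
exists 1, (- (m *m n)); split; last by move=> p; rewrite hpN.
split; first by left.
rewrite e hik /cmx (map_mxN (real_complex R)) mulmxN scale1r.
by rewrite scaleN1r.
Qed.

Lemma acts_as_inv zo u g i m : u != 0 -> \det g = 1 -> acts_as zo u g i m ->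
  exists l s, acts_as zo u (invmx g) l s /\ forall p, hp s p = hp (invmx m) p.
Proof.
move=> u0 hg ham; have hdet := acts_as_det u0 hg ham; case: ham => hi hgm.
have um : m \in unitmx by rewrite unitmxE unitfE -normr_eq0 hdet oner_eq0.
have ug : g \in unitmx by rewrite unitmxE hg unitr1.
have ucm : cmx m \in unitmx by rewrite map_unitmx.
have i0 : i != 0 by case: hi => ->; rewrite ?oner_eq0 // eq_complex /= oner_eq0 andbF.
have e : invmx g *m frame zo u = i^-1 *: (frame zo u *m cmx (invmx m)).
  by rewrite (intertwine_inv ug ucm i0 hgm) /cmx map_invmx.
case: hi => hi.
  exists 1, (invmx m); split=> //; split; first by left.
  by rewrite e hi invr1.
exists 'i, (- invmx m); split; last by move=> p; rewrite hpN.
split; first by right.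
rewrite e hi /cmx (map_mxN (real_complex R)) mulmxN scalerN -scaleNr; congr (_ *: _).
by apply: (mulfI (_ : 'i%C != 0)); rewrite -?hi // mulfV // hi mulrN -expr2 sqr_i opprK.
Qed.

(** The number e = conj(a) d - b conj(c) satisfies conj(x) = x e for each entry x, is real and has
    square 1. For e = 1 all entries are real, for e = -1 all are imaginary. *)
Lemma real_or_imaginary (a b c d : C) : a * d - b * c = 1 ->
  complex.Im (a * conjc c) = 0 -> complex.Im (b * conjc d) = 0 ->
  complex.Im (a * conjc d + b * conjc c) = 0 ->
  exists (iota : C) m, (iota = 1 \/ iota = 'i) /\ mk a b c d = iota *: cmx m.
Proof.
move=> hd h1 h2 h3.
have realP (x : C) : complex.Im x = 0 -> conjc x = x.
  by case: x => p q /= ->; rewrite oppr0.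
have {}h1 := realP _ h1; have {}h2 := realP _ h2; have {}h3 := realP _ h3.
rewrite !(rmorphD, rmorphM) /= !conjcK in h1 h2 h3.
pose e := conjc a * d - b * conjc c.
have h3' : e = a * conjc d - conjc b * c.
  by apply/eqP; rewrite /e -subr_eq0; apply/eqP; move/eqP: h3; rewrite -subr_eq0 => /eqP <-; ring.
have ea : conjc a = a * e.
  rewrite -[LHS]mulr1 -hd /e; transitivity (a * (conjc a * d) - (conjc a * c) * b); first by ring.
  by rewrite h1; ring.
have ec : conjc c = c * e.
  rewrite -[LHS]mulr1 -hd /e; transitivity ((a * conjc c) * d - b * c * conjc c); first by ring.
  by rewrite -h1; ring.
have ed : conjc d = d * e.
  rewrite -[LHS]mulr1 -hd h3'; transitivity (d * (a * conjc d) - (b * conjc d) * c); first by ring.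
  by rewrite -h2; ring.
have eb : conjc b = b * e.
  rewrite -[LHS]mulr1 -hd h3'; transitivity ((conjc b * d) * a - b * c * conjc b); first by ring.
  by rewrite h2; ring.
have ee : conjc e = e.
  by rewrite {2}h3' /e rmorphB !rmorphM /= !conjcK.
have e2 : e ^+ 2 = 1.
  have sq (x : C) : conjc x = x * e -> x * e ^+ 2 = x.
    by move=> hx; rewrite -[RHS]conjcK hx rmorphM /= hx ee expr2 mulrA.
  rewrite -[LHS]mul1r -{1}hd mulrBl.
  by rewrite [a * d]mulrC -!mulrA (sq _ ea) (sq _ ec) [d * a]mulrC hd.
have : (e - 1) * (e + 1) == 0.
  have -> : (e - 1) * (e + 1) = e ^+ 2 - 1 by ring.
  by rewrite e2 subrr.
rewrite mulf_eq0 subr_eq0 addr_eq0 => /orP[/eqP e1|/eqP e1].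
  have rl (x : C) : conjc x = x * e -> (complex.Re x)%:C = x.
    rewrite e1 mulr1; case: x => p q [] /eqP.
    by rewrite eq_sym -subr_eq0 opprK -mulr2n mulrn_eq0 /= => /eqP ->.
  exists 1, (mk (complex.Re a) (complex.Re b) (complex.Re c) (complex.Re d)).
  by split; [left|rewrite scale1r /cmx map_mk /= !rl].
have im (x : C) : conjc x = x * e -> 'i * (complex.Im x)%:C = x.
  rewrite e1 mulrN1; case: x => p q [] /eqP.
  rewrite -subr_eq0 opprK -mulr2n mulrn_eq0 /= => /eqP ->.
  by apply/eqP; rewrite eq_complex /=; apply/andP; split; apply/eqP; ring.
exists 'i, (mk (complex.Im a) (complex.Im b) (complex.Im c) (complex.Im d)).
by split; [right|rewrite /cmx map_mk scale_mk /= !im].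
Qed.

Lemma stab_acts zo u g : u != 0 -> \det g = 1 ->
  hact g @` vplane zo u = vplane zo u <-> exists i m, acts_as zo u g i m.
Proof.
move=> u0 hg; split=> [hst|[i [m ham]]]; last first.
  have hdet := acts_as_det u0 hg ham.
  have m0 : \det m != 0 by rewrite -normr_eq0 hdet oner_eq0.
  apply/seteqP; split=> [_ [_ [p hp0 <-] <-]|_ [p hp0 <-]].
    by exists (hp m p); [exact: hp_gt0|rewrite (hact_vparam u0 hg ham)].
  have mi0 : \det (invmx m) != 0 by rewrite det_inv invr_eq0.
  exists (vparam zo u (hp (invmx m) p)).
    by exists (hp (invmx m) p) => //; exact: hp_gt0.
  rewrite (hact_vparam u0 hg ham); last exact: hp_gt0.
  by rewrite -hpM // mulmxV ?hp1 // unitmxE unitfE.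
have uf := frame_unit zo u0.
pose M := invmx (frame zo u) *m g *m frame zo u.
have hM : g *m frame zo u = frame zo u *m M by rewrite /M !mulmxA mulmxV // mul1mx.
have detM : M 0 0 * M 1 1 - M 0 1 * M 1 0 = 1.
  by rewrite -det2 /M !det_mulmx hg mulr1 det_inv mulVf //.
have key (x t : R) : 0 < t -> complex.Im ((M 0 0 * x%:C + M 0 1) * conjc (M 1 0 * x%:C + M 1 1)
    + M 0 0 * conjc (M 1 0) * (t ^+ 2)%:C) = 0.
  move=> t0; have := hact_vparam_gen (p := (x, t)) hM; rewrite /=.
  set e := M 1 0 * x%:C + M 1 1; set n := sqnorm e + _; set w := _ + _ * (t ^+ 2)%:C.
  have n0 : n != 0.
    have [c0|c0] := eqVneq (M 1 0) 0.
      have e0 : e != 0.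
        rewrite /e c0 mul0r add0r; apply: contra_eq_neq detM => ->.
        by rewrite c0 !mulr0 subr0 eq_sym oner_eq0.
      by rewrite gt_eqF // /n ltr_pwDl ?sqnorm_gt0 // mulr_ge0 ?sqnorm_ge0 ?sqr_ge0.
    by rewrite gt_eqF // ltr_wpDl ?sqnorm_ge0 // mulr_gt0 ?sqnorm_gt0 ?exprn_gt0.
  move=> /(_ n0) hE.
  have : vplane zo u (hact g (vparam zo u (x, t))).
    by rewrite -hst; exists (vparam zo u (x, t)) => //; exists (x, t).
  rewrite hE => -[[y s] /= _ []]; rewrite /vparam /= => h1 h2 _.
  have : zo + y%:C * u = zo + u * (w / n%:C).
    by rewrite -[LHS]complex_eta -[RHS]complex_eta h1 h2.
  move=> /addrI; rewrite mulrC => /(mulfI u0) hw.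
  have -> : w = (y * n)%:C.
    rewrite rmorphM /= hw mulfVK //.
    by apply: contra n0 => /eqP/complexI/eqP.
  by [].
(* The expression is a polynomial in x and t; the three points (0, 1), (0, 2) and (1, 1) suffice to
   separate its coefficients. *)
have := key 0 1 ltr01; have := key 0 2 (ltr0n _ 2); have := key 1 1 ltr01.
rewrite !mulr0 !mulr1 !add0r expr1n !mulr1 => k1 k2 k3.
have ac : complex.Im (M 0 0 * conjc (M 1 0)) = 0.
  move: k2 k3; case: (M 0 0 * _) => p q; case: (M 0 1 * _) => p' q' /=.
  by rewrite !mulr0 add0r => h1 h2; lra.
have bd : complex.Im (M 0 1 * conjc (M 1 1)) = 0.
  by move: ac k3; case: (M 0 0 * _) => p q; case: (M 0 1 * _) => p' q' /=; lra.
have ad : complex.Im (M 0 0 * conjc (M 1 1) + M 0 1 * conjc (M 1 0)) = 0.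
  have e : (M 0 0 + M 0 1) * conjc (M 1 0 + M 1 1) + M 0 0 * conjc (M 1 0) =
     (M 0 0 * conjc (M 1 1) + M 0 1 * conjc (M 1 0)) +
     (M 0 0 * conjc (M 1 0) + M 0 0 * conjc (M 1 0)) + M 0 1 * conjc (M 1 1).
    by rewrite rmorphD /=; ring.
  move: ac bd k1; rewrite e; case: (M 0 0 * conjc (M 1 0)) => p q.
  case: (M 0 1 * conjc (M 1 1)) => p' q'.
  by case: (M 0 0 * conjc (M 1 1) + M 0 1 * conjc (M 1 0)) => p'' q'' /=; lra.
have [i [m [hi hm]]] := real_or_imaginary detM ac bd ad.
by exists i, m; split => //; rewrite hM [M]mk_eta hm -scalemxAr.
Qed.

End Stabilizers.

(** * Measurable fundamental domains *)

Section MeasurableDomains.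
Variable R : realType.
Implicit Types (m : 'M[R]_2) (p q : R * R).
Local Notation leb := (@lebesgue_measure R).

Definition upper : set (R * R) := [set p | 0 < p.2].

(** The power with exponent -1 agrees with the inverse on all nonnegative reals, 0 included. *)
Lemma measurable_fun_invr d (T : measurableType d) (f : T -> R) :
  (forall x, 0 <= f x) -> measurable_fun setT f -> measurable_fun setT (fun x => (f x)^-1).
Proof.
move=> f0 mf; rewrite (_ : (fun x => _) = (@powR R ^~ (-1)) \o f).
  by apply: measurableT_comp => //; exact: measurable_powR.
by apply/funext => x /=; rewrite powR_inv1.
Qed.

Lemma measurable_hp m : measurable_fun [set: R * R] (hp m).
Proof.
have aff (a b : R) : measurable_fun [set: R * R] (fun p => a * p.1 + b).
  by apply: measurable_funD => //; apply: measurable_funM.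
have sc (a : R) : measurable_fun [set: R * R] (fun p => a * p.2).
  by apply: measurable_funM.
have mV : measurable_fun [set: R * R] (fun p => (hden m p)^-1).
  apply: measurable_fun_invr => [p|]; first by rewrite addr_ge0 ?sqr_ge0.
  by apply: measurable_funD; apply: measurable_funX.
apply: measurable_fun_pair; apply: measurable_funM => //.
apply: measurable_funD; first exact: measurable_funM.
by apply: measurable_funM => //; apply: measurable_funX.
Qed.

Lemma measurable_upper : measurable upper.
Proof.
rewrite (_ : upper = (fun p => 0 < p.2) @^-1` [set true]).
  by rewrite -[X in measurable X]setTI; apply: measurable_fun_ltr => //.
by apply/seteqP; split=> p /=.
Qed.

Lemma measurable_eq_fun2 (f g : R * R -> R * R) :
  measurable_fun setT f -> measurable_fun setT g -> measurable [set p | f p = g p].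
Proof.
move=> /measurable_fun_pairP[f1 f2] /measurable_fun_pairP[g1 g2].
rewrite (_ : [set p | _] = ((fun p => (f p).1 == (g p).1) @^-1` [set true]) `&`
   ((fun p => (f p).2 == (g p).2) @^-1` [set true])).
  apply: measurableI; rewrite -[X in measurable X]setTI.
    exact: (measurable_fun_eqr f1 g1).
  exact: (measurable_fun_eqr f2 g2).
apply/seteqP; split=> p /= => [->|[]]; first by rewrite !eqxx.
by move=> /eqP h1 /eqP h2; rewrite [LHS]surjective_pairing h1 h2 -surjective_pairing.
Qed.

Section Selection.
Variables (mm : nat -> 'M[R]_2) (V : nat -> set (R * R)).
Hypothesis mm_det : forall a, \det (mm a) != 0.
Hypothesis mm_mul : forall a b, exists c, forall p, upper p ->
  hp (mm c) p = hp (mm a) (hp (mm b) p).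
Hypothesis mm_one : exists c, forall p, upper p -> hp (mm c) p = p.
Hypothesis mm_inv : forall a, exists c, forall p, upper p -> hp (mm c) (hp (mm a) p) = p.
Hypothesis V_meas : forall n, measurable (V n).
Hypothesis V_isol : forall p, upper p ->
  exists n, V n p /\ forall k, V n (hp (mm k) p) -> hp (mm k) p = p.

Definition singled n p : Prop :=
  exists a, V n (hp (mm a) p) /\ forall b, V n (hp (mm b) p) -> hp (mm b) p = hp (mm a) p.

(* From each orbit, the point singled out by the first V_n that meets the orbit
   in exactly one point. *)
Definition selection : set (R * R) :=
  [set p | upper p /\ exists n, [/\ V n p, singled n p & forall k, (k < n)%N -> ~ singled k p]].

Lemma upper_hp a p : upper p -> upper (hp (mm a) p).
Proof. by move=> hp0; apply: hp_gt0. Qed.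

(** Being singled out depends on the orbit only, as the maps [hp (mm k)] form a group on [upper]. *)
Lemma singled_hp n a p : upper p -> singled n (hp (mm a) p) <-> singled n p.
Proof.
move=> up; split=> -[b [h1 h2]].
  have [c hc] := mm_mul b a; exists c; rewrite hc //; split=> // d.
  have [a' ha'] := mm_inv a; have [e he] := mm_mul d a'.
  have -> : hp (mm d) p = hp (mm e) (hp (mm a) p).
    by rewrite he ?ha' //; exact: upper_hp.
  exact: h2.
have [a' ha'] := mm_inv a; have [e he] := mm_mul b a'.
have ee : hp (mm e) (hp (mm a) p) = hp (mm b) p.
  by rewrite he ?ha' //; exact: upper_hp.
exists e; rewrite ee; split=> // d.
by have [c hc] := mm_mul d a; rewrite -hc //; exact: h2.
Qed.

Lemma selectionP p : upper p ->
  exists! q, selection q /\ exists k, q = hp (mm k) p.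
Proof.
move=> up.
have [c hc] := mm_one.
have ex : exists n, `[< singled n p >].
  have [n [h1 h2]] := V_isol up; exists n; apply/asboolP.
  by exists c; rewrite hc //; split.
case: (ex_minnP ex) => n /asboolP[a [h1 h2]] hmin.
exists (hp (mm a) p); split.
  split; last by exists a.
  split; first exact: upper_hp.
  exists n; split=> //; first by apply/singled_hp => //; exists a.
  move=> k kn; rewrite singled_hp // => /asboolP/hmin.
  by rewrite leqNgt kn.
move=> q [[uq [n' [hV hs hm]]] [k qE]]; subst q.
have {}hs := (singled_hp n' _ up).1 hs.
have nn : n' = n.
  apply/eqP; rewrite eqn_leq; apply/andP; split; last exact/hmin/asboolP.
  rewrite leqNgt; apply/negP => /hm; rewrite singled_hp //; apply.
  by exists a.
by rewrite nn in hV; rewrite (h2 _ hV).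
Qed.

(** Index 0 has priority over all others, which permits forcing a prescribed set into the domain. *)
Lemma selection0 p : upper p -> V 0 p ->
  (forall k, V 0 (hp (mm k) p) -> hp (mm k) p = p) -> selection p.
Proof.
move=> up hV h; split=> //; exists 0%N; split=> //.
by have [c hc] := mm_one; exists c; rewrite hc //.
Qed.

Lemma measurable_selection : measurable selection.
Proof.
have ms n : measurable [set p | singled n p].
  rewrite (_ : [set p | _] = \bigcup_a ((hp (mm a) @^-1` V n) `&` \bigcap_b
     (~` (hp (mm b) @^-1` V n) `|` [set p | hp (mm b) p = hp (mm a) p]))).
    have mpre b : measurable (hp (mm b) @^-1` V n).
      by rewrite -[X in measurable X]setTI; exact: measurable_hp.
    apply: bigcupT_measurable => a; apply: measurableI => //.
    apply: bigcapT_measurable => b; apply: measurableU; first exact: measurableC.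
    by apply: measurable_eq_fun2; exact: measurable_hp.
  apply/seteqP; split=> p /=.
    move=> [a [h1 h2]]; exists a => //; split=> // b _ /=.
    by have [h|h] := pselect (V n (hp (mm b) p)); [right; exact: h2|left].
  move=> [a _ [h1 h2]]; exists a; split=> // b hb.
  by have [] := h2 b I.
rewrite (_ : selection = upper `&` \bigcup_n (V n `&` [set p | singled n p] `&`
   \bigcap_k (if (k < n)%N then ~` [set p | singled k p] else setT))).
  apply: measurableI; first exact: measurable_upper.
  apply: bigcupT_measurable => n; apply: measurableI; first exact: measurableI.
  by apply: bigcapT_measurable => k; case: ifP => // _; exact: measurableC.
apply/seteqP; split=> p /=.
  move=> [up [n [h1 h2 h3]]]; split=> //; exists n => //; split=> // k _.
  by case: ifP => // /h3.
move=> [up [n _ [[h1 h2] h3]]]; split=> //; exists n; split=> // k kn.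
by have := h3 k I; rewrite kn.
Qed.

End Selection.

(** All lengths are proportional to the height [y], so up to translations and dilations, which are
    isometries, the box depends on [d] alone. *)
Definition box (d x y : R) : set (R * R) :=
  `[x - d * y, x + d * y]%classic `*` `[y, (1 + d) * y]%classic.

Lemma measurable_box d x y : measurable (box d x y).
Proof. by apply: measurableX; exact: measurable_itv. Qed.

(** The density is smallest on the top edge, at height (1 + d) y, and the Euclidean area is 2 d^2
    y^2. *)
Lemma area_box d x y : 0 < d -> 0 < y ->
  ((2 * d ^+ 2 / (1 + d) ^+ 2)%:E <= \int[leb \x leb]_(q in box d x y) (q.2 ^- 2)%:E)%E.
Proof.
move=> d0 y0.
have mf : measurable_fun (box d x y) (fun q => (q.2 ^- 2)%:E : \bar R).
  apply/measurable_EFinP; apply: measurable_funS (measurableT) _ _ => //.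
  by apply: measurable_fun_invr => [q|]; [exact: sqr_ge0|exact: measurable_funX].
have dy : 0 < d * y by rewrite mulr_gt0.
have d1y : 0 < (1 + d) * y by rewrite mulr_gt0 // addr_gt0.
apply: (@le_trans _ _ (\int[leb \x leb]_(q in box d x y) (cst (((1 + d) * y) ^- 2)%:E) q)%E).
  rewrite integral_cst; last exact: measurable_box.
  have hI (a b : R) : a < b -> leb `[a, b]%classic = (b - a)%:E.
    by move=> ab; rewrite lebesgue_measure_itv /= lte_fin ab EFinB.
  rewrite [X in (_ * X)%E](_ : _ = ((x + d * y - (x - d * y)) * ((1 + d) * y - y))%:E);
    last first.
    rewrite [LHS]product_measure1E; [|exact: measurable_itv|exact: measurable_itv].
    by rewrite EFinM; congr (_ * _)%E; apply: hI; lra.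
  rewrite -EFinM lee_fin le_eqVlt; apply/orP; left; apply/eqP.
  by field; apply/andP; split; rewrite gt_eqF // addr_gt0.
apply: ge0_le_integral => //.
- exact: measurable_box.
- by move=> q _; rewrite /= lee_fin invr_ge0 sqr_ge0.
- move=> [a b] [_ /=]; rewrite in_itv /= => /andP[h1 h2].
  have b0 : 0 < b by apply: lt_le_trans h1.
  rewrite lee_fin lef_pV2 ?posrE ?exprn_gt0 //.
  by rewrite ler_sqr // nnegrE ltW.
Qed.

Lemma infinite_area (D : set (R * R)) (d : R) (x y : nat -> R) : 0 < d ->
  (forall i, 0 < y i) -> measurable D -> trivIset setT (fun i => box d (x i) (y i)) ->
  (forall i, box d (x i) (y i) `<=` D) ->
  (\int[leb \x leb]_(q in D) (q.2 ^- 2)%:E = +oo)%E.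
Proof.
move=> d0 y0 mD tB sB; apply/eqP; rewrite -leye_eq.
have mf A : measurable_fun A (fun q : R * R => (q.2 ^- 2)%:E : \bar R).
  apply/measurable_EFinP; apply: measurable_funS (measurableT) _ _ => //.
  by apply: measurable_fun_invr => [q|]; [exact: sqr_ge0|exact: measurable_funX].
have f0 (q : R * R) : (0 <= (q.2 ^- 2)%:E :> \bar R)%E.
  by rewrite lee_fin invr_ge0 sqr_ge0.
have mB i : measurable (box d (x i) (y i)) by exact: measurable_box.
apply: (@le_trans _ _ (\int[leb \x leb]_(q in \bigcup_i box d (x i) (y i)) (q.2 ^- 2)%:E)%E);
  last first.
  apply: ge0_subset_integral => //; first exact: bigcupT_measurable.
    exact: mf.
  by move=> q [i _ hq]; exact: (sB i).
rewrite ge0_integral_bigcup //; last exact: mf.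
set c := 2 * d ^+ 2 / (1 + d) ^+ 2.
have c0 : 0 < c by rewrite divr_gt0 ?mulr_gt0 ?exprn_gt0 // addr_gt0.
set u := fun i => (\int[leb \x leb]_(q in box d (x i) (y i)) (q.2 ^- 2)%:E)%E.
have hu i : (c%:E <= u i)%E by exact: area_box.
have key n : ((c * n%:R)%:E <= \sum_(i <oo) u i)%E.
  apply: le_trans (nneseries_lim_ge (m := 0%N) n _); last first.
    by move=> i _ _; apply: le_trans (hu i); rewrite lee_fin ltW.
  elim: n => [|n IH]; first by rewrite mulr0 big_geq.
  by rewrite big_nat_recr //= -natr1 mulrDr mulr1 EFinD; exact: leeD.
rewrite leye_eq; apply/eqP.
have [[r hr]|[->//|h]] : (exists r, (\sum_(i <oo) u i)%E = r%:E) \/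
   ((\sum_(i <oo) u i)%E = +oo%E \/ (\sum_(i <oo) u i)%E = -oo%E).
  by case: (\sum_(i <oo) u i)%E => [r||]; [left; exists r|right; left|right; right].
  have := key (Num.truncn (r / c)).+1; rewrite hr lee_fin.
  have := truncnS_gt (r / c); rewrite ltr_pdivrMr // mulrC => h1 h2.
  by have := lt_le_trans h1 h2; rewrite ltxx.
by have := key 0%N; rewrite h.
Qed.

End MeasurableDomains.

(** * The crossing geodesic and its returns *)

Section RationalReals.
Variable R : realType.
Implicit Types x y : R.

Definition isQ x := exists r : rat, x = ratr r.

Lemma isQ_rat (r : rat) : isQ (ratr r). Proof. by exists r. Qed.
Lemma isQ_nat (n : nat) : isQ n%:R. Proof. by exists n%:R; rewrite ratr_nat. Qed.
Lemma isQD x y : isQ x -> isQ y -> isQ (x + y).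
Proof. by case=> r -> [s ->]; exists (r + s); rewrite rmorphD. Qed.
Lemma isQN x : isQ x -> isQ (- x).
Proof. by case=> r ->; exists (- r); rewrite rmorphN. Qed.
Lemma isQB x y : isQ x -> isQ y -> isQ (x - y).
Proof. by move=> hx hy; apply: isQD => //; exact: isQN. Qed.
Lemma isQM x y : isQ x -> isQ y -> isQ (x * y).
Proof. by case=> r -> [s ->]; exists (r * s); rewrite rmorphM. Qed.
Lemma isQV x : isQ x -> isQ x^-1.
Proof. by case=> r ->; exists r^-1; rewrite fmorphV. Qed.

End RationalReals.

Section Crossing.
Variables (R : realType) (j : nat) (z : R[i]) (rho : twist_group j -> 'M[R[i]]_2).
Hypothesis hrho : hyperbolic_rep z rho.
Hypothesis oddj : odd j.
Local Notation C := R[i].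
Local Notation Gp := (Gp rho).

(* gamma maps the hyperplane over the real line to one crossing the hyperplane
   over zo + R u: the endpoints of the common geodesic have coordinates r1, r2 in
   the frame of the latter and Y1, Y2 on the real line. *)
Record crossing (zo u : C) (gamma : 'M[C]_2) (r1 r2 Y1 Y2 : R) (k1 k2 : C) : Prop := {
  crossing_Gp : Gp gamma;
  crossing_eq : frame zo u *m cmx (mk r1 r2 1 1) =
    gamma *m cmx (mk Y1 Y2 1 1) *m mk k1 0 0 k2;
  crossing_r : r1 != r2;
  crossing_Y : Y1 != Y2;
  crossing_k : complex.Im (k1 * conjc k2) != 0;
  crossing_irr : nonrational Y1;
  crossing_rr : ~ (isQ (r1 + r2) /\ isQ (r1 * r2))
}.

(** Write q = p + n with 0 < |p| < 1/2, z = x + i y and N = |z|^2. The matrix gamma sends Y to n + 1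
    / (z Y - 2 e). For real r this is the point q - 4 r / z of the line exactly when r = e p N Y / 8
    and N Y^2 - 4 e x Y + 4 + 2 e / p = 0, by separating real and imaginary parts. The sign e is
    opposite to that of p, so the constant term 4 - 2 / |p| is negative and there are two real
    roots. *)
Lemma crossing_exists (q : rat) : (forall n : int, 2 * q <> n%:~R) ->
  exists gamma r1 r2 Y1 Y2 k1 k2,
    crossing (ratr q) (- 4 / z) gamma r1 r2 Y1 Y2 k1 k2.
Proof.
move=> hq.
pose x := complex.Re z; pose y := complex.Im z; pose N := x ^+ 2 + y ^+ 2.
have y0 : y != 0 by exact: z_nonreal hrho oddj.
have zE : z = x%:C + 'i * y%:C by exact: complexE.
have z0 := z_neq0 hrho oddj.
have N0 : 0 < N by rewrite /N ltr_wpDl ?sqr_ge0 // exprn_even_gt0.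
have [n [p [pE pn p12]]] : exists (n : int) (p : rat),
    [/\ q = p + n%:~R, p != 0 & `|p| < 2^-1].
  have := floor_le q; have := floorD1_gt q; rewrite intrD /=.
  set n := Num.floor q => h1 h2.
  have e0 : q - n%:~R <> 0.
    by move=> /eqP; rewrite subr_eq0 => /eqP e; apply: (hq (2 * n)); rewrite intrM -e.
  have e1 : q - n%:~R <> 2^-1.
    move=> e; apply: (hq (2 * n + 1)); rewrite intrD intrM /=.
    have -> : q = 2^-1 + n%:~R by rewrite -e subrK.
    by rewrite mulrDr mulfV // addrC.
  have [h|h] := ltP (q - n%:~R) 2^-1.
    exists n, (q - n%:~R); rewrite subrK; split=> //; first exact/eqP.
    by rewrite ger0_norm ?subr_ge0.
  exists (n + 1), (q - n%:~R - 1); rewrite intrD /=.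
  split; [by ring| |].
    by rewrite lt_eqF //; lra.
  have : 2^-1 < q - n%:~R by rewrite lt_neqAle h andbT eq_sym; exact/eqP.
  by move=> h3; rewrite ltr_norml; apply/andP; split; lra.
pose qr : R := ratr p.
have qr0 : qr != 0 by rewrite fmorph_eq0.
have qr12 : `|qr| < 2^-1.
  have -> : 2^-1 = ratr 2^-1 :> R by rewrite fmorphV /= ratr_nat.
  by rewrite /qr -ratr_norm ltr_rat.
pose e : R := if qr < 0 then 1 else -1.
have e2 : e * e = 1 by rewrite /e; case: ifP => _; ring.
have eqr : e * qr = - `|qr|.
  by rewrite /e; case: ltP => h; [rewrite ltr0_norm // opprK mul1r|rewrite ger0_norm // mulN1r].
have eQ : isQ e by rewrite /e; case: ifP => _; [exact: (isQ_nat R 1)|exact: isQN (isQ_nat R 1)].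
have qrQ : isQ qr by exact: isQ_rat.
have aq0 : 0 < `|qr| by rewrite normr_gt0.
have q2e : 2 * qr + e != 0.
  apply/eqP => h; have : e * (2 * qr + e) = 0 by rewrite h mulr0.
  by rewrite mulrDr mulrCA eqr e2; lra.
pose pr := 4 + 2 * e / qr.
have prE : pr = 2 * (2 * qr + e) / qr by rewrite /pr; field.
have pr0 : pr != 0 by rewrite prE !mulf_neq0 ?invr_eq0.
pose D := 4 * x ^+ 2 - N * pr.
have D0 : 0 < D.
  have eq1 : e / qr = - `|qr|^-1.
    apply: (mulIf qr0); rewrite mulfVK // mulNr.
    have -> : qr = - (e * `|qr|) by rewrite -[qr in LHS]mul1r -e2 -mulrA eqr mulrN.
    by rewrite normrN normrM normr_id; have -> : `|e| = 1;
      [rewrite /e; case: ifP => _; rewrite ?normrN normr1|rewrite mul1r mulrN opprK mulrCA mulVf ?mulr1 // gt_eqF].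
  have : 2 < `|qr|^-1 by rewrite -[2]invrK ltf_pV2 ?posrE // invr_gt0.
  move=> h2; rewrite /D /pr -mulrA eq1 /N.
  have := sqr_ge0 x; have y2 : 0 < y ^+ 2 by rewrite exprn_even_gt0.
  by move=> x2; nra.
pose sD := Num.sqrt D.
have sD0 : 0 < sD by rewrite sqrtr_gt0.
have sD2 : sD ^+ 2 = D by rewrite sqr_sqrtr // ltW.
have Nn0 : N != 0 by rewrite gt_eqF.
pose Ya := (2 * e * x + sD) / N; pose Yb := (2 * e * x - sD) / N.
have Yab : Ya != Yb.
  rewrite /Ya /Yb -subr_eq0 -mulrBl mulf_neq0 ?invr_eq0 //.
  by rewrite gt_eqF //; lra.
have sumY : Ya + Yb = 4 * e * x / N by rewrite /Ya /Yb; field.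
have prodY : Ya * Yb = pr / N.
  transitivity ((4 * (e * e) * x ^+ 2 - sD ^+ 2) / N ^+ 2); first by rewrite /Ya /Yb; field.
  by rewrite sD2 e2 /D; field.
have notQ : ~ (isQ x /\ isQ N).
  by case=> -[a ha] [b hb]; exact: (not_quadratic hrho oddj ha hb).
have prQ : isQ pr.
  by rewrite /pr; apply: isQD (isQ_nat R 4) _; apply: isQM (isQV qrQ); apply: isQM eQ; exact: isQ_nat.
(* The sum and product of the roots determine N and x, so one root is irrational; it becomes
   [Y1]. *)
have nYQ : ~ (isQ Ya /\ isQ Yb).
  case=> ha hb; apply: notQ.
  have NQ : isQ N.
    have -> : N = pr / (Ya * Yb) by rewrite prodY; field; rewrite Nn0 pr0.
    by apply: isQM prQ _; apply: isQV; exact: isQM.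
  split=> //.
  have -> : x = e * (Ya + Yb) * N * 4^-1.
    by rewrite sumY; transitivity (e * e * x); [rewrite e2 mul1r|field].
  apply: isQM; last exact: isQV (isQ_nat R 4).
  by apply: isQM NQ; apply: isQM eQ _; exact: isQD.
have [Y1 [Y2 [Y12 irrY sumY' prodY']]] : exists Y1 Y2, [/\ Y1 != Y2, nonrational Y1,
    Y1 + Y2 = 4 * e * x / N & Y1 * Y2 = pr / N].
  have [ha|ha] := pselect (isQ Ya).
    exists Yb, Ya; split; [by rewrite eq_sym| |by rewrite addrC|by rewrite mulrC].
    by move=> r hr; apply: nYQ; split=> //; exists r.
  by exists Ya, Yb; split=> // r hr; apply: ha; exists r.
pose rr (Y : R) := e * qr * N * Y / 8.
have root Y Y' : Y + Y' = 4 * e * x / N -> Y * Y' = pr / N ->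
    N * Y ^+ 2 - 4 * e * x * Y + pr = 0.
  move=> h1 h2; have -> : N * Y ^+ 2 - 4 * e * x * Y + pr =
     N * (Y * (Y + Y') - Y * Y') - 4 * e * x * Y + pr by ring.
  by rewrite h1 h2; field.
have root1 := root _ _ sumY' prodY'.
have root2 : N * Y2 ^+ 2 - 4 * e * x * Y2 + pr = 0.
  by apply: (root _ Y1); rewrite 1?addrC 1?[Y2 * _]mulrC.
have [P hP hW] := ev_twist hrho oddj.
have P0 : P != 0.
  by apply: contra_eq_neq hP => ->; rewrite expr0n mul0r eq_sym oppr_eq0 oner_eq0.
have hgam : Gp (mk 0 (- P) (- (z * P)) (2 * e%:C * P)).
  (* The lower right entry of w a followed by the translation by 4 k / z is (2 - 4 k) P: the values
     0 and 1 of [k] realize both signs. *)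
  have [k hk] : exists k : int, 4 - (4 : C) * k%:~R = 2 + 2 * e%:C.
    rewrite /e; case: ifP => _; [exists 0|exists 1].
      by rewrite rmorph1 mulr0; ring.
    by rewrite rmorphN rmorph1; ring.
  have -> : mk 0 (- P) (- (z * P)) (2 * e%:C * P) =
      ev rho (twist_word j) *m mk 1 1 0 1 *m mk 1 (4 / z * k%:~R) 0 1.
    rewrite hW !mk_mul; congr mk; try by ring.
    have -> : 2 * e%:C = 2 - (4 : C) * k%:~R by move: hk => /(congr1 (fun t => t - 2)) h; transitivity (2 + 2 * e%:C - 2); [ring|rewrite -h; ring].
    by field.
  apply: (Gp_mul hrho); last exact: (Gp_U hrho).
  apply: (Gp_mul hrho); first exact: Gp_ev.
  by rewrite -(ev_a hrho); exact: Gp_ev.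
pose den (Y : R) : C := z * Y%:C - 2 * e%:C.
have den0 Y : den Y != 0.
  rewrite /den zE; apply/eqP => /eqP; rewrite eq_complex /=.
  move=> /andP[/eqP h1 /eqP h2].
  have Y0 : Y = 0.
    move/eqP: h2; rewrite !(mul0r, mulr0, mul1r, addr0, add0r, subr0, oppr0) mulf_eq0 (negPf y0).
    by move/eqP.
  move: h1 e2; rewrite Y0 !(mul0r, mulr0, mul1r, addr0, add0r, subr0, oppr0).
  move=> h1; have e0 : e = 0 by lra.
  by rewrite e0 mul0r => /esym/eqP; rewrite oner_eq0.
have main Y : N * Y ^+ 2 - 4 * e * x * Y + pr = 0 ->
    ((- 4 / z) * (rr Y)%:C + qr%:C) * den Y = 1.
  move=> hroot; apply: (mulfI z0); rewrite mulr1.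
  transitivity ((qr%:C * z - 4 * (rr Y)%:C) * den Y); first by field.
  have him : - 4 * rr Y * Y + 2 * qr * x * Y - 2 * e * qr = 1.
    transitivity (- (e * qr / 2) * (N * Y ^+ 2 - 4 * e * x * Y + pr) + 2 * (1 - e * e) * qr * x * Y + e * e).
      by rewrite /rr /pr; field.
    by rewrite hroot e2; ring.
  have hre : 8 * e * rr Y = qr * N * Y.
    by transitivity (e * e * qr * N * Y); [rewrite /rr; field|rewrite e2; ring].
  rewrite /den zE; apply/eqP; rewrite eq_complex /=; apply/andP; split; apply/eqP.
    transitivity (x * (- 4 * rr Y * Y + 2 * qr * x * Y - 2 * e * qr) + (8 * e * rr Y - qr * N * Y)).
      by rewrite /N; ring.
    by rewrite him hre; ring.
  transitivity (y * (- 4 * rr Y * Y + 2 * qr * x * Y - 2 * e * qr)); first by ring.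
  by rewrite him; ring.
exists (mk 1 n%:~R 0 1 *m mk 0 (- P) (- (z * P)) (2 * e%:C * P)).
exists (rr Y1), (rr Y2), Y1, Y2, (- (P * den Y1)^-1), (- (P * den Y2)^-1).
have qE : ratr q = qr%:C + n%:~R :> C by rewrite pE rmorphD /= ratr_int /qr -ratrC.
split.
- by apply: (Gp_mul hrho); first exact: (Gp_T hrho).
- have m1 := main _ root1; have m2 := main _ root2.
  rewrite /cmx !map_mk /frame !mk_mul qE !(rmorph1, mulr1, mulr0, mul0r, addr0, add0r, mul1r).
  have col Y : ((- 4 / z) * (rr Y)%:C + qr%:C) * den Y = 1 ->
     (- 4 / z) * (rr Y)%:C + (qr%:C + n%:~R) =
       (n%:~R * (- (z * P)) * Y%:C + (- P + n%:~R * (2 * e%:C * P))) * - (P * den Y)^-1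
     /\ 1 = (- (z * P) * Y%:C + 2 * e%:C * P) * - (P * den Y)^-1.
    move=> h; have eD : - (z * P) * Y%:C + 2 * e%:C * P = - (P * den Y) by rewrite /den; ring.
    have PD0 : P * den Y != 0 by rewrite mulf_neq0.
    split; last by rewrite eD mulrNN mulfV.
    have -> : n%:~R * (- (z * P)) * Y%:C + (- P + n%:~R * (2 * e%:C * P)) =
       - P + n%:~R * (- (P * den Y)) by rewrite -eD; ring.
    have -> : (- 4 / z) * (rr Y)%:C = (den Y)^-1 - qr%:C.
      by apply: (mulIf (den0 Y)); rewrite mulrBl mulVf // -[X in X - _]h; ring.
    by field; rewrite den0.
  have [c1 c2] := col _ m1; have [c3 c4] := col _ m2.
  by congr mk; [rewrite c1|rewrite c3|rewrite {1}c2|rewrite {1}c4]; ring.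
- rewrite /rr -subr_eq0 -!mulrBl -mulrBr mulf_neq0 ?invr_eq0 // mulf_neq0 ?subr_eq0 //.
  by rewrite eqr mulf_neq0 // oppr_eq0 gt_eqF.
- exact: Y12.
- have -> : - (P * den Y1)^-1 * conjc (- (P * den Y2)^-1) =
     ((sqnorm (P * den Y1 * den Y2))^-1)%:C * (conjc (den Y1) * den Y2).
    rewrite fmorphV /= !sqnormE !rmorphN /= mulrNN conjc_inv !rmorphM /=.
    have c0 (v : C) : v != 0 -> conjc v != 0 by rewrite conjc_eq0.
    by field; rewrite !c0 ?P0 ?den0.
  set w := conjc _ * _; set cc := _^-1.
  have -> : complex.Im (cc%:C * w) = cc * complex.Im w by case: (w) => a b /=; ring.
  apply: mulf_neq0.
    by rewrite invr_eq0 gt_eqF // sqnorm_gt0 // !mulf_neq0.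
  have -> : complex.Im w = 2 * e * y * (Y1 - Y2) by rewrite /w /den zE /=; ring.
  have e0 : e != 0 by apply: contra_eq_neq e2 => ->; rewrite mul0r eq_sym oner_eq0.
  by rewrite !mulf_neq0 ?subr_eq0.
- exact: irrY.
- case=> h1 h2; apply: notQ; split.
    have -> : x = (rr Y1 + rr Y2) * 2 / qr.
      have -> : rr Y1 + rr Y2 = e * qr * N / 8 * (Y1 + Y2) by rewrite /rr; ring.
      rewrite sumY'; transitivity (e * e * x); first by rewrite e2 mul1r.
      by field; rewrite qr0.
    by apply: isQM (isQV qrQ); apply: isQM => //; exact: isQ_nat.
  have -> : N = rr Y1 * rr Y2 * 64 / (qr * qr * pr).
    have -> : rr Y1 * rr Y2 = e * e * qr * qr * N * N / 64 * (Y1 * Y2) by rewrite /rr; field.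
    by rewrite prodY' e2; field; rewrite qr0 pr0.
  apply: isQM; last by apply: isQV; apply: isQM prQ; exact: isQM.
  by apply: isQM => //; exact: isQ_nat.
Qed.

End Crossing.

Section RealBounds.
Variable R : realType.
Implicit Types (m n : 'M[R]_2) (B : R).

Definition bndR B m := forall i k, `|m i k| <= B.

Lemma bndR_mul B B' m n : bndR B m -> bndR B' n -> bndR (2 * B * B') (m *m n).
Proof.
move=> hm hn i k; rewrite mul2E; apply: le_trans (ler_normD _ _) _.
have -> : 2 * B * B' = B * B' + B * B' by ring.
by rewrite !normrM; apply: lerD; apply: ler_pM.
Qed.

Lemma bnd_cmx B m : bndR B m -> bnd B (cmx m).
Proof. by move=> h i k; rewrite mxE cn_real. Qed.

Lemma bndR_mk B (a b c d : R) : `|a| <= B -> `|b| <= B -> `|c| <= B -> `|d| <= B ->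
  bndR B (mk a b c d).
Proof. by move=> ha hb hc hd i k; rewrite mxE; do 2![case: ifP => _]. Qed.

Lemma invmx2 (K : fieldType) (M : 'M[K]_2) : \det M != 0 ->
  invmx M = (\det M)^-1 *: mk (M 1 1) (- M 0 1) (- M 1 0) (M 0 0).
Proof.
move=> d0; have uM : M \in unitmx by rewrite unitmxE unitfE.
have e : M *m ((\det M)^-1 *: mk (M 1 1) (- M 0 1) (- M 1 0) (M 0 0)) = 1%:M.
  rewrite -scalemxAr {2}[M]mk_eta mk_mul scale_mk -mk1.
  by apply: mx2P; rewrite !mkE; move: d0; rewrite det2 => d0; field.
by rewrite -[LHS]mulmx1 -e mulKmx.
Qed.

Lemma bndR_inv B m : `|\det m| = 1 -> bndR B m -> bndR B (invmx m).
Proof.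
move=> hd hm; have d0 : \det m != 0 by rewrite -normr_eq0 hd oner_eq0.
rewrite invmx2 // => i k; rewrite mxE normrM normfV hd invr1 mul1r mxE.
by do 2![case: ifP => _]; rewrite ?normrN.
Qed.

Definition dg (c : R) : 'M[R]_2 := mk c 0 0 c^-1.

Lemma det_dg c : c != 0 -> \det (dg c) = 1.
Proof. by move=> c0; rewrite det_mk mulfV // mulr0 subr0. Qed.

Lemma cmx_inj m n : cmx m = cmx n -> m = n.
Proof. by move=> h; apply/matrixP => i k; move/matrixP: h => /(_ i k); rewrite !mxE => -[]. Qed.

Lemma cmx_unit m : (cmx m \in unitmx) = (m \in unitmx).
Proof. exact: map_unitmx. Qed.

Lemma cmx_inv m : cmx (invmx m) = invmx (cmx m).
Proof. exact: map_invmx. Qed.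

End RealBounds.

(** * Returns of the crossing geodesic and their transport to the plane *)

Section Dynamics.
Variables (R : realType) (j : nat) (z : R[i]) (rho : twist_group j -> 'M[R[i]]_2).
Hypothesis hrho : hyperbolic_rep z rho.
Hypothesis oddj : odd j.
Local Notation C := R[i].
Local Notation Gp := (Gp rho).
Variables (zo u : C) (gamma : 'M[C]_2) (r1 r2 Y1 Y2 : R) (k1 k2 : C).
Hypothesis u0 : u != 0.
Hypothesis hcr : crossing rho zo u gamma r1 r2 Y1 Y2 k1 k2.
Hypothesis hrat : forall w m, ev rho w *m frame zo u = frame zo u *m cmx m ->
  forall i k, isQ (m i k).

Let PY : 'M[R]_2 := mk Y1 Y2 1 1.
Let PR : 'M[R]_2 := mk r1 r2 1 1.
Let K : 'M[C]_2 := mk k1 0 0 k2.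

(* Up to the real element t of Gp, the geodesic with endpoints Y1, Y2 is within
   bounded distance of the base point at parameter c. *)
Definition good (B : R) (t : 'M[R]_2) (c : R) : Prop :=
  [/\ Gp (cmx t), \det t = 1, 0 < c & bndR B (invmx t *m PY *m dg c)].

(** Take c = q for a convergent p / q of [Y1]. The inverse of the matrix of convergents makes the
    first column of [PY] of order 1 / q and the second of order q, and [dg q] rescales both to
    bounded size. A coset representative with entries at most 3 moves the matrix of convergents into
    Gamma_0(4), whence 2 * 3 * B0. *)
Lemma recurrence : exists B, forall x : R, exists t c, good B t c /\ x <= c.
Proof.
pose B0 := `|Y2 - Y1| + 1.
have B0p : 0 <= B0 by rewrite addr_ge0.
exists (2 * 3 * B0) => x.
have [p [p' [q [q' [hd hq hq' h1 h2]]]]] := good_convergents (crossing_irr hcr) (Num.truncn x).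
have [a [b [c [d [hd0 /andP[ha hb] /andP[hc hd'] h4]]]]] := Gamma04_coset hd.
have q0 : 0 < q by apply: lt_le_trans hq.
have qR : 0 < q%:~R :> R by rewrite ltr0z.
have qR1 : 1 <= q%:~R :> R by rewrite ler1z.
have qn0 : q%:~R != 0 :> R by rewrite gt_eqF.
pose tau : 'M[R]_2 := mk (p * d - p' * c)%:~R (p' * a - p * b)%:~R
   (q * d - q' * c)%:~R (q' * a - q * b)%:~R.
pose s0 : 'M[R]_2 := mk a%:~R b%:~R c%:~R d%:~R.
pose si : 'M[R]_2 := mk q'%:~R (- p'%:~R) (- q%:~R) p%:~R.
have hds : (p * d - p' * c) * (q' * a - q * b) - (p' * a - p * b) * (q * d - q' * c) = 1.
  by transitivity ((p * q' - p' * q) * (a * d - b * c)); [ring|rewrite hd hd0 mulr1].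
have dR : \det tau = 1 by rewrite det_mk -!intrM -intrB hds.
have hdR : a%:~R * d%:~R - b%:~R * c%:~R = 1 :> R by rewrite -!intrM -intrB hd0.
have hdR' : p%:~R * q'%:~R - p'%:~R * q%:~R = 1 :> R by rewrite -!intrM -intrB hd.
exists tau, q%:~R; split; last first.
  apply: le_trans (ltW (truncnS_gt x)) _.
  by rewrite -[_.+1%:R]/(_.+1%:~R) ler_int.
split=> //.
  rewrite /cmx map_mk /= !rmorph_int.
  exact: (Gp_Gamma04 hrho oddj).
have -> : invmx tau = s0 *m si.
  rewrite invmx_mk; last by rewrite -det_mk.
  by rewrite mk_mul; congr mk; rewrite !(intrB, intrM); ring.
rewrite -!mulmxA; apply: bndR_mul.
  have i3 (n : int) : (`|n| <= 3)%N -> `|n%:~R| <= 3 :> R.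
    by move=> hn; rewrite -intr_norm -[3]/(3%:~R) ler_int; lia.
  by apply: bndR_mk; exact: i3.
have qi1 : (q%:~R)^-1 <= 1 :> R by rewrite invf_le1.
have c1 (v : R) : `|v| <= (q%:~R)^-1 -> `|v * q%:~R| <= B0.
  move=> hv; rewrite normrM (gtr0_norm qR); apply: (@le_trans _ _ 1); last by rewrite lerDr.
  by rewrite -ler_pdivlMr // mul1r.
have c2 (v w : R) : `|v| <= (q%:~R)^-1 -> `|w| <= q%:~R ->
    `|(v + w * (Y2 - Y1)) / q%:~R| <= B0.
  move=> hv hw; rewrite normrM normfV (gtr0_norm qR) ler_pdivrMr //.
  apply: le_trans (ler_normD _ _) _; rewrite normrM.
  have : `|w| * `|Y2 - Y1| <= q%:~R * `|Y2 - Y1| by rewrite ler_wpM2r.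
  by rewrite /B0; nra.
have -> : si *m (PY *m dg q%:~R) =
  mk ((q'%:~R * Y1 - p'%:~R) * q%:~R) (((q'%:~R * Y1 - p'%:~R) + q'%:~R * (Y2 - Y1)) / q%:~R)
     (- (q%:~R * Y1 - p%:~R) * q%:~R) ((- (q%:~R * Y1 - p%:~R) + - q%:~R * (Y2 - Y1)) / q%:~R).
  by rewrite /si /PY /dg !mk_mul; congr mk; ring.
apply: bndR_mk.
- exact: c1.
- apply: c2 => //; by rewrite -intr_norm ler_int.
- by apply: c1; rewrite normrN.
- by apply: c2; rewrite normrN // gtr0_norm.
Qed.

(** A frame of the crossing geodesic at parameter [c] in the coordinates of H: infinity and 0 go to
    [r1] and [r2]. *)
Definition Nmx (c : R) : 'M[R]_2 := PR *m dg c.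

Lemma det_PR : \det PR != 0.
Proof. by rewrite det_mk !mulr1 subr_eq0 (crossing_r hcr). Qed.

Lemma det_PY : \det PY != 0.
Proof. by rewrite det_mk !mulr1 subr_eq0 (crossing_Y hcr). Qed.

Lemma det_Nmx c : 0 < c -> \det (Nmx c) != 0.
Proof.
move=> c0; have cn : c != 0 by rewrite gt_eqF.
by rewrite det_mulmx det_dg // mulr1 det_PR.
Qed.

Lemma Nmx_unit c : 0 < c -> Nmx c \in unitmx.
Proof. by move=> c0; rewrite unitmxE unitfE det_Nmx. Qed.

Lemma k1_neq0 : k1 != 0.
Proof.
by apply/eqP => h; have := crossing_k hcr; rewrite h mul0r /= eqxx.
Qed.

Lemma k2_neq0 : k2 != 0.
Proof.
by apply/eqP => h; have := crossing_k hcr; rewrite h conjc0 mulr0 /= eqxx.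
Qed.

Lemma det_K : \det K != 0.
Proof. by rewrite det_mk mulr0 subr0 mulf_neq0 ?k1_neq0 ?k2_neq0. Qed.

Lemma K_unit : K \in unitmx. Proof. by rewrite unitmxE unitfE det_K. Qed.

(** The frame at the same parameter in the coordinates of the real plane, brought back by [t]. *)
Definition Lmx (t : 'M[R]_2) (c : R) := invmx t *m PY *m dg c.

Lemma det_Lmx B t c : good B t c -> \det (Lmx t c) = \det PY.
Proof.
case=> _ dt c0 _; rewrite !det_mulmx det_inv dt invr1 mul1r det_dg ?mulr1 //.
by rewrite gt_eqF.
Qed.

(* In the frame of a return point, an element of the stabilizer of the second
   hyperplane becomes the element transfer of Gp. *)
Definition transfer (g : 'M[C]_2) (t t' : 'M[R]_2) :=
  invmx (cmx t') *m invmx gamma *m g *m gamma *m cmx t.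

(** By [crossing_eq], and since the diagonal matrices [K] and [dg] commute, gamma t L K = frame N at
    each return. The two sides express one isometry in these two ways. *)
Lemma transferE B B' g i m t c t' c' : good B t c -> good B' t' c' ->
  acts_as zo u g i m ->
  transfer g t t' *m cmx (Lmx t c) *m K =
  i *: (cmx (Lmx t' c') *m K *m cmx (invmx (Nmx c') *m m *m Nmx c)).
Proof.
move=> [gt dt c0 _] [gt' dt' c0' _] [_ hg].
have ugam := Gp_unit hrho (crossing_Gp hcr).
have DK e : cmx (dg e) *m K = K *m cmx (dg e).
  by rewrite /cmx map_mk !mk_mul; congr mk; rewrite /= ?rmorph0; ring.
have key s e : s \in unitmx ->
    gamma *m (cmx s *m (cmx (Lmx s e) *m K)) = frame zo u *m cmx (Nmx e).
  move=> us; rewrite [cmx s *m _]mulmxA -cmxM /Lmx -[invmx s *m _ *m _]mulmxA mulKVmx //.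
  rewrite /Nmx !cmxM -mulmxA DK !mulmxA; congr (_ *m _).
  by rewrite (crossing_eq hcr).
have ut : t \in unitmx by rewrite unitmxE dt unitr1.
have ut' : t' \in unitmx by rewrite unitmxE dt' unitr1.
set S := cmx (invmx (Nmx c') *m m *m Nmx c).
have mN : cmx m *m cmx (Nmx c) = cmx (Nmx c') *m S.
  by rewrite /S -!cmxM -[invmx _ *m m *m _]mulmxA mulKVmx // Nmx_unit.
rewrite /transfer -!mulmxA (key _ _ ut) [g *m (_ *m _)]mulmxA hg -scalemxAl -!scalemxAr.
congr (_ *: _); rewrite -[frame zo u *m _ *m _]mulmxA mN [frame zo u *m _]mulmxA -(key _ _ ut').
by rewrite -[gamma *m _ *m S]mulmxA mulKmx // -[cmx t' *m _ *m S]mulmxA mulKmx ?cmx_unit // mulmxA.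
Qed.

Lemma transfer_Gp B B' g t c t' c' : good B t c -> good B' t' c' -> Gp g ->
  Gp (transfer g t t').
Proof.
move=> [gt _ _ _] [gt' _ _ _] gg; have ggam := crossing_Gp hcr.
apply: (Gp_mul hrho _ gt); apply: (Gp_mul hrho _ ggam); apply: (Gp_mul hrho _ gg).
by apply: (Gp_mul hrho); exact: (Gp_inv hrho).
Qed.

Lemma bnd_exists (M : 'M[C]_2) : exists B, bnd B M.
Proof.
exists (cn (M 0 0) + cn (M 0 1) + cn (M 1 0) + cn (M 1 1)).
move=> i k; have -> : M i k = mk (M 0 0) (M 0 1) (M 1 0) (M 1 1) i k by rewrite -mk_eta.
rewrite mxE.
have := cn_ge0 (M 0 0); have := cn_ge0 (M 0 1); have := cn_ge0 (M 1 0).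
by have := cn_ge0 (M 1 1); do 2![case: ifP => _]; lra.
Qed.

Lemma bnd_le B B' (M : 'M[C]_2) : B <= B' -> bnd B M -> bnd B' M.
Proof. by move=> h hM i k; apply: le_trans (hM i k) h. Qed.

(** The matrices [Lmx] are bounded by [B] and have the determinant of [PY], so their inverses are
    bounded too, and [A] does not depend on the returns. *)
Lemma conj_bounded B : exists A, 0 < A /\ forall t c t' c' (f X : 'M[C]_2) b,
  good B t c -> good B t' c' ->
  f *m cmx (Lmx t c) *m K = cmx (Lmx t' c') *m K *m X -> bnd b X -> bnd (A * b) f.
Proof.
have [bK hK] := bnd_exists K.
have [bKi hKi] := bnd_exists (invmx K).
pose bL := B / `|\det PY|.
exists (`|2 * (2 * (2 * (2 * B * bK)) * bKi) * bL| + 1); split.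
  by rewrite ltr_pwDr.
move=> t c t' c' f X b hg hg' hf hX.
have dL := det_Lmx hg; have dPY := det_PY.
have [_ _ _ hB] := hg; have [_ _ _ hB'] := hg'.
have B0 : 0 <= B by apply: le_trans (normr_ge0 _) (hB 0 0).
have b0 : 0 <= b by apply: le_trans (cn_ge0 _) (hX 0 0).
have uL : cmx (Lmx t c) \in unitmx by rewrite cmx_unit unitmxE unitfE dL.
have hLi : bndR bL (invmx (Lmx t c)).
  rewrite invmx2 ?dL // => i k; rewrite mxE normrM normfV mulrC /bL ler_wpM2r ?invr_ge0 //.
  by rewrite mxE; do 2![case: ifP => _]; rewrite ?normrN; exact: hB.
have -> : f = cmx (Lmx t' c') *m K *m X *m invmx K *m cmx (invmx (Lmx t c)).
  by rewrite -hf (mulmxK K_unit) cmx_inv mulmxK.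
have h1 := bnd_mul (bnd_cmx hB') hK.
have h2 := bnd_mul (bnd_mul (bnd_mul h1 hX) hKi) (bnd_cmx hLi).
apply: bnd_le h2.
have -> : 2 * (2 * (2 * (2 * B * bK) * b) * bKi) * bL = 2 * (2 * (2 * (2 * B * bK)) * bKi) * bL * b by ring.
by rewrite ler_wpM2r //; apply: le_trans (ler_norm _) _; rewrite lerDl.
Qed.

End Dynamics.

(** * Separation of returns modulo the stabilizer *)

Section Separation.
Variables (R : realType) (j : nat) (z : R[i]) (rho : twist_group j -> 'M[R[i]]_2).
Hypothesis hrho : hyperbolic_rep z rho.
Hypothesis oddj : odd j.
Local Notation C := R[i].
Local Notation Gp := (Gp rho).
Local Notation ev := (ev rho).
Variables (zo u : C) (gamma : 'M[C]_2) (r1 r2 Y1 Y2 : R) (k1 k2 : C).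
Hypothesis u0 : u != 0.
Hypothesis hcr : crossing rho zo u gamma r1 r2 Y1 Y2 k1 k2.
Hypothesis hrat : forall w m, ev w *m frame zo u = frame zo u *m cmx m ->
  forall i k, isQ (m i k).
Local Notation good := (good rho Y1 Y2).
Local Notation Nmx := (Nmx r1 r2).
Local Notation Lmx := (Lmx Y1 Y2).
Local Notation transfer := (transfer gamma).
Local Notation K := (mk k1 0 0 k2).

(** The isometry [m] of H between the frames of two returns; it has bounded entries when [m] brings
    the point at [c] within bounded distance of the point at [c']. *)
Definition moved (m : 'M[R]_2) c c' := invmx (Nmx c') *m m *m Nmx c.

Lemma det_ev_acts w i m : acts_as zo u (ev w) i m -> `|\det m| = 1.
Proof. by move=> hm; exact: (acts_as_det u0 (det_ev hrho w) hm). Qed.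

Lemma det_moved w i m c c' : acts_as zo u (ev w) i m -> 0 < c -> 0 < c' ->
  `|\det (moved m c c')| = 1.
Proof.
move=> hm c0 c0'; have dPR := det_PR hcr.
have dN e : 0 < e -> \det (Nmx e) = \det (mk r1 r2 1 1).
  move=> e0; have en : e != 0 by rewrite gt_eqF.
  by rewrite det_mulmx det_dg // mulr1.
rewrite /moved det_mulmx det_mulmx det_inv !dN //.
by rewrite mulrAC mulVf // mul1r; exact: det_ev_acts hm.
Qed.

Lemma cmxE (m : 'M[R]_2) a b : cmx m a b = (m a b)%:C.
Proof. exact: mxE. Qed.

Lemma unit_det1 (m : 'M[R]_2) : `|\det m| = 1 -> m \in unitmx.
Proof. by move=> h; rewrite unitmxE unitfE -normr_eq0 h oner_eq0. Qed.

(** Nonreality of a conj(b) is transversality of the two planes. Applied to the entries of [K], it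
    says that a real matrix whose conjugate by [K] is real must be diagonal: an isometry preserving
    both planes preserves their common geodesic and its ends. *)
Lemma real_ratio_eq0 (a b : C) (x q : R) : complex.Im (a * conjc b) != 0 ->
  x%:C * b = a * q%:C -> q = 0.
Proof.
move=> hab h.
have : complex.Im (a * conjc b * q%:C) = 0.
  have -> : a * conjc b * q%:C = (x * sqnorm b)%:C.
    by rewrite rmorphM /= sqnormE mulrA h; ring.
  by [].
have -> : complex.Im (a * conjc b * q%:C) = complex.Im (a * conjc b) * q.
  by case: (a * conjc b) => v w /=; ring.
by move=> /eqP; rewrite mulf_eq0 (negPf hab) => /eqP.
Qed.

(* Two elements of the stabilizer with the same transfer differ by an element
   fixing both endpoints of the common geodesic, which are then conjugate
   rational or quadratic numbers. *)
Lemma two_returns B t c t' c' t'' c'' w w' i m m' b :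
  good B t c -> good B t' c' -> good B t'' c'' ->
  acts_as zo u (ev w) i m -> acts_as zo u (ev w') i m' ->
  transfer (ev w) t t'' = transfer (ev w') t' t'' ->
  bndR b (moved m c c'') -> bndR b (moved m' c' c'') ->
  2 * b * b * c < c' -> False.
Proof.
move=> hg hg' hg'' hm hm' htr hb hb' hc.
have [_ _ c0 _] := hg; have [_ _ c0' _] := hg'; have [_ _ c0'' _] := hg''.
have dS := det_moved hm c0 c0''; have dS' := det_moved hm' c0' c0''.
have uS := unit_det1 dS; have uS' := unit_det1 dS'.
have e1 := transferE hrho hcr hg hg'' hm.
have e2 := transferE hrho hcr hg' hg'' hm'.
rewrite -/(moved m c c'') htr in e1; rewrite -/(moved m' c' c'') in e2.
set f := transfer _ _ _ in e1 e2.
have uf : f \in unitmx.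
  by apply: (Gp_unit hrho); apply: (transfer_Gp hrho hcr hg' hg''); exact: Gp_ev.
have [Q QE] : exists Q, Q = invmx (moved m' c' c'') *m moved m c c'' by eexists.
have [X XE] : exists X, X = invmx (Lmx t' c') *m Lmx t c by eexists.
have uL' : Lmx t' c' \in unitmx.
  by rewrite unitmxE unitfE (det_Lmx hg') (det_PY hcr).
have uK := K_unit hcr.
have XKQ : cmx X *m K = K *m cmx Q.
  have hL : cmx (Lmx t c) *m K = cmx (Lmx t' c') *m K *m cmx Q.
    apply: (can_inj (mulKmx uf)); rewrite !mulmxA e1 e2 -scalemxAl; congr (_ *: _).
    by rewrite -[RHS]mulmxA -cmxM QE mulKVmx.
  by rewrite XE cmxM -mulmxA hL cmx_inv -[_ *m K *m _]mulmxA mulKmx // cmx_unit.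
have Q01 : Q 0 1 = 0.
  have := congr1 (fun M : 'M[C]_2 => M 0 1) XKQ.
  rewrite !mul2E !mkE !(mulr0, mul0r, addr0, add0r) !cmxE.
  apply: (real_ratio_eq0 (crossing_k hcr)).
have Q10 : Q 1 0 = 0.
  have := congr1 (fun M : 'M[C]_2 => M 1 0) XKQ.
  rewrite !mul2E !mkE !(mulr0, mul0r, addr0, add0r) !cmxE.
  apply: real_ratio_eq0; have := crossing_k hcr.
  case: (k1) (k2) => [p q] [p' q'] /=; apply: contra_neq => h; lra.
have hQ : bndR (2 * b * b) Q by rewrite QE; apply: bndR_mul => //; exact: bndR_inv.
have dQ : `|Q 0 0 * Q 1 1| = 1.
  have -> : Q 0 0 * Q 1 1 = \det Q by rewrite det2 Q01 mul0r subr0.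
  by rewrite QE det_mulmx det_inv normrM normfV dS dS' invr1 mulr1.
have um' : m' \in unitmx by apply: unit_det1; exact: det_ev_acts hm'.
have [M ME] : exists M, M = invmx m' *m m by eexists.
have hM : forall a d, isQ (M a d).
  (* As [i] is the same for both elements, the quotient of [w] by [w'] acts with factor 1, which is
     the case covered by the rationality assumption. *)
  have [i0 hw] : i != 0 /\ ev w *m frame zo u = i *: (frame zo u *m cmx m).
    case: hm => hi ->; split=> //; case: hi => ->; first exact: oner_neq0.
    by rewrite eq_complex /= oner_eq0 andbF.
  have [_ hw'] := hm'.
  apply: (hrat (w := inv_word w' ++ w)).
  have uw' : ev w' \in unitmx by rewrite unitmxE (det_ev hrho) unitr1.
  have um : cmx m' \in unitmx by rewrite cmx_unit.
  by rewrite (ev_cat hrho) (ev_inv hrho) (intertwine_div uw' um i0 hw hw') ME cmxM cmx_inv.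
have MN : M *m Nmx c = Nmx c' *m Q.
  have uN'' := Nmx_unit hcr c0''; have uN' := Nmx_unit hcr c0'.
  have e : moved m' c' c'' *m invmx (Nmx c') *m M *m Nmx c = moved m c c''.
    by rewrite /moved ME -[_ *m Nmx c' *m invmx _]mulmxA mulmxV // mulmx1 !mulmxA
      -[_ *m m' *m invmx m']mulmxA mulmxV // mulmx1.
  have -> : Q = invmx (Nmx c') *m M *m Nmx c.
    rewrite QE -e; move: (moved m' c' c'') uS' => mv umv.
    by rewrite -!mulmxA mulKmx.
  by rewrite !mulmxA mulmxV // mul1mx.
pose d1 := c' * Q 0 0 / c; pose d2 := c * Q 1 1 / c'.
have cn0 : c != 0 by rewrite gt_eqF.
have cn0' : c' != 0 by rewrite gt_eqF.
have MP : M *m mk r1 r2 1 1 = mk r1 r2 1 1 *m mk d1 0 0 d2.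
  have udg : dg c \in unitmx by rewrite unitmxE det_dg // unitr1.
  apply: (can_inj (mulmxK udg)); rewrite -mulmxA -/(Nmx c) MN /Nmx -!mulmxA; congr (_ *m _).
  rewrite {1}[Q]mk_eta Q01 Q10 /dg !mk_mul /d1 /d2; congr mk; try by field.
  by field; rewrite cn0 cn0'.
have ent a d := congr1 (fun N : 'M[R]_2 => N a d) MP.
have := ent 0 0; have := ent 0 1; have := ent 1 0; have := ent 1 1.
rewrite !mul2E !mkE !(mulr0, mul0r, mulr1, mul1r, addr0, add0r).
set al := M 0 0; set be := M 0 1; set ga := M 1 0; set de := M 1 1.
move=> e11 e10 e01 e00.
(* [d1] and [d2] are the eigenvalues of [M]. Their product has modulus 1, while the growth of the
   parameter makes |d2| < 1, so [M] is not scalar. *)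
have d12 : d1 != d2.
  have dd1 : `|d1 * d2| = 1 by rewrite -dQ; congr `|_|; rewrite /d1 /d2; field; rewrite cn0 cn0'.
  have q11 : `|Q 1 1| <= 2 * b * b by exact: hQ.
  have d2lt : `|d2| < 1.
    rewrite /d2 !normrM normfV (gtr0_norm c0) (gtr0_norm c0') ltr_pdivrMr // mul1r.
    by apply: le_lt_trans hc; rewrite mulrC ler_wpM2r // ltW.
  apply/eqP => h; move: dd1; rewrite h normrM => h1.
  by have := normr_ge0 d2; nra.
have r12 : r1 - r2 != 0 by rewrite subr_eq0 (crossing_r hcr).
have gar : ga * (r1 - r2) = d1 - d2 by rewrite -e10 -e11; ring.
have ga0 : ga != 0.
  by apply: contra_neq d12 => h; apply/eqP; rewrite -subr_eq0 -gar h mul0r.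
(* The fixed points [r1] and [r2] of [M] are the roots of ga X^2 + (de - al) X - be, which has
   rational coefficients. *)
have q1 : al * r1 + be = r1 * (ga * r1 + de) by rewrite e10 e00.
have q2 : al * r2 + be = r2 * (ga * r2 + de) by rewrite e11 e01.
have sumr : r1 + r2 = (al - de) / ga.
  apply: (mulIf ga0); rewrite mulfVK //; apply: (mulIf r12).
  transitivity (r1 * (ga * r1 + de) - r2 * (ga * r2 + de) - de * (r1 - r2)); first by ring.
  by rewrite -q1 -q2; ring.
have prodr : r1 * r2 = - be / ga.
  apply: (mulIf ga0); rewrite mulfVK //.
  have -> : r1 * r2 * ga = r1 * ((r1 + r2) * ga) - ga * r1 * r1 by ring.
  rewrite sumr mulfVK //; transitivity (al * r1 + be - r1 * (ga * r1 + de) - be); first by ring.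
  by rewrite q1 subrr sub0r.
apply: (crossing_rr hcr); rewrite sumr prodr; split.
  by apply: isQM (isQV (hM _ _)); exact: isQB (hM _ _) (hM _ _).
by apply: isQM (isQV (hM _ _)); exact: isQN (hM _ _).
Qed.

Lemma acts_iota i (m : 'M[R]_2) g : acts_as zo u g i m -> cn i = 1.
Proof.
case=> -[->|->] _; rewrite /cn /= ?normr0 ?normr1 ?addr0 ?add0r //.
Qed.

Lemma bnd_scale i b (S : 'M[R]_2) : cn i = 1 -> bndR b S -> bnd b (i *: cmx S).
Proof.
move=> hi hS a d; rewrite mxE; have := cnM_le (lexx (cn i)) (bnd_cmx hS a d).
by rewrite hi mul1r.
Qed.

Lemma transfer_bounded B : exists A, forall b t c t' c' w i m, good B t c -> good B t' c' ->
  acts_as zo u (ev w) i m -> bndR b (moved m c c') -> bnd (A * b) (transfer (ev w) t t').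
Proof.
have [A [_ hA]] := conj_bounded hcr B; exists A => b t c t' c' w i m hg hg' hm hb.
have e := transferE hrho hcr hg hg' hm.
apply: (hA t c t' c' _ (i *: cmx (moved m c c'))) => //; first by rewrite e -scalemxAr.
by apply: bnd_scale => //; exact: acts_iota hm.
Qed.

(** Otherwise there is a sequence of such returns whose parameters grow by the factor [L] at each
    step. Their transfers are bounded elements of [Gp], so two of them agree, together with the
    factors 1 or i; as [L] exceeds 2 b^2, this contradicts [two_returns]. *)
Lemma separation B b t' c' : good B t' c' -> exists X, forall t c w i m,
  good B t c -> X <= c -> acts_as zo u (ev w) i m -> ~ bndR b (moved m c c').
Proof.
move=> hg'; apply/not_existsP => hn.
have [A hA] := transfer_bounded B.
have [T [code hcode]] := bounded_code hrho (A * b).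
pose L := 2 * b * b + 1.
have L1 : 1 <= L by rewrite lerDr -mulrA mulr_ge0 // -expr2 sqr_ge0.
have hyp X : exists x : 'M[R]_2 * R * word bool * C * 'M[R]_2,
    [/\ good B x.1.1.1.1 x.1.1.1.2, X <= x.1.1.1.2,
        acts_as zo u (ev x.1.1.2) x.1.2 x.2 & bndR b (moved x.2 x.1.1.1.2 c')].
  have /existsNP[t /existsNP[c /existsNP[w /existsNP[i /existsNP[m]]]]] := hn X.
  move=> /not_implyP[h1 /not_implyP[h2 /not_implyP[h3 /contrapT h4]]].
  by exists (t, c, w, i, m).
have [F hF] := choice hyp.
pose s := fix s n := if n is n'.+1 then F (L * (s n').1.1.1.2) else F 1.
have hs n : [/\ good B (s n).1.1.1.1 (s n).1.1.1.2,
        acts_as zo u (ev (s n).1.1.2) (s n).1.2 (s n).2 &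
        bndR b (moved (s n).2 (s n).1.1.1.2 c')].
  by case: n => [|n] /=; [have [] := hF 1|have [] := hF (L * (s n).1.1.1.2)].
have hc n k : (n < k)%N -> L * (s n).1.1.1.2 <= (s k).1.1.1.2.
  elim: k => // k IH; rewrite ltnS leq_eqVlt => /orP[/eqP->|/IH h].
    by have [] := hF (L * (s k).1.1.1.2).
  apply: le_trans h _; have [_ h2 _ _] := hF (L * (s k).1.1.1.2).
  apply: le_trans h2; have [[_ _ h3 _] _ _] := hs k.
  by rewrite ler_peMl // ltW.
pose code' n := (code (transfer (ev (s n).1.1.2) (s n).1.1.1.1 t'), (s n).1.2 == 1).
have [n [k [nk hnk]]] : exists n k, (n < k)%N /\ code' n = code' k.
  have /injectivePn[x [y xy hxy]] : ~~ injectiveb (fun n : 'I_#|{: T * bool}|.+1 => code' n).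
    apply/negP => /injectiveP/leq_card; rewrite card_ord ltnNge.
    by rewrite leqnn.
  have [h|h|h] := ltngtP x y; [by exists x, y|by exists y, x|].
  by move/eqP: xy; case; exact: val_inj.
have [gn an bn] := hs n; have [gk ak bk] := hs k.
case: hnk => hcd hi.
have hii : (s n).1.2 = (s k).1.2.
  case: an ak hi => -[]-> _ [[]-> _] //.
  - by rewrite eqxx => /esym/eqP.
  - by rewrite eqxx => /eqP.
have htr : transfer (ev (s n).1.1.2) (s n).1.1.1.1 t' =
    transfer (ev (s k).1.1.2) (s k).1.1.1.1 t'.
  apply: hcode => //.
  - by apply: (transfer_Gp hrho hcr gn hg'); exact: Gp_ev.
  - by apply: (transfer_Gp hrho hcr gk hg'); exact: Gp_ev.
  - exact: (hA _ _ _ _ _ _ _ _ gn hg' an bn).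
  - exact: (hA _ _ _ _ _ _ _ _ gk hg' ak bk).
rewrite hii in an.
apply: (two_returns gn gk hg' an ak htr bn bk).
apply: lt_le_trans (hc _ _ nk); have [_ _ h _] := gn.
by rewrite ltr_pM2r // ltrDl.
Qed.

End Separation.

(** * Disjoint balls along the returns *)

Section NearlyFixed.
Variable R : realType.
Implicit Types (S : 'M[R]_2) (v : R * R).

(** With rows (a, b) and (c, d) of [S], these are the real and imaginary parts of v' (c v + d) = a v
    + b, or of its analogue with conj(v) when the determinant is -1. *)
Lemma hp_eqs S v v' : `|\det S| = 1 -> 0 < v.2 -> hp S v = v' ->
  v'.1 * (S 1 0 * v.1 + S 1 1) - (S 0 0 * v.1 + S 0 1) = \det S * S 1 0 * v.2 * v'.2 /\
  S 0 0 * v.2 - v'.1 * S 1 0 * v.2 = \det S * v'.2 * (S 1 0 * v.1 + S 1 1).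
Proof.
move=> hd ht <-; have d0 : \det S != 0 by rewrite -normr_eq0 hd oner_eq0.
have n0 : hden S v != 0 by rewrite gt_eqF // hden_gt0.
rewrite /hp /= hd mul1r; split; apply: (mulIf n0).
  transitivity (((S 0 0 * v.1 + S 0 1) * (S 1 0 * v.1 + S 1 1) + S 0 0 * S 1 0 * v.2 ^+ 2) *
     (S 1 0 * v.1 + S 1 1) - (S 0 0 * v.1 + S 0 1) * hden S v); first by field.
  transitivity (\det S * S 1 0 * v.2 * v.2); last by field.
  by rewrite det2 /hden; ring.
transitivity (S 0 0 * v.2 * hden S v - ((S 0 0 * v.1 + S 0 1) * (S 1 0 * v.1 + S 1 1) +
   S 0 0 * S 1 0 * v.2 ^+ 2) * (S 1 0 * v.2)); first by field.
transitivity (\det S * v.2 * (S 1 0 * v.1 + S 1 1)); last by field.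
by rewrite det2 /hden; ring.
Qed.

Lemma sqr_bound (x b : R) : 0 <= b -> x ^+ 2 <= b ^+ 2 -> `|x| <= b.
Proof.
by move=> b0 h; rewrite -ler_sqr ?nnegrE // real_normK ?num_real.
Qed.

(** The heights bound |c v + d|^2 = [hden S v] by 4, and then |a v + b|^2 = [hden S v] |v'|^2 by 32.
    So |a| <= 12, and the largest bound is that of the entry b, 6 + 2 * 12 = 30. *)
Lemma hp_bounded S v v' : `|\det S| = 1 -> hp S v = v' ->
  `|v.1| <= 2 -> 2^-1 <= v.2 <= 2 -> `|v'.1| <= 2 -> 2^-1 <= v'.2 <= 2 -> bndR 30 S.
Proof.
move=> hd hv hx /andP[ht1 ht2] hx' /andP[ht1' ht2'].
have d0 : \det S != 0 by rewrite -normr_eq0 hd oner_eq0.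
have t0 : 0 < v.2 by lra.
have t0' : 0 < v'.2 by lra.
have nn0 := hden_gt0 d0 t0; have n0 : hden S v != 0 by rewrite gt_eqF.
have nE : hden S v * v'.2 = v.2 by rewrite -hv /= hd mul1r mulrC mulfVK.
have n4 : hden S v <= 4.
  by rewrite leNgt; apply/negP => h; nra.
have d2 : `|\det S| ^+ 2 = (S 0 0 * S 1 1 - S 0 1 * S 1 0) ^+ 2.
  by rewrite real_normK ?num_real // det2.
have num : (S 0 0 * v.1 + S 0 1) ^+ 2 + (S 0 0 * v.2) ^+ 2 = hden S v * (v'.1 ^+ 2 + v'.2 ^+ 2).
  apply: (mulIf n0); rewrite -hv /hp /=.
  transitivity (((S 0 0 * v.1 + S 0 1) * (S 1 0 * v.1 + S 1 1) + S 0 0 * S 1 0 * v.2 ^+ 2) ^+ 2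
    + `|\det S| ^+ 2 * v.2 ^+ 2); last by field.
  by rewrite d2 /hden; ring.
have s2 : v'.1 ^+ 2 + v'.2 ^+ 2 <= 8.
  have : v'.1 ^+ 2 <= 4.
    by rewrite -[v'.1 ^+ 2]real_normK ?num_real //; have := normr_ge0 v'.1; nra.
  by have : v'.2 ^+ 2 <= 4 by [nra]; lra.
have num32 : (S 0 0 * v.1 + S 0 1) ^+ 2 + (S 0 0 * v.2) ^+ 2 <= 32.
  rewrite num; apply: le_trans (_ : 4 * 8 <= _); last by lra.
  by apply: ler_pM => //; [exact: ltW|rewrite addr_ge0 ?sqr_ge0].
have q1 := sqr_ge0 (S 0 0 * v.1 + S 0 1); have q2 := sqr_ge0 (S 0 0 * v.2).
have q3 := sqr_ge0 (S 1 0 * v.1 + S 1 1); have q4 := sqr_ge0 (S 1 0 * v.2).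
have b1 : `|S 0 0 * v.1 + S 0 1| <= 6 by apply: sqr_bound => //; lra.
have b2 : `|S 0 0 * v.2| <= 6 by apply: sqr_bound => //; lra.
have b3 : `|S 1 0 * v.1 + S 1 1| <= 2 by apply: sqr_bound => //; move: n4; rewrite /hden; lra.
have b4 : `|S 1 0 * v.2| <= 2 by apply: sqr_bound => //; move: n4; rewrite /hden; lra.
have ha : `|S 0 0| <= 12.
  by move: b2; rewrite normrM (gtr0_norm t0); have := normr_ge0 (S 0 0); nra.
have hc : `|S 1 0| <= 4.
  by move: b4; rewrite normrM (gtr0_norm t0); have := normr_ge0 (S 1 0); nra.
have sub (a x b B : R) : `|a * x + b| <= B -> `|x| <= 2 -> `|b| <= B + 2 * `|a|.
  move=> h1 h2; have -> : b = (a * x + b) - a * x by ring.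
  apply: le_trans (ler_normB _ _) _; rewrite normrM.
  have := normr_ge0 a; have := normr_ge0 x; nra.
have hb := sub _ _ _ _ b1 hx; have hdd := sub _ _ _ _ b3 hx.
rewrite [S]mk_eta; clear -ha hb hc hdd; apply: bndR_mk.
- by lra.
- by lra.
- by lra.
- by lra.
Qed.

(** Divided differences: [c] is reached by two divisions by gaps of size at least 1 / n, each
    costing a factor n; then [d] and [e] follow. *)
Lemma three_points (c d e h : R) (n : nat) (x y w : R) : (0 < n)%N ->
  `|x| <= 1 -> `|y| <= 1 -> `|w| <= 1 ->
  n%:R^-1 <= `|x - y| -> n%:R^-1 <= `|x - w| -> n%:R^-1 <= `|y - w| ->
  `|c * x ^+ 2 + d * x + e| <= h -> `|c * y ^+ 2 + d * y + e| <= h ->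
  `|c * w ^+ 2 + d * w + e| <= h ->
  [/\ `|c| <= 20 * h * n%:R ^+ 2, `|d| <= 20 * h * n%:R ^+ 2 & `|e| <= 20 * h * n%:R ^+ 2].
Proof.
move=> n0 hx hy hw hxy hxw hyw px py pw.
have N1 : 1 <= n%:R :> R by rewrite ler1n.
set N : R := n%:R in N1 *.
have Np : 0 < N by lra.
have h0 : 0 <= h by apply: le_trans px.
have div (v t B : R) : N^-1 <= `|t| -> `|v * t| <= B -> `|v| <= B * N.
  move=> ht; rewrite normrM => hv; rewrite -ler_pdivrMr //.
  by apply: le_trans hv; rewrite ler_wpM2l.
have A1 : `|c * (x + y) + d| <= 2 * h * N.
  apply: (div _ (x - y)) => //.
  have -> : (c * (x + y) + d) * (x - y) = (c * x ^+ 2 + d * x + e) - (c * y ^+ 2 + d * y + e) by ring.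
  by apply: le_trans (ler_normB _ _) _; lra.
have A2 : `|c * (x + w) + d| <= 2 * h * N.
  apply: (div _ (x - w)) => //.
  have -> : (c * (x + w) + d) * (x - w) = (c * x ^+ 2 + d * x + e) - (c * w ^+ 2 + d * w + e) by ring.
  by apply: le_trans (ler_normB _ _) _; lra.
have hc : `|c| <= 4 * h * N * N.
  apply: (div _ (y - w)) => //.
  have -> : c * (y - w) = (c * (x + y) + d) - (c * (x + w) + d) by ring.
  by apply: le_trans (ler_normB _ _) _; lra.
have hN : h * N <= h * N * N by rewrite ler_peMr // mulr_ge0 // ltW.
have hN1 : h <= h * N by rewrite ler_peMr.
have hd : `|d| <= 2 * h * N + 8 * h * N * N.
  have -> : d = (c * (x + y) + d) - c * (x + y) by ring.
  apply: le_trans (ler_normB _ _) _; rewrite normrM.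
  have hxy2 : `|x + y| <= 2 by apply: le_trans (ler_normD _ _) _; lra.
  have : `|c| * `|x + y| <= (4 * h * N * N) * 2 by apply: ler_pM.
  by lra.
have he : `|e| <= h + 4 * h * N * N + (2 * h * N + 8 * h * N * N).
  have -> : e = (c * x ^+ 2 + d * x + e) - (c * x ^+ 2 + d * x) by ring.
  apply: le_trans (ler_normB _ _) _.
  have := ler_normD (c * x ^+ 2) (d * x); rewrite (normrM c) (normrM d).
  have x2 : `|x ^+ 2| <= 1 by rewrite normrX expr_le1.
  have : `|c| * `|x ^+ 2| <= (4 * h * N * N) * 1 by apply: ler_pM.
  have : `|d| * `|x| <= (2 * h * N + 8 * h * N * N) * 1 by apply: ler_pM.
  by lra.
have -> : 20 * h * N ^+ 2 = 20 * (h * N * N) by ring.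
by split; lra.
Qed.

Definition near_point (eta x : R) v := `|v.1 - x| <= eta /\ `|v.2 - 1| <= eta.

(** If S fixed x + i exactly, [hp_eqs] would make the first expression 0 and the second one (1 + det
    S) c x. The bounds are the errors for entries at most 30. The first equation is quadratic in x,
    so it has to be used at three points. *)
Lemma nearly_fixed_eq S (x eta : R) v v' : `|\det S| = 1 -> bndR 30 S ->
  0 <= x <= 1 -> 0 <= eta <= 4^-1 -> near_point eta x v -> near_point eta x v' ->
  hp S v = v' ->
  `|S 1 0 * x ^+ 2 + (S 1 1 - S 0 0) * x + (- S 0 1 - \det S * S 1 0)| <= 240 * eta /\
  `|S 0 0 - \det S * S 1 1| <= 60 * eta + 8 * `|S 1 0|.
Proof.
move=> hd hS /andP[x0 x1] /andP[e0 e4] [h1 h2] [h1' h2'] hv.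
have t0 : 0 < v.2 by move: h2; rewrite ler_norml => /andP[? ?]; lra.
have [E1 E2] := hp_eqs hd t0 hv.
have pd (a b A B : R) : `|a| <= A -> `|b| <= B -> `|a * b| <= A * B.
  by move=> ha hb; rewrite normrM; apply: ler_pM.
have hx2 : `|x| <= 1 by rewrite ger0_norm.
have v1 : `|v.1| <= 2.
  by have -> : v.1 = (v.1 - x) + x by [ring]; apply: le_trans (ler_normD _ _) _; lra.
have v2 : `|v.2| <= 2.
  by have -> : v.2 = (v.2 - 1) + 1 by [ring]; apply: le_trans (ler_normD _ _) _; rewrite normr1; lra.
have v1' : `|v'.1| <= 2.
  by have -> : v'.1 = (v'.1 - x) + x by [ring]; apply: le_trans (ler_normD _ _) _; lra.
have v2' : `|v'.2| <= 2.
  by have -> : v'.2 = (v'.2 - 1) + 1 by [ring]; apply: le_trans (ler_normD _ _) _; rewrite normr1; lra.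
split.
  have -> : S 1 0 * x ^+ 2 + (S 1 1 - S 0 0) * x + (- S 0 1 - \det S * S 1 0) =
     - (S 1 0 * (x * (v'.1 - x) + v'.1 * (v.1 - x))) - S 1 1 * (v'.1 - x)
     + S 0 0 * (v.1 - x) + \det S * (S 1 0 * ((v.2 - 1) + v.2 * (v'.2 - 1))).
    transitivity (S 1 0 * x ^+ 2 + (S 1 1 - S 0 0) * x + (- S 0 1 - \det S * S 1 0)
      - (v'.1 * (S 1 0 * v.1 + S 1 1) - (S 0 0 * v.1 + S 0 1) - \det S * S 1 0 * v.2 * v'.2)).
      by rewrite E1 subrr subr0.
    by ring.
  have b1 : `|S 1 0 * (x * (v'.1 - x) + v'.1 * (v.1 - x))| <= 30 * (3 * eta).
    apply: (pd) (hS _ _) _; apply: le_trans (ler_normD _ _) _.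
    by have := pd _ _ _ _ hx2 h1'; have := pd _ _ _ _ v1' h1; lra.
  have b2 := pd _ _ _ _ (hS 1 1) h1'; have b3 := pd _ _ _ _ (hS 0 0) h1.
  have b4 : `|\det S * (S 1 0 * ((v.2 - 1) + v.2 * (v'.2 - 1)))| <= 30 * (3 * eta).
    rewrite normrM hd mul1r; apply: (pd) (hS _ _) _; apply: le_trans (ler_normD _ _) _.
    by have := pd _ _ _ _ v2 h2'; lra.
  apply: le_trans (ler_normD _ _) _.
  have := ler_normD (- (S 1 0 * (x * (v'.1 - x) + v'.1 * (v.1 - x))) - S 1 1 * (v'.1 - x)) (S 0 0 * (v.1 - x)).
  have := ler_normB (- (S 1 0 * (x * (v'.1 - x) + v'.1 * (v.1 - x)))) (S 1 1 * (v'.1 - x)).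
  by rewrite normrN; lra.
have -> : S 0 0 - \det S * S 1 1 = - (S 0 0 * (v.2 - 1)) + \det S * (S 1 1 * (v'.2 - 1))
    + (v'.1 * S 1 0 * v.2 + \det S * (v'.2 * (S 1 0 * v.1))).
  transitivity (S 0 0 - \det S * S 1 1 - (S 0 0 * v.2 - v'.1 * S 1 0 * v.2
     - \det S * v'.2 * (S 1 0 * v.1 + S 1 1))); first by rewrite E2 subrr subr0.
  by ring.
have b1 := pd _ _ _ _ (hS 0 0) h2.
have b2 : `|\det S * (S 1 1 * (v'.2 - 1))| <= 30 * eta.
  by rewrite normrM hd mul1r; exact: (pd).
have c1 : `|v'.1 * S 1 0 * v.2| <= 2 * `|S 1 0| * 2 by apply: (pd) => //; exact: (pd).
have c2 : `|\det S * (v'.2 * (S 1 0 * v.1))| <= 2 * (`|S 1 0| * 2).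
  by rewrite normrM hd mul1r; apply: (pd) => //; exact: (pd).
apply: le_trans (ler_normD _ _) _.
have := ler_normD (- (S 0 0 * (v.2 - 1))) (\det S * (S 1 1 * (v'.2 - 1))).
have := ler_normD (v'.1 * S 1 0 * v.2) (\det S * (v'.2 * (S 1 0 * v.1))).
by rewrite normrN; lra.
Qed.

(** For determinant -1 both a + d and a - d are small, hence so is the determinant, which is absurd.
    For determinant 1 the product (a - 1)(a + 1) is small, and one factor is at least 1 in
    modulus. *)
Lemma near_scalar S (th : R) : `|\det S| = 1 -> `|S 0 0| <= 30 -> 0 <= th <= 100^-1 ->
  `|S 1 0| <= th -> `|S 1 1 - S 0 0| <= th -> `|S 0 1| <= 2 * th ->
  `|S 0 0 - \det S * S 1 1| <= 9 * th ->
  \det S = 1 /\ exists s : R, (s = 1 \/ s = -1) /\ bndR (100 * th) (S - s%:M).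
Proof.
move=> hd; have dE : \det S = 1 \/ \det S = -1.
  have : `|\det S| == 1 by rewrite hd.
  by rewrite eqr_norml => /andP[/orP[]/eqP -> _]; [left|right].
have det := det2 S; move: dE det; rewrite [S]mk_eta !mkE.
move: (S 0 0) (S 0 1) (S 1 0) (S 1 1) => a b c d {hd}; set D := \det _.
move=> dE det ha /andP[th0 th1] hc hda hb q.
have hbc : `|b * c| <= 2 * th * th by rewrite normrM; apply: ler_pM.
case: dE => dE; rewrite dE in det q *; last first.
  have a5 : `|a| <= 10 * th.
    by move: q hda th0; clear; rewrite !ler_norml => /andP[? ?] /andP[? ?] ?; apply/andP; split; lra.
  have d5 : `|d| <= 11 * th.
    by move: a5 hda; clear; rewrite !ler_norml => /andP[? ?] /andP[? ?]; apply/andP; split; lra.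
  have ad : `|a * d| <= (10 * th) * (11 * th) by rewrite normrM; apply: ler_pM.
  have tt : th * th <= 100^-1 * 100^-1 by apply: ler_pM.
  exfalso; move: det ad hbc tt; clear.
  by rewrite !ler_norml => ? /andP[? ?] /andP[? ?] ?; lra.
split=> //.
have key (s : R) : (s = 1 \/ s = -1) -> `|a - s| <= 64 * th ->
    exists s0 : R, (s0 = 1 \/ s0 = -1) /\ bndR (100 * th) (mk a b c d - s0%:M).
  move=> hs h; exists s; split=> //.
  have -> : mk a b c d - s%:M = mk (a - s) b c (d - s).
    by rewrite -mk_scalar opp_mk; apply: mx2P; rewrite mxE !mkE ?oppr0 ?addr0.
  have hds : `|d - s| <= 65 * th.
    have -> : d - s = (d - a) + (a - s) by ring.
    by apply: le_trans (ler_normD _ _) _; move: h hda; clear; lra.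
  have le (x k : R) : k <= 100 -> `|x| <= k * th -> `|x| <= 100 * th.
    by move=> hk hx; apply: le_trans hx _; rewrite ler_wpM2r.
  apply: bndR_mk; [apply: (le _ 64)|apply: (le _ 2)|apply: (le _ 1)|apply: (le _ 65)] => //;
    by rewrite ?mul1r ?ler1n ?ler_nat.
have prod : `|a - 1| * `|a + 1| <= 32 * th.
  rewrite -normrM.
  have -> : (a - 1) * (a + 1) = b * c - a * (d - a).
    by transitivity (a * a - (a * d - b * c)); [rewrite -det; ring|ring].
  apply: le_trans (ler_normB _ _) _.
  have h1 : `|a * (d - a)| <= 30 * th by rewrite normrM; apply: ler_pM.
  have h2 : 2 * th * th <= 2 * th by rewrite ler_piMr ?mulr_ge0 //; move: th1; clear; lra.
  by move: h1 h2 hbc; clear; lra.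
have split2 (x y : R) : 0 <= x -> 1 <= y -> x * y <= 32 * th -> x <= 64 * th.
  move=> x0 y1 hxy; have : x <= x * y by rewrite ler_peMr.
  by move: hxy th0; clear; lra.
have [h|h] := leP 0 a.
  apply: (key 1); first by left.
  apply: split2 prod => //; rewrite ger0_norm; by move: h; clear; lra.
apply: (key (-1)); first by right.
rewrite opprK; apply: split2 (_ : _ * `|a - 1| <= _) => //.
  by rewrite ltr0_norm; move: h; clear; lra.
by rewrite mulrC.
Qed.

(** The constant 5000 exceeds 20 * 240, from [three_points] and [nearly_fixed_eq]. *)
Lemma nearly_fixed3 S (n : nat) (eta th x y w : R) vx vx' vy vy' vw vw' :
  `|\det S| = 1 -> bndR 30 S -> (0 < n)%N -> 0 <= eta <= 4^-1 ->
  5000 * eta * n%:R ^+ 2 <= th -> th <= 100^-1 ->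
  0 <= x <= 1 -> 0 <= y <= 1 -> 0 <= w <= 1 ->
  n%:R^-1 <= `|x - y| -> n%:R^-1 <= `|x - w| -> n%:R^-1 <= `|y - w| ->
  near_point eta x vx -> near_point eta x vx' -> hp S vx = vx' ->
  near_point eta y vy -> near_point eta y vy' -> hp S vy = vy' ->
  near_point eta w vw -> near_point eta w vw' -> hp S vw = vw' ->
  \det S = 1 /\ exists s : R, (s = 1 \/ s = -1) /\ bndR (100 * th) (S - s%:M).
Proof.
move=> hd hS n0 he hth th1 hx hy hw hxy hxw hyw n1 n1' e1 n2 n2' e2 n3 n3' e3.
have [p1 q1] := nearly_fixed_eq hd hS hx he n1 n1' e1.
have [p2 _] := nearly_fixed_eq hd hS hy he n2 n2' e2.
have [p3 _] := nearly_fixed_eq hd hS hw he n3 n3' e3.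
have unit (t : R) : 0 <= t <= 1 -> `|t| <= 1 by move=> /andP[? ?]; rewrite ger0_norm.
have [hc hda hb] := three_points n0 (unit _ hx) (unit _ hy) (unit _ hw) hxy hxw hyw p1 p2 p3.
have N1 : 1 <= n%:R ^+ 2 :> R by rewrite expr_ge1 // ler1n.
case/andP: he => e0 _.
have en0 : 0 <= eta * n%:R ^+ 2 by rewrite mulr_ge0 // exprn_ge0.
have eN : 60 * eta <= th.
  have : eta <= eta * n%:R ^+ 2 by rewrite ler_peMr.
  by move: hth en0; clear; lra.
have thE : 20 * (240 * eta) * n%:R ^+ 2 <= th by move: hth en0; clear; lra.
have {}hc := le_trans hc thE; have {}hda := le_trans hda thE; have {}hb := le_trans hb thE.
apply: near_scalar => //.
- by rewrite th1 (le_trans _ hc).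
- have -> : S 0 1 = - (- S 0 1 - \det S * S 1 0) - \det S * S 1 0 by ring.
  apply: le_trans (ler_normB _ _) _; rewrite normrN normrM hd mul1r.
  by move: hb hc; clear; lra.
- by apply: le_trans q1 _; move: eN hc; clear; lra.
Qed.

End NearlyFixed.

Lemma finite_lower_bound (R : realType) (T : finType) (e : T -> R) :
  (forall x, 0 < e x) -> exists d, 0 < d /\ forall x, d <= e x.
Proof.
move=> e0; pose s := 1 + \sum_x (e x)^-1.
have s0 : 0 < s by rewrite ltr_pwDl // sumr_ge0 // => x _; rewrite invr_ge0 ltW.
exists s^-1; split=> [|x]; first by rewrite invr_gt0.
rewrite -[leRHS]invrK lef_pV2 ?posrE ?invr_gt0 // /s (bigD1 x) //=.
rewrite addrCA lerDl addr_ge0 // sumr_ge0 // => y _; rewrite invr_ge0 ltW //.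
Qed.

Lemma pigeonhole3 (T : finType) (n : nat) (f : 'I_n -> T) : (2 * #|T| < n)%N ->
  exists x y w, [/\ x != y, x != w, y != w, f x = f y & f x = f w].
Proof.
move=> hn; apply: contrapT => hno; move: hn; apply/negP; rewrite -leqNgt.
have fiber y : (#|[pred x | f x == y]| <= 2)%N.
  rewrite leqNgt; apply/negP => h.
  have /card_gt2P[x [x' [x'' [[h1 h2 h3] [d1 d2 d3]]]]] := h.
  apply: hno; exists x, x', x''; move: h1 h2 h3; rewrite !inE => /eqP-> /eqP-> /eqP->.
  by split=> //; rewrite eq_sym.
rewrite -{1}[n]card_ord -sum1_card (partition_big f xpredT) //=.
rewrite mulnC -sum_nat_const; apply: leq_sum => y _.
rewrite sum1_card; exact: fiber.
Qed.

Lemma iota_neq0 (R : realType) (i : R[i]) : i = 1 \/ i = 'i -> i != 0.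
Proof. by case=> ->; rewrite ?oner_neq0 // eq_complex /= oner_eq0 andbF. Qed.

Lemma iota_eq (R : realType) (i k : R[i]) : i = 1 \/ i = 'i -> k = 1 \/ k = 'i ->
  (i == 1) = (k == 1) -> i = k.
Proof.
move=> [] -> [] -> //; rewrite eqxx; first by move=> /esym/eqP.
by move=> /eqP.
Qed.

Lemma cn_sign (R : realType) (s : R) (f : 'M[R[i]]_2) k l : s = 1 \/ s = -1 ->
  cn ((s%:C *: f) k l - (1%:M : 'M[R[i]]_2) k l) = cn ((f - s%:C%:M) k l).
Proof.
move=> hs; have -> : s%:C = (-1) ^+ (s != 1) :> R[i].
  by case: hs => ->; rewrite ?eqxx // rmorphN1 eq_sym -subr_eq0 opprK -[1 + 1]/(2%:R) pnatr_eq0.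
case: (s != 1); last by rewrite expr0 scale1r !mxE.
by rewrite expr1 scaleN1r -cnN; congr cn; rewrite !mxE mulNrn opprB !opprK addrC.
Qed.

Lemma intertwine_scalar (R : realType) (f L K : 'M[R[i]]_2) (s : R) (m : 'M[R]_2) :
  f *m L *m K = L *m K *m cmx m ->
  (f - s%:C%:M) *m L *m K = L *m K *m cmx (m - s%:M).
Proof.
move=> h; have -> : cmx (m - s%:M) = cmx m - s%:C%:M by rewrite /cmx map_mxB map_scalar_mx.
by rewrite mulmxBr -h !mulmxBl !mul_scalar_mx mul_mx_scalar -scalemxAl.
Qed.

(** In the box, [dd] to the point [hp N (x, 1)] is at most 2 (eta/4)^2 <= (eta/2)^2. It is invariant
    under [N], and [dd_near] doubles eta/2. *)
Lemma box_near (R : realType) (N : 'M[R]_2) (eta x : R) p : \det N != 0 ->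
  0 < eta -> eta <= 4^-1 -> box (eta / 4) (hp N (x, 1)).1 (hp N (x, 1)).2 p ->
  near_point eta x (hp (invmx N) p).
Proof.
move=> dN eta0 eta4; have : 0 < (hp N (x, 1)).2 by apply: hp_gt0; rewrite ?ltr01.
have uN : N \in unitmx by rewrite unitmxE unitfE.
have dNi : \det (invmx N) != 0 by rewrite det_inv invr_eq0.
have : hp (invmx N) (hp N (x, 1)) = (x, 1).
  by rewrite -hpM ?mulVmx ?hp1 ?ltr01.
case: (hp N (x, 1)) => [c e] cE /= e0 [] /=; rewrite !in_itv /=.
move=> /andP[h1 h2] /andP[h3 h4]; have p0 : 0 < p.2 by apply: lt_le_trans h3.
have e2 : 0 < eta / 2 <= 2^-1 by rewrite divr_gt0 //=; lra.
have hdd : dd (hp (invmx N) p) (x, 1) <= (eta / 2) ^+ 2.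
  rewrite -cE dd_hp // /dd ler_pdivrMr ?mulr_gt0 //=.
  set d := eta / 4 in h1 h2 h4; have d0 : 0 < d by rewrite divr_gt0.
  have de : 0 <= d * e by rewrite mulr_ge0 // ltW.
  have a1 : (p.1 - c) ^+ 2 <= (d * e) ^+ 2.
    rewrite -[(_ - _) ^+ 2]real_normK ?num_real // ler_sqr ?nnegrE //.
    by rewrite ler_norml; apply/andP; split; lra.
  have a2 : (p.2 - e) ^+ 2 <= (d * e) ^+ 2.
    by rewrite ler_sqr ?nnegrE ?subr_ge0 //; lra.
  have a3 : e * e <= p.2 * e by rewrite ler_wpM2r // ltW.
  apply: (@le_trans _ _ (2 * (d * e) ^+ 2)); first by lra.
  apply: (@le_trans _ _ ((eta / 2) ^+ 2 * (e * e))); last first.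
    by rewrite ler_wpM2l // sqr_ge0.
  have -> : 2 * (d * e) ^+ 2 = eta ^+ 2 * (e * e) / 8 by rewrite /d; field.
  have -> : (eta / 2) ^+ 2 * (e * e) = eta ^+ 2 * (e * e) / 4 by field.
  have : 0 <= eta ^+ 2 * (e * e) by rewrite !mulr_ge0 // ltW.
  by clear; lra.
have [] := dd_near _ _ e2 hdd erefl; [exact: hp_gt0|exact: ltr01|].
by have -> : 2 * (eta / 2) = eta by field.
Qed.

Lemma rescale_bounds (R : realType) (x y t : R) : 0 < y -> `|x| < y / 4 -> `|t - y| < y / 4 ->
  `|x / y| <= 2 /\ 2^-1 <= t / y <= 2.
Proof.
move=> y0 hx; rewrite ltr_norml => /andP[h1 h2].
rewrite normrM normfV (gtr0_norm y0) ler_pdivrMr // ler_pdivlMr // ler_pdivrMr //.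
by split; [lra|apply/andP; split; lra].
Qed.

(** * Boxes that embed disjointly in the quotient *)

Section ReturnFamily.
Variables (R : realType) (j : nat) (z : R[i]) (rho : twist_group j -> 'M[R[i]]_2).
Hypothesis hrho : hyperbolic_rep z rho.
Hypothesis oddj : odd j.
Local Notation C := R[i].
Local Notation Gp := (Gp rho).
Local Notation ev := (ev rho).
Variables (zo u : C) (gamma : 'M[C]_2) (r1 r2 Y1 Y2 : R) (k1 k2 : C).
Hypothesis u0 : u != 0.
Hypothesis hcr : crossing rho zo u gamma r1 r2 Y1 Y2 k1 k2.
Hypothesis hrat : forall w m, ev w *m frame zo u = frame zo u *m cmx m ->
  forall i k, isQ (m i k).
Local Notation good := (good rho Y1 Y2).
Local Notation Nmx := (Nmx r1 r2).
Local Notation Lmx := (Lmx Y1 Y2).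
Local Notation transfer := (transfer gamma).
Local Notation moved := (moved r1 r2).
Local Notation K := (mk k1 0 0 k2).

Lemma iota_det w i (m : 'M[R]_2) c : acts_as zo u (ev w) i m -> 0 < c ->
  \det (moved m c c) = 1 -> i = 1.
Proof.
move=> [hi hE] c0.
have : 1 = i ^+ 2 * (\det m)%:C.
  move: hE => /(congr1 determinant).
  rewrite detZ !det_mulmx (det_ev hrho) det_mk mulr1 mulr0 subr0 mul1r det_map_mx => e.
  by apply: (mulfI u0); rewrite mulr1 [in LHS]e; ring.
have dN := det_Nmx hcr c0.
move=> e; rewrite [X in X = 1 -> _]det_mulmx [X in X * _ = 1 -> _]det_mulmx det_inv.
rewrite mulrAC mulVf // mul1r => h.
case: hi => // hi; move: e; rewrite h hi sqr_i mulr1 => /eqP.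
by rewrite -subr_eq0 opprK -[1 + 1]/(2%:R) pnatr_eq0.
Qed.

Lemma hp_scalar (s : R) (p : R * R) : s = 1 \/ s = -1 -> hp s%:M p = p.
Proof.
case=> ->; first exact: hp1.
by rewrite rmorphN /= hpN hp1.
Qed.

Lemma near_point_bounds (eta x : R) v : 0 <= eta <= 4^-1 -> 0 <= x <= 1 ->
  near_point eta x v -> `|v.1| <= 2 /\ 2^-1 <= v.2 <= 2.
Proof.
move=> /andP[e0 e1] /andP[x0 x1] []; rewrite !ler_norml => /andP[h1 h2] /andP[h3 h4].
by split; apply/andP; split; lra.
Qed.

(** The centres k / n at height 1 are tried, with n more than twice the number of codes. If each is
    nearly fixed by a nontrivial element, three of them share the code, hence the isometry. Nearly
    fixing three points of a horizontal line, it is close to 1 or -1; so is its transfer, which is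
    then 1 or -1 by [near1_trivial]. *)
Lemma return_balls B : exists eta, 0 < eta <= 4^-1 /\ forall t c, good B t c ->
  exists x, 0 <= x <= 1 /\ forall w i (m : 'M[R]_2) v v', acts_as zo u (ev w) i m ->
    near_point eta x v -> near_point eta x v' -> hp (moved m c c) v = v' ->
    forall p, hp (moved m c c) p = p.
Proof.
have [A hA] := transfer_bounded hrho hcr B.
have [A' [A'0 hA']] := conj_bounded hcr B.
have [T [code hcode]] := bounded_code hrho (A * 30).
have [d [d0 hd]] : exists d : R, 0 < d /\ forall M, Gp M ->
  (forall i k, cn (M i k - (1%:M : 'M[C]_2) i k) < d) -> M = 1%:M.
  by have [d d0 hd] := near1_trivial hrho; exists d.
pose n := (2 * #|{: T * bool}|).+1.
have n0 : (0 < n)%N by [].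
have N0 : 0 < n%:R :> R by rewrite ltr0n.
have N20 : 0 < n%:R ^+ 2 :> R by rewrite exprn_gt0.
(* Chosen backwards: [100 * th] is the distance to a scalar in [nearly_fixed3], [A'] the cost of
   passing to the transfer, and [d] the radius of [near1_trivial]. *)
pose th := Num.min (100^-1) (d / (200 * A')).
have th0 : 0 < th by rewrite lt_min invr_gt0 ltr0n andTb divr_gt0 // mulr_gt0 // ltr0n.
have th1 : th <= 100^-1 by rewrite ge_min lexx.
have thd : A' * (100 * th) < d.
  have : th <= d / (200 * A') by rewrite ge_min lexx orbT.
  rewrite ler_pdivlMr ?mulr_gt0 // => h; have : 0 < A' * th by rewrite mulr_gt0.
  by lra.
have [eh Eh] : exists k : R, k = 5000 by eexists.
have eh0 : 0 < eh by rewrite Eh ltr0n.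
pose eta := Num.min (4^-1) (th / (eh * n%:R ^+ 2)).
have eta0 : 0 < eta by rewrite lt_min invr_gt0 ltr0n andTb divr_gt0 // mulr_gt0.
have eta4 : eta <= 4^-1 by rewrite ge_min lexx.
have etath : 5000 * eta * n%:R ^+ 2 <= th.
  have : eta <= th / (eh * n%:R ^+ 2) by rewrite ge_min lexx orbT.
  by rewrite ler_pdivlMr ?mulr_gt0 // Eh mulrA [eta * _]mulrC.
have etab : 0 <= eta <= 4^-1 by rewrite ltW.
exists eta; split; first by rewrite eta0.
move=> t c hg; apply: contrapT => hno.
have [_ _ c0 _] := hg.
pose xx (k : 'I_n) : R := k%:R / n%:R.
have xx01 k : 0 <= xx k <= 1.
  by rewrite divr_ge0 //= ler_pdivrMr // mul1r ler_nat ltnW.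
have xxd k l : k != l -> n%:R^-1 <= `|xx k - xx l|.
  move=> kl; rewrite /xx -mulrBl normrM normfV (gtr0_norm N0) ler_peMl ?invr_ge0 ?ler0n //.
  have : (k < l)%N || (l < k)%N by rewrite -neq_ltn.
  case/orP => h; last by rewrite -natrB ?(ltnW h) // normr_nat ler1n subn_gt0.
  by rewrite distrC -natrB ?(ltnW h) // normr_nat ler1n subn_gt0.
have hyp k : exists x : word bool * C * 'M[R]_2 * (R * R) * (R * R),
   [/\ acts_as zo u (ev x.1.1.1.1) x.1.1.1.2 x.1.1.2,
       near_point eta (xx k) x.1.2, near_point eta (xx k) x.2,
       hp (moved x.1.1.2 c c) x.1.2 = x.2 &
       ~ forall p, hp (moved x.1.1.2 c c) p = p].
  apply: contrapT => h; apply: hno; exists (xx k); split=> // w i m v v' h1 h2 h3 h4.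
  by apply: contrapT => h5; apply: h; exists (w, i, m, v, v').
have [F hF] := choice hyp.
pose S k := moved (F k).1.1.2 c c.
pose f k := transfer (ev (F k).1.1.1.1) t t.
have dS k : `|\det (S k)| = 1.
  by have [h _ _ _ _] := hF k; exact: (det_moved hrho u0 hcr h).
have bS k : bndR 30 (S k).
  have [_ h1 h2 h3 _] := hF k.
  have [a1 a2] := near_point_bounds etab (xx01 k) h1.
  have [a3 a4] := near_point_bounds etab (xx01 k) h2.
  exact: hp_bounded (dS k) h3 a1 a2 a3 a4.
have gf k : Gp (f k) by apply: (transfer_Gp hrho hcr hg hg); exact: Gp_ev.
have bf k : bnd (A * 30) (f k).
  by have [h _ _ _ _] := hF k; exact: (hA _ _ _ _ _ _ _ _ hg hg h (bS k)).
have uK := K_unit hcr.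
have uL : cmx (Lmx t c) \in unitmx by rewrite cmx_unit unitmxE unitfE (det_Lmx hg) (det_PY hcr).
have fE k : f k *m cmx (Lmx t c) *m K = (F k).1.1.1.2 *: (cmx (Lmx t c) *m K *m cmx (S k)).
  by have [h _ _ _ _] := hF k; exact: (transferE hrho hcr hg hg h).
have [a [b [e [ab ae be hab hae]]]] :=
  @pigeonhole3 _ _ (fun k => (code (f k), (F k).1.1.1.2 == 1)) (ltnSn _).
have same k l : (code (f k), (F k).1.1.1.2 == 1) = (code (f l), (F l).1.1.1.2 == 1) -> S k = S l.
  move=> h; have hc : code (f k) = code (f l) := congr1 fst h.
  have [[ik _] _ _ _ _] := hF k; have [[il _] _ _ _ _] := hF l.
  have ii := iota_eq ik il (congr1 snd h).
  have ff : f k = f l by apply: hcode.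
  have i0 : (F l).1.1.1.2 != 0.
    by apply: iota_neq0.
  apply: cmx_inj.
  have uLK : cmx (Lmx t c) *m K \in unitmx by rewrite unitmx_mul uL.
  apply: (can_inj (mulKmx uLK)); apply: (scalerI i0).
  by rewrite -(fE l) -ff fE ii.
have Sab := same _ _ hab; have Sae := same _ _ hae.
have [_ na na' ea nta] := hF a; have [_ nb nb' eb _] := hF b; have [_ ne ne' ee _] := hF e.
have [det1 [s [hs hbs]]] : \det (S a) = 1 /\ exists s : R, (s = 1 \/ s = -1) /\
    bndR (100 * th) (S a - s%:M).
  apply: (nearly_fixed3 (dS a) (bS a) n0 etab etath th1 (xx01 a) (xx01 b) (xx01 e)
     (xxd _ _ ab) (xxd _ _ ae) (xxd _ _ be) na na' ea nb nb' _ ne ne' _).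
    by rewrite Sab.
  by rewrite Sae.
have i1 : (F a).1.1.1.2 = 1 by have [h _ _ _ _] := hF a; exact: iota_det h c0 det1.
have fa := fE a; rewrite i1 scale1r in fa.
have cs : cmx s%:M = s%:C%:M by rewrite /cmx map_scalar_mx.
have fs : f a = s%:C%:M.
  have e1 : (f a - s%:C%:M) *m cmx (Lmx t c) *m K = cmx (Lmx t c) *m K *m cmx (S a - s%:M).
    exact: intertwine_scalar fa.
  have hb := hA' _ _ _ _ _ _ _ hg hg e1 (bnd_cmx hbs).
  have : s%:C *: f a = 1%:M.
    apply: hd.
      case: hs => ->; first by rewrite scale1r.
      by rewrite rmorphN1 scaleN1r; exact: Gp_opp.
    by move=> k l; rewrite (cn_sign _ _ _ hs); apply: le_lt_trans thd; exact: hb.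
  move=> /(congr1 (fun M => s%:C *: M)); rewrite scalerA scalemx1.
  have -> : s%:C * s%:C = 1 by case: hs => ->; rewrite ?rmorphN1 ?mulrNN mulr1.
  by rewrite scale1r.
apply: nta => p; rewrite -/(S a).
have -> : S a = s%:M.
  apply: cmx_inj; rewrite cs.
  have uLK : cmx (Lmx t c) *m K \in unitmx by rewrite unitmx_mul uL.
  apply: (can_inj (mulKmx uLK)); rewrite -fa fs mul_mx_scalar -!mulmxA mul_scalar_mx.
  by [].
exact: hp_scalar.
Qed.

(** The parameter of each return is taken beyond the thresholds that [separation] attaches to all
    earlier ones, so the stabilizer does not relate different boxes. Inside one box, [return_balls]
    leaves only elements acting trivially. *)
Lemma return_family : exists (d : R) (X Y : nat -> R), [/\ 0 < d, forall n, 0 < Y n &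
  forall n k p w i (m : 'M[R]_2), acts_as zo u (ev w) i m ->
    box d (X n) (Y n) p -> box d (X k) (Y k) (hp m p) -> n = k /\ hp m p = p].
Proof.
have [B hB] := recurrence hrho oddj u0 hcr.
have [eta [/andP[eta0 eta4] heta]] := return_balls B.
have sep (x : 'M[R]_2 * R) : exists X, good B x.1 x.2 -> forall t c w i m,
    good B t c -> X <= c -> acts_as zo u (ev w) i m -> ~ bndR 30 (moved m c x.2).
  have [h|h] := pselect (good B x.1 x.2); last by exists 0.
  have [X hX] := separation hrho u0 hcr hrat 30 h.
  by exists X => _.
have [sX hsX] := choice sep.
have pick0 (x : R) : exists y : 'M[R]_2 * R, good B y.1 y.2 /\ x <= y.2.
  by have [t [c [h1 h2]]] := hB x; exists (t, c).
have [F hF] := choice pick0.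
pose acc := fix acc n := if n is n'.+1 then Num.max (acc n') (sX (F (acc n'))) else 0 : R.
pose s n := F (acc n).
have sg n : good B (s n).1 (s n).2 by have [] := hF (acc n).
have c0 n : 0 < (s n).2 by have [] := sg n.
have acc_le n k : (n < k)%N -> sX (s n) <= acc k.
  elim: k => // k IH; rewrite ltnS leq_eqVlt => /orP[/eqP->|/IH h] /=.
    by rewrite le_max lexx orbT.
  by rewrite le_max h.
have sX_le n k : (n < k)%N -> sX (s n) <= (s k).2.
  by move=> nk; apply: le_trans (acc_le _ _ nk) _; have [] := hF (acc k).
have balls n : exists x, 0 <= x <= 1 /\ forall w i (m : 'M[R]_2) v v', acts_as zo u (ev w) i m ->
    near_point eta x v -> near_point eta x v' -> hp (moved m (s n).2 (s n).2) v = v' ->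
    forall p, hp (moved m (s n).2 (s n).2) p = p by exact: heta (sg n).
have [xx hxx] := choice balls.
pose cen n := hp (Nmx (s n).2) (xx n, 1).
have dN n := det_Nmx hcr (c0 n).
have uN n := Nmx_unit hcr (c0 n).
have cen0 n : 0 < (cen n).2 by apply: hp_gt0; [exact: dN|exact: ltr01].
have etab : 0 <= eta <= 4^-1 by rewrite ltW.
pose d := eta / 4.
have d0 : 0 < d by rewrite divr_gt0.
have box_pos n p : box d (cen n).1 (cen n).2 p -> 0 < p.2.
  by move=> [_ /=]; rewrite in_itv /= => /andP[h _]; apply: lt_le_trans h; exact: cen0.
have near n p : box d (cen n).1 (cen n).2 p ->
    near_point eta (xx n) (hp (invmx (Nmx (s n).2)) p).
  by apply: box_near; rewrite ?eta0 ?dN.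
have move_eq n k p w i (m : 'M[R]_2) : acts_as zo u (ev w) i m -> 0 < p.2 ->
    hp (moved m (s n).2 (s k).2) (hp (invmx (Nmx (s n).2)) p) = hp (invmx (Nmx (s k).2)) (hp m p).
  move=> hm p0.
  have dm : \det m != 0 by rewrite -normr_eq0 (det_ev_acts hrho u0 hm) oner_eq0.
  have di l : \det (invmx (Nmx (s l).2)) != 0 by rewrite det_inv invr_eq0.
  have dv : \det (moved m (s n).2 (s k).2) != 0.
    by rewrite -normr_eq0 (det_moved hrho u0 hcr hm (c0 n) (c0 k)) oner_eq0.
  rewrite -hpM //.
  rewrite /moved -[_ *m Nmx _ *m _]mulmxA mulmxV // mulmx1 hpM //.
have bounded n k p w i (m : 'M[R]_2) : acts_as zo u (ev w) i m ->
    box d (cen n).1 (cen n).2 p -> box d (cen k).1 (cen k).2 (hp m p) ->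
    bndR 30 (moved m (s n).2 (s k).2).
  move=> hm hn hk; have p0 := box_pos _ _ hn.
  have [x1 _] := hxx n; have [x2 _] := hxx k.
  have [a1 a2] := near_point_bounds etab x1 (near _ _ hn).
  have [a3 a4] := near_point_bounds etab x2 (near _ _ hk).
  have dS := det_moved hrho u0 hcr hm (c0 n) (c0 k).
  exact: hp_bounded dS (move_eq n k _ _ _ _ hm p0) a1 a2 a3 a4.
exists d, (fun n => (cen n).1), (fun n => (cen n).2); split=> //.
move=> n k p w i m hm hn hk; have p0 := box_pos _ _ hn.
have [nk|kn|nk] := ltngtP n k.
(* [separation] forbids moving a later return to an earlier one, so the inverse element is used
   here. *)
- exfalso.
  have [l [m' [hm' hpE]]] := acts_as_inv u0 (det_ev hrho w) hm.
  rewrite -(ev_inv hrho) in hm'.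
  have dm : \det m != 0 by rewrite -normr_eq0 (det_ev_acts hrho u0 hm) oner_eq0.
  have back : hp m' (hp m p) = p.
    rewrite hpE -hpM ?det_inv ?invr_eq0 // mulVmx ?hp1 //.
    by rewrite unitmxE unitfE.
  apply: (hsX (s n) (sg n) _ _ _ _ _ (sg k) (sX_le _ _ nk) hm').
  by apply: bounded hm' hk _; rewrite back.
- exfalso; apply: (hsX (s k) (sg k) _ _ _ _ _ (sg n) (sX_le _ _ kn) hm).
  exact: bounded hm hn hk.
subst k; split=> //.
have [_ hx] := hxx n.
have e := move_eq n n p _ _ _ hm p0.
have triv := hx _ _ _ _ _ hm (near _ _ hn) (near _ _ hk) e.
rewrite triv in e.
have di : \det (invmx (Nmx (s n).2)) != 0 by rewrite det_inv invr_eq0.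
have q0 := box_pos _ _ hk.
have := congr1 (hp (Nmx (s n).2)) e.
by rewrite -(hpM (dN n) di p0) -(hpM (dN n) di q0) (mulmxV (uN n)) !hp1 => <-.
Qed.

(* Orbits are locally finite because bounded elements of Gp are finitely many. *)
Lemma orbit_isolated (p : R * R) : 0 < p.2 -> exists e, 0 < e /\
  forall w i (m : 'M[R]_2), acts_as zo u (ev w) i m ->
    `|(hp m p).1 - p.1| < e -> `|(hp m p).2 - p.2| < e -> hp m p = p.
Proof.
move=> p0.
pose Ap : 'M[R]_2 := mk p.2 p.1 0 1.
have dA : \det Ap = p.2 by rewrite det_mk mulr1 mulr0 subr0.
have dA0 : \det Ap != 0 by rewrite dA gt_eqF.
have uA : Ap \in unitmx by rewrite unitmxE unitfE.
have dAi : \det (invmx Ap) != 0 by rewrite det_inv invr_eq0.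
have ApE : hp Ap (0, 1) = p.
  rewrite /hp /hden dA !mkE /= gtr0_norm //; case: (p) => a b /=.
  by rewrite !(mul0r, mulr0, add0r, addr0, mulr1, expr0n, expr1n, divr1).
have ApV q : hp (invmx Ap) q = ((q.1 - p.1) / p.2, q.2 / p.2).
  have pn : p.2 != 0 by rewrite gt_eqF.
  rewrite invmx2 // dA scale_mk /hp /hden det_mk !mkE /=.
  rewrite !(mulr0, mul0r, oppr0, addr0, add0r, subr0, mulr1, expr0n) /= mulVf //.
  rewrite !(mulr1, expr1n, divr1) gtr0_norm ?invr_gt0 //; congr (_, _); by field.
have uf := frame_unit zo u0.
have [bF hbF] := bnd_exists (frame zo u).
have [bFi hbFi] := bnd_exists (invmx (frame zo u)).
have [bA hbA] := bnd_exists (cmx Ap).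
have [bAi hbAi] := bnd_exists (cmx (invmx Ap)).
have [b hb] : exists b, forall w i (m : 'M[R]_2), acts_as zo u (ev w) i m ->
    bndR 30 (invmx Ap *m m *m Ap) -> bnd b (ev w).
  exists (2 * (2 * (2 * (2 * bF * bA) * 30) * bAi) * bFi) => w i m hm hS.
  have mE : m = Ap *m (invmx Ap *m m *m Ap) *m invmx Ap.
    by rewrite !mulmxA mulmxV // mul1mx mulmxK.
  have -> : ev w = frame zo u *m cmx Ap *m (i *: cmx (invmx Ap *m m *m Ap)) *m cmx (invmx Ap)
      *m invmx (frame zo u).
    apply: (can_inj (mulmxK uf)); rewrite mulmxKV // hm.2 {1}mE !cmxM -!scalemxAr -!scalemxAl.
    by rewrite !mulmxA.
  apply: bnd_mul hbFi; apply: bnd_mul hbAi; apply: bnd_mul; first exact: bnd_mul.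
  by apply: bnd_scale => //; exact: acts_iota hm.
have [T [code hcode]] := bounded_code hrho b.
pose dist (q : R * R) := `|q.1 - p.1| + `|q.2 - p.2|.
(* Bounded elements with the same code are equal, so each code accounts for at most one displaced
   point, whose distance from [p] serves as a radius. *)
have per (x : T) : exists e : R, 0 < e /\ forall w i (m : 'M[R]_2), acts_as zo u (ev w) i m ->
    bnd b (ev w) -> code (ev w) = x -> hp m p <> p -> e <= dist (hp m p).
  have [[w [i [m [h1 h2 h3 h4]]]]|hno] := pselect (exists w i (m : 'M[R]_2),
      [/\ acts_as zo u (ev w) i m, bnd b (ev w), code (ev w) = x & hp m p <> p]).
    exists (dist (hp m p)); split.
      rewrite lt_neqAle addr_ge0 // andbT eq_sym paddr_eq0 // !normr_eq0 !subr_eq0.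
      apply/negP => /andP[/eqP a1 /eqP a2]; apply: h4.
      by rewrite [LHS]surjective_pairing a1 a2 -surjective_pairing.
    move=> w' i' m' h1' h2' h3' h4'.
    have eg : ev w = ev w' by apply: hcode => //; [exact: Gp_ev|exact: Gp_ev|rewrite h3 h3'].
    suff -> : hp m p = hp m' p by [].
    apply: (vparam_inj (zo := zo) u0).
    by rewrite -(hact_vparam u0 (det_ev hrho w) h1) // eg (hact_vparam u0 (det_ev hrho w') h1').
  exists 1; split=> // w i m h1 h2 h3 h4.
  by case: hno; exists w, i, m; split.
have [e he] := choice per.
have [d [d0 hd]] := finite_lower_bound (fun x => (he x).1).
pose e0 := Num.min (d / 2) (p.2 / 4).
exists e0; split; first by rewrite lt_min !divr_gt0.
move=> w i m hm; rewrite !lt_min => /andP[a1 a2] /andP[a3 a4].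
apply: contrapT => hne.
have dm1 := det_ev_acts hrho u0 hm.
have dm : \det m != 0 by rewrite -normr_eq0 dm1 oner_eq0.
have dS : `|\det (invmx Ap *m m *m Ap)| = 1.
  by rewrite det_mulmx det_mulmx det_inv mulrAC mulVf // mul1r.
have bS : bndR 30 (invmx Ap *m m *m Ap).
  have SE : hp (invmx Ap *m m *m Ap) (0, 1) = hp (invmx Ap) (hp m p).
    by rewrite hpM ?det_mulmx ?mulf_neq0 //= ?ltr01 // ApE hpM.
  apply: (hp_bounded dS SE); rewrite ?ApV /= ?normr0 //.
  - by apply/andP; split; [rewrite invf_le1 ?ler1n ?ltr0n|rewrite ler1n].
  - by have [] := rescale_bounds p0 a2 a4.
  - by have [] := rescale_bounds p0 a2 a4.
have := (he (code (ev w))).2 w i m hm (hb _ _ _ hm bS) erefl hne.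
apply/negP; rewrite -ltNge; apply: lt_le_trans (hd _).
by rewrite [d]splitr ltrD.
Qed.

End ReturnFamily.

(** * The stabilizer of the plane *)

(** For odd t the point s/t is not a half-integer either, as the crossing requires. *)
Lemma twice_nonint (s t : int) : odd `|t|%N -> s%:Q / t%:Q \isn't a Num.int ->
  forall n : int, 2 * (s%:Q / t%:Q) <> n%:~R.
Proof.
move=> ot hst n e.
have t0 : t != 0 by apply: contraTneq ot => ->.
have tq : t%:Q != 0 by rewrite intr_eq0.
have {}e : 2 * s = n * t.
  by apply: (@intr_inj rat); rewrite !rmorphM /= -e; field.
have : (2 %| n)%Z.
  have : (2 %| n * t)%Z by rewrite -e dvdz_mulr.
  by rewrite Gauss_dvdzl // coprimezE coprime2n.
move=> /dvdzP[k hk]; move: hst; have -> : s = k * t.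
  by apply: (mulfI (_ : 2 != 0 :> int)) => //; rewrite e hk; ring.
by rewrite rmorphM /= mulfK // intr_int.
Qed.

Lemma odd_denq (s t : int) : odd `|t|%N -> odd `|denq (s%:Q / t%:Q)|%N.
Proof.
move=> ot; have t0 : t%:Q != 0 by rewrite intr_eq0; apply: contraTneq ot => ->.
set q := _ / _; have e : numq q * t = s * denq q.
  apply: (@intr_inj rat); rewrite !rmorphM /= numqE /q.
  by field.
apply: dvdn_odd ot; have : (denq q %| numq q * t)%Z by rewrite e dvdz_mull.
by rewrite Gauss_dvdzr // coprimezE coprime_sym coprime_num_den.
Qed.

Lemma infinite_range T (S : set T) (f : nat -> T) : injective f ->
  (forall n, S (f n)) -> ~ finite_set S.
Proof.
move=> fI hf; apply/infiniteP.
apply: (@card_le_trans _ _ _ (range f)).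
  by rewrite -(card_le_eql (inj_card_eq (A := setT) (f := f) (in2W fI))) card_lexx.
by apply: subset_card_le => _ [n _ <-].
Qed.

Section Rationality.
Variables (R : realType) (j : nat) (z : R[i]) (rho : twist_group j -> 'M[R[i]]_2).
Hypothesis hrho : hyperbolic_rep z rho.
Hypothesis oddj : odd j.

Lemma frame_rational (q : rat) :
  (forall F : set R[i], subfield F -> F `<=` Qadjoin z ->
     F <> Qadjoin z -> F `<=` @Rc R -> F = @Qc R) ->
  forall w m, ev rho w *m frame (ratr q) (- 4 / z) = frame (ratr q) (- 4 / z) *m cmx m ->
  forall i k, isQ (m i k).
Proof.
move=> hreal w m h.
have hQ := @Qadjoin_subfield R z; have [_ _ QV] := (subfieldP _).1 hQ.
have [_ QN QD QM] := subfield_closed hQ.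
have Qz : Qadjoin z z by move=> F [_]; apply.
have Qq := subfield_rat q hQ.
have Qu : Qadjoin z (- 4 / z).
  by apply: (QV) => //; apply: (QN); have := subfield_rat 4%:R hQ; rewrite ratr_nat.
have u0 : - 4 / z != 0.
  by rewrite mulf_neq0 ?invr_eq0 ?(z_neq0 hrho oddj) // oppr_eq0 pnatr_eq0.
have Qe := ev_subfield hrho hQ Qz w.
have ent i k := congr1 (fun M : 'M[R[i]]_2 => M i k) h.
move: u0 Qu Qq (ent 0 0) (ent 0 1) (ent 1 0) (ent 1 1) => {ent h}.
move: (- 4 / z) (ratr q) => u zo u0 Qu Qq.
rewrite !mul2E !mkE !cmxE !(mulr0, mul0r, mul1r, mulr1, add0r, addr0) => e00 e01 e10 e11.
have Q10 : Qadjoin z (m 1 0)%:C by rewrite -e10; apply: (QM).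
have Q11 : Qadjoin z (m 1 1)%:C by rewrite -e11; apply: (QD) => //; apply: (QM).
have Q00 : Qadjoin z (m 0 0)%:C.
  have -> : (m 0 0)%:C = (ev rho w 0 0 * u - zo * (m 1 0)%:C) / u by rewrite e00; field.
  by apply: (QV) => //; apply: (QD); [exact: (QM)|apply: (QN); exact: (QM)].
have Q01 : Qadjoin z (m 0 1)%:C.
  have -> : (m 0 1)%:C = (ev rho w 0 0 * zo + ev rho w 0 1 - zo * (m 1 1)%:C) / u.
    by rewrite e01; field.
  by apply: (QV) => //; apply: (QD); [apply: (QD) => //; exact: (QM)|apply: (QN); exact: (QM)].
move=> i k; have hik : Qadjoin z (m i k)%:C.
  by have [->|->] := ord2P i; have [->|->] := ord2P k.
by have [r hr] := real_Qadjoin_rat hrho oddj hreal hik erefl; exists r.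
Qed.

End Rationality.

Section VerticalPlane.
Variables (R : realType) (zo u : R[i]).
Hypothesis u0 : u != 0.
Implicit Types (P : R * R * R) (p : R * R).

Definition unparam P : R * R :=
  ((P.1.1 - complex.Re zo) * complex.Re u^-1 - (P.1.2 - complex.Im zo) * complex.Im u^-1,
   P.2 / Num.sqrt (sqnorm u)).

Lemma vparamK : cancel (vparam zo u) unparam.
Proof.
case=> x y; have s0 : Num.sqrt (sqnorm u) != 0 by rewrite sqrtr_eq0 -ltNge sqnorm_gt0.
rewrite /unparam /vparam /=; congr (_, _); last by rewrite mulrC mulKf.
transitivity (complex.Re (x%:C * u * u^-1)); last by rewrite mulfK.
case: (zo) (u) (u^-1) => a b [c d] [e f] /=; ring.
Qed.

(** The image is the preimage of [S] under the left inverse [unparam], cut by the two equations of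
    the line under the plane. *)
Lemma measurable_vparam_image (S : set (R * R)) :
  measurable S -> measurable (vparam zo u @` S).
Proof.
move=> mS; pose g P := vparam zo u (unparam P).
have mfst : measurable_fun [set: R * R * R] (fun P => P.1.1).
  exact: (measurableT_comp (f := fst) (g := fst)).
have msnd : measurable_fun [set: R * R * R] (fun P => P.1.2).
  exact: (measurableT_comp (f := snd) (g := fst)).
have m1 : measurable_fun [set: R * R * R] (fun P => (unparam P).1).
  by apply: measurable_funB; apply: measurable_funM => //; apply: measurable_funB.
have m2 : measurable_fun [set: R * R * R] (fun P => (unparam P).2).
  exact: measurable_funM.
have -> : vparam zo u @` S = unparam @^-1` S `&`
   ([set P | (complex.Re zo + (unparam P).1 * complex.Re u == P.1.1)] `&`
    [set P | (complex.Im zo + (unparam P).1 * complex.Im u == P.1.2)]).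
  have s0 : Num.sqrt (sqnorm u) != 0 by rewrite sqrtr_eq0 -ltNge sqnorm_gt0.
  have re_mul (x : R) (y : R[i]) : complex.Re (x%:C * y) = x * complex.Re y.
    by case: y => a b /=; ring.
  have im_mul (x : R) (y : R[i]) : complex.Im (x%:C * y) = x * complex.Im y.
    by case: y => a b /=; ring.
  have reD (x y : R[i]) : complex.Re (x + y) = complex.Re x + complex.Re y by case: x y => ? ? [].
  have imD (x y : R[i]) : complex.Im (x + y) = complex.Im x + complex.Im y by case: x y => ? ? [].
  apply/seteqP; split=> [_ [p hp <-]|P /= [h1 [/eqP h2 /eqP h3]]].
    by split; [|split]; rewrite /preimage /mkset vparamK // /vparam /= ?reD ?imD ?re_mul ?im_mul eqxx.
  exists (unparam P) => //; rewrite /vparam reD imD re_mul im_mul h2 h3 /=.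
  by rewrite mulrC divfK //; case: (P) => [[]].
apply: measurableI; last first.
  apply: measurableI.
    rewrite -[X in measurable X]setTI.
    apply: (measurable_fun_eqr (D := setT) _ mfst measurableT (Y := [set true])) => //.
    by apply: measurable_funD => //; apply: measurable_funM.
  rewrite -[X in measurable X]setTI.
  apply: (measurable_fun_eqr (D := setT) _ msnd measurableT (Y := [set true])) => //.
  by apply: measurable_funD => //; apply: measurable_funM.
rewrite -[X in measurable X]setTI.
by apply: (measurable_fun_pair m1 m2).
Qed.

End VerticalPlane.

Section Stabilizer.
Variables (R : realType) (j : nat) (z : R[i]) (rho : twist_group j -> 'M[R[i]]_2).
Hypothesis hrho : hyperbolic_rep z rho.
Hypothesis oddj : odd j.
Local Notation C := R[i].
Local Notation ev := (ev rho).

Section Plane.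
Variables zo u : C.
Hypothesis u0 : u != 0.

Definition stab : set 'M[C]_2 := rho @` stabilizer rho (vplane zo u).

Lemma stabP g : stab g <-> exists w i m, g = ev w /\ acts_as zo u g i m.
Proof.
split=> [[x hx <-]|[w [i [m [-> ham]]]]].
  have e : rho x = ev (pres_repr x) by rewrite /ev pres_reprK.
  have d1 : \det (rho x) = 1 by rewrite e (det_ev hrho).
  have [i [m h]] := (stab_acts zo u0 d1).1 hx.
  by exists (pres_repr x), i, m.
exists (pres_class (twist_rels j) w) => //.
by apply/(stab_acts zo u0 (det_ev hrho w)); exists i, m.
Qed.

Lemma stab_mul g h : stab g -> stab h -> stab (g *m h).
Proof.
move=> /stabP[w [i [m [-> h1]]]] /stabP[w' [i' [m' [-> h2]]]]; apply/stabP.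
have [l [s [hs _]]] := acts_as_mul h1 h2.
by exists (w ++ w'), l, s; rewrite (ev_cat hrho).
Qed.

Lemma stab_fuchsian : fuchsian stab.
Proof.
split; last first.
- exists (vplane zo u); first by left; exists zo, u.
  move=> g /stabP[w [i [m [-> h]]]].
  by apply/(stab_acts zo u0 (det_ev hrho w)); exists i, m.
- move=> g sg; have rg : range rho g by case: sg => x _ <-; exists x.
  have [_ [V hV VE]] := rep_discrete hrho rg.
  split; first exact/mem_set.
  exists V => //; apply/seteqP; split=> [x [Vx [y _ yx]]|_ ->].
    by rewrite -VE; split=> //; exists y.
  by split=> //; have : [set g] g by []; rewrite -VE => -[].
split=> [g /stabP[w [_ [_ [-> _]]]]||g h|g /stabP[w [i [m [-> h]]]]].
- exact: det_ev hrho w.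
- by apply/stabP; exists [::], 1, 1%:M; rewrite (ev_nil hrho); split=> //; exact: acts_as1.
- exact: stab_mul.
apply/stabP; have [l [s [hs _]]] := acts_as_inv u0 (det_ev hrho w) h.
by exists (inv_word w), l, s; rewrite (ev_inv hrho).
Qed.

(** The stabilizer consists of elements of the image, so an element of [Gp] enters it only up to
    sign; [hact] and [mobius] ignore this sign. *)
Lemma Gp_stab M i m : Gp rho M -> acts_as zo u M i m ->
  exists g, stab g /\ (g = M \/ g = - M).
Proof.
move=> [w hw] [hi hM]; exists (ev w); split; last first.
  by case: hw => ->; [left|right; rewrite opprK].
apply/stabP; exists w; case: hw => hw.
  by exists i, m; split=> //; split=> //; rewrite -hw.
exists i, (- m); split=> //; split=> //.
by rewrite -[ev w]opprK -hw mulNmx hM /cmx (map_mxN (real_complex R)) mulmxN scalerN.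
Qed.

Lemma acts_as_translation (r : R) : acts_as zo u (mk 1 (u * r%:C) 0 1) 1 (mk 1 r 0 1).
Proof.
split; first by left.
rewrite /frame /cmx map_mk !mk_mul scale_mk /=; congr (mk _ _ _ _); rewrite ?rmorph1 ?rmorph0; ring.
Qed.

End Plane.

Lemma hact_translation g x (p : R * R * R) : g = mk 1 x 0 1 \/ g = - mk 1 x 0 1 ->
  hact g p = (p.1.1 + complex.Re x, p.1.2 + complex.Im x, p.2).
Proof.
have key (e : C) : e = 1 \/ e = -1 -> hact (mk e (e * x) 0 e) p =
   (p.1.1 + complex.Re x, p.1.2 + complex.Im x, p.2).
  move=> he; have ce : conjc e = e by case: he => ->; apply/eqP; rewrite eq_complex /= ?oppr0 !eqxx.
  have ee : e * e = 1 by case: he => ->; rewrite ?mulrNN mulr1.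
  have se : sqnorm e = 1 by apply: complexI; rewrite sqnormE ce ee.
  have s0 : sqnorm (0 : C) = 0 by apply: complexI; rewrite sqnormE mul0r.
  rewrite /hact !mkE mul0r add0r se s0 mul0r addr0 !divr1 conjc0 mulr0 mul0r addr0 ce.
  have -> (y : C) : (e * y + e * x) * e = (e * e) * (y + x) by ring.
  by rewrite ee mul1r; case: (x) => a b.
case=> ->; first by rewrite -[x in mk _ x]mul1r; apply: key; left.
by rewrite opp_mk oppr0 -[- x]mulN1r; apply: key; right.
Qed.

Lemma mobius_translation g x (y : C) : g = mk 1 x 0 1 \/ g = - mk 1 x 0 1 ->
  mobius g (Some y) = Some (y + x).
Proof.
case=> ->; rewrite /mobius ?opp_mk !mkE ?oppr0 !mul0r !add0r ?oppr_eq0 oner_eq0; congr Some.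
  by rewrite divr1 mul1r.
by rewrite invrN1 mulN1r mulrN1 opprD !opprK.
Qed.

Lemma mobius_infty_translation g (h : 'M[C]_2) x : g = mk 1 x 0 1 \/ g = - mk 1 x 0 1 ->
  h 1 0 != 0 -> mobius (g *m h) None = Some (h 0 0 / h 1 0 + x).
Proof.
move=> hg h0; rewrite /mobius !mul2E.
case: hg => ->; rewrite ?opp_mk !mkE ?oppr0 !mul0r !add0r ?mul1r ?mulN1r ?oppr_eq0 (negPf h0).
  by congr Some; field.
by congr Some; field.
Qed.

(** The translations by multiples of u give every point other than infinity an infinite orbit.
    Infinity itself is moved off by the parabolic fixing q: in the frame it is lower unipotent with
    entry -4 t^2, real because z u = -4. *)
Lemma stab_nonelementary (q : rat) : odd `|denq q|%N -> ~ elementary (stab (ratr q) (- 4 / z)).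
Proof.
move=> oq; have z0 := z_neq0 hrho oddj.
set zo := ratr q; set u := - 4 / z.
have u0 : u != 0 by rewrite mulf_neq0 ?invr_eq0 // oppr_eq0 pnatr_eq0.
pose X (n : nat) : C := u * (n%:R : R)%:C.
have XI : injective X.
  by move=> n m /(mulfI u0) /complexI /eqP; rewrite eqr_nat => /eqP.
have tr n : exists g, stab zo u g /\ (g = mk 1 (X n) 0 1 \/ g = - mk 1 (X n) 0 1).
  apply: (Gp_stab u0 _ (acts_as_translation zo u n%:R)).
  have := Gp_U hrho oddj (- n%:Z); congr (Gp rho (mk _ _ _ _)).
  by rewrite rmorph_nat mulrNz /u mulrN !mulNr.
have [h [sh h10]] : exists h, stab zo u h /\ h 1 0 != 0.
  have t0 : (denq q)%:~R != 0 :> C by rewrite intr_eq0 denq_neq0.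
  have cop : coprimez (4 * numq q) (denq q).
    rewrite coprimezMl coprimezE (_ : `|4| = 2 * 2)%N // coprimeMl coprime2n oq /=.
    by rewrite coprimezE coprime_num_den.
  have zoE : zo = (numq q)%:~R / (denq q)%:~R by rewrite /zo /ratr.
  have gp := Gp_conj_parabolic hrho oddj cop.
  suff act : acts_as zo u (mk (1 + (numq q)%:~R * (denq q)%:~R * z) (- ((numq q)%:~R ^+ 2 * z))
      ((denq q)%:~R ^+ 2 * z) (1 - (numq q)%:~R * (denq q)%:~R * z))
      1 (mk 1 0 (- 4 * (denq q)%:~R ^+ 2) 1).
    have [h [sh hE]] := Gp_stab u0 gp act.
    exists h; split=> //; have : (denq q)%:~R ^+ 2 * z != 0 by rewrite mulf_neq0 // expf_neq0.
    by case: hE => ->; rewrite ?opp_mk !mkE ?oppr_eq0.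
  split; first by left.
  rewrite /frame /cmx map_mk !mk_mul scale_mk zoE /u /= !rmorphM rmorphN rmorph_nat !rmorph_int.
  move: (numq q)%:~R (denq q)%:~R t0 => a t t0.
  by rewrite rmorph0 rmorph1; congr (mk _ _ _ _); field; rewrite ?t0 ?z0.
case=> [[p p0]|[[y|]]].
- pose f n : R * R * R := (p.1.1 + complex.Re (X n), p.1.2 + complex.Im (X n), p.2).
  apply: (@infinite_range _ _ f) => [n m [/addrI h1 /addrI h2]|n].
    by apply: XI; rewrite -[LHS]complex_eta h1 h2 complex_eta.
  by have [g [sg hg]] := tr n; exists g => //; exact: hact_translation.
- apply: (@infinite_range _ _ (fun n => Some (y + X n))) => [n m [/addrI /XI]//|n].
  by have [g [sg hg]] := tr n; exists g => //; exact: mobius_translation.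
apply: (@infinite_range _ _ (fun n => Some (h 0 0 / h 1 0 + X n))) => [n m [/addrI /XI]//|n].
have [g [sg hg]] := tr n; exists (g *m h); first exact: stab_mul.
exact: mobius_infty_translation.
Qed.

End Stabilizer.

(** * A fundamental domain of infinite area *)

Section Covolume.
Variables (R : realType) (j : nat) (z : R[i]) (rho : twist_group j -> 'M[R[i]]_2).
Hypothesis hrho : hyperbolic_rep z rho.
Hypothesis oddj : odd j.
Local Notation C := R[i].
Local Notation ev := (ev rho).
Variables (zo u : C) (gamma : 'M[C]_2) (r1 r2 Y1 Y2 : R) (k1 k2 : C).
Hypothesis u0 : u != 0.
Hypothesis hcr : crossing rho zo u gamma r1 r2 Y1 Y2 k1 k2.
Hypothesis hrat : forall w m, ev w *m frame zo u = frame zo u *m cmx m ->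
  forall i k, isQ (m i k).

Lemma acts_as_unique w i i' (m m' : 'M[R]_2) p : acts_as zo u (ev w) i m ->
  acts_as zo u (ev w) i' m' -> 0 < p.2 -> hp m p = hp m' p.
Proof.
move=> h h' p0; apply: (vparam_inj (zo := zo) u0).
rewrite -(hact_vparam u0 (det_ev hrho w) h) //.
exact: hact_vparam (det_ev hrho w) h' p0.
Qed.

(** Words are countable; an index that is not the code of a word in the stabilizer gets the
    identity. *)
Lemma stab_enumeration : exists mm : nat -> 'M[R]_2,
  (forall a, exists w i, acts_as zo u (ev w) i (mm a)) /\
  forall w i m, acts_as zo u (ev w) i m ->
    exists a, forall p, upper p -> hp (mm a) p = hp m p.
Proof.
have pick1 n : exists m : 'M[R]_2, (exists w i, acts_as zo u (ev w) i m) /\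
    forall w : seq (bool * bool), unpickle n = Some w ->
    (exists i m', acts_as zo u (ev w) i m') -> exists i, acts_as zo u (ev w) i m.
  have [[w [hw [i [m hm]]]]|hno] := pselect (exists w : seq (bool * bool),
      unpickle n = Some w /\ exists i m, acts_as zo u (ev w) i m).
    exists m; split; first by exists w, i.
    by move=> w'; rewrite hw => -[<-] _; exists i.
  exists 1%:M; split.
    by exists [::], 1; rewrite (ev_nil hrho); exact: acts_as1.
  by move=> w hw h; case: hno; exists w.
have [mm hmm] := choice pick1; exists mm; split=> [a|w i m hm]; first by case: (hmm a).
exists (pickle (w : seq (bool * bool))) => p up.
have [_ /(_ _ (pickleK _)) []] := hmm (pickle (w : seq (bool * bool))).
  by exists i, m.
by move=> i' h'; exact: acts_as_unique h' hm up.
Qed.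

Definition rational_box n : set (R * R) :=
  if (unpickle n : option (rat * rat * rat)) is Some (a, b, r) then
    `[ratr a - ratr r, ratr a + ratr r]%classic `*`
    `[ratr b - ratr r, ratr b + ratr r]%classic
  else set0.

Lemma rational_box_near (p : R * R) (e : R) : 0 < e -> exists n, rational_box n p /\
  forall v, rational_box n v -> `|v.1 - p.1| < e /\ `|v.2 - p.2| < e.
Proof.
move=> e0; have e2 : 0 < e / 2 by rewrite divr_gt0.
have [r] := rat_in_itvoo e2; rewrite in_itv /= => /andP[r0 re].
have [a] : exists a : rat, ratr a \in `]p.1 - ratr r, p.1 + ratr r[.
  by apply: rat_in_itvoo; lra.
have [b] : exists b : rat, ratr b \in `]p.2 - ratr r, p.2 + ratr r[.
  by apply: rat_in_itvoo; lra.
rewrite !in_itv /= => /andP[b1 b2] /andP[a1 a2].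
exists (pickle (a, b, r)); rewrite /rational_box pickleK; split.
  by split; rewrite /= in_itv /=; apply/andP; split; lra.
move=> v [] /=; rewrite !in_itv /= => /andP[h1 h2] /andP[h3 h4].
by rewrite !ltr_norml; split; apply/andP; split; lra.
Qed.

Lemma stab_covolume :
  covolume_is (stab rho zo u) (vplane zo u) (vplane_area zo u) +oo%E.
Proof.
have [mm [mm_acts mm_all]] := stab_enumeration.
have [d [X [Y [d0 Y0 hXY]]]] := return_family hrho oddj u0 hcr hrat.
(* At index 0 stands the union of all boxes, which the selection then contains; the rational boxes
   at the other indices single out a point of every orbit. *)
pose V n : set (R * R) := if n is n'.+1 then rational_box n' else \bigcup_k box d (X k) (Y k).
have mm_det a : \det (mm a) != 0.
  by have [w [i h]] := mm_acts a; rewrite -normr_eq0 (det_ev_acts hrho u0 h) oner_eq0.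
have mm_mul a b : exists c, forall p, upper p -> hp (mm c) p = hp (mm a) (hp (mm b) p).
  have [w [i h]] := mm_acts a; have [w' [i' h']] := mm_acts b.
  have [l [s [hs sE]]] := acts_as_mul h h'; rewrite -(ev_cat hrho) in hs.
  have [c hc] := mm_all _ _ _ hs.
  by exists c => p up; rewrite hc // sE hpM.
have mm_one : exists c, forall p, upper p -> hp (mm c) p = p.
  have h : acts_as zo u (ev [::]) 1 1%:M by rewrite (ev_nil hrho); exact: acts_as1.
  by have [c hc] := mm_all _ _ _ h; exists c => p up; rewrite hc // hp1.
have mm_inv a : exists c, forall p, upper p -> hp (mm c) (hp (mm a) p) = p.
  have [w [i h]] := mm_acts a.
  have [l [s [hs sE]]] := acts_as_inv u0 (det_ev hrho w) h; rewrite -(ev_inv hrho) in hs.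
  have [c hc] := mm_all _ _ _ hs; exists c => p up.
  rewrite hc ?sE; last exact: hp_gt0.
  rewrite -hpM ?mulVmx ?hp1 // ?det_inv ?invr_eq0 //.
  by rewrite unitmxE unitfE.
have V_meas n : measurable (V n).
  case: n => [|n] /=; first by apply: bigcupT_measurable => k; exact: measurable_box.
  rewrite /rational_box; case: unpickle => [[[a b] r]|//].
  by apply: measurableX; exact: measurable_itv.
have V_isol p : upper p ->
    exists n, V n p /\ forall k, V n (hp (mm k) p) -> hp (mm k) p = p.
  move=> up; have [e [e0 he]] := orbit_isolated hrho zo u0 up.
  have [n [hn hn']] := rational_box_near p e0.
  exists n.+1; split=> // k /hn' [h1 h2].
  by have [w [i h]] := mm_acts k; exact: he h h1 h2.
pose S := selection mm V.
have mS : measurable S by exact: measurable_selection.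
have orbE (p : R * R) q : upper p ->
    Defs.orbit (@hact R) (stab rho zo u) (vparam zo u p) q <-> exists k, q = vparam zo u (hp (mm k) p).
  move=> up; split=> [[g /(stabP hrho zo u0)[w [i [m [-> hm]]]] <-]|[k ->]].
    have [k hk] := mm_all _ _ _ hm; exists k; rewrite hk //.
    exact: hact_vparam (det_ev hrho w) hm up.
  have [w [i hm]] := mm_acts k; exists (ev w).
    by apply/(stabP hrho zo u0); exists w, i, (mm k).
  exact: hact_vparam (det_ev hrho w) hm up.
exists (vparam zo u @` S).
  split; first exact: measurable_vparam_image.
    by move=> _ [p [up _] <-]; exists p.
  move=> _ [p up <-].
  have [q [[Sq [k qE]] uq]] := selectionP mm_det mm_mul mm_one mm_inv V_isol up.
  exists (vparam zo u q); split.
    by split; [exists q|apply/orbE => //; exists k; rewrite qE].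
  move=> _ [[q' Sq' <-] /(orbE _ _ up) [k' /(vparam_inj u0) q'E]].
  by congr vparam; apply: uq; split=> //; exists k'.
rewrite /vplane_area (_ : _ @^-1` _ = S); last first.
  apply/seteqP; split=> [p [q Sq /(vparam_inj u0) <-]//|p Sp].
  by exists p.
have box_upper k p : box d (X k) (Y k) p -> upper p.
  by move=> [_ /=]; rewrite in_itv /= => /andP[h _]; apply: lt_le_trans h.
have eq_box k k' p w i m : acts_as zo u (ev w) i m -> box d (X k) (Y k) p ->
    box d (X k') (Y k') (hp m p) -> k = k' /\ hp m p = p by exact: hXY.
apply: (infinite_area d0 Y0 mS (x := X)).
  (* Disjointness of the boxes is the case of the identity element. *)
  apply/trivIsetP => k k' _ _ kk'; apply/seteqP; split=> // p [h h'].
  have h1 : acts_as zo u (ev [::]) 1 1%:M by rewrite (ev_nil hrho); exact: acts_as1.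
  have h2 : box d (X k') (Y k') (hp 1%:M p) by rewrite hp1.
  have [e _] := eq_box k k' p _ _ _ h1 h h2.
  by rewrite e eqxx in kk'.
move=> k p hk; apply: (selection0 mm_one) => //.
- exact: box_upper hk.
- by exists k.
move=> a [k' _ hk']; have [w [i h]] := mm_acts a.
by have [] := eq_box _ _ _ _ _ _ h hk hk'.
Qed.

End Covolume.

Theorem corollary3p7 (R : realType) (j : nat) (hj : (3 <= j)%N)
    (oddj : odd j) (z : R[i]) (rho : twist_group j -> 'M[R[i]]_2)
    (hrho : hyperbolic_rep z rho)
    (hreal : forall F : set R[i], subfield F -> F `<=` Qadjoin z ->
       F <> Qadjoin z -> F `<=` @Rc R -> F = @Qc R)
    (s t : int) (oddt : odd `|t|%N)
    (hst : s%:Q / t%:Q \isn't a Num.int) :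
  let H := Hplane z (s%:Q / t%:Q) in
  let G := rho @` stabilizer rho H in
  [/\ fuchsian G, ~ elementary G &
      covolume_is G H (Hplane_area z (s%:Q / t%:Q)) +oo%E].
Proof.
have z0 := z_neq0 hrho oddj.
have u0 : - 4 / z != 0 by rewrite mulf_neq0 ?invr_eq0 // oppr_eq0 pnatr_eq0.
rewrite /Hplane /Hplane_area; have -> : tau z - 2 = - 4 / z by rewrite /tau; field.
have [gamma [r1 [r2 [Y1 [Y2 [k1 [k2 hcr]]]]]]] :=
  crossing_exists hrho oddj (twice_nonint oddt hst).
have hrat := frame_rational hrho oddj hreal (q := s%:Q / t%:Q).
rewrite -/(stab rho _ (- 4 / z)); split; first exact: (stab_fuchsian hrho _ u0).
  exact: stab_nonelementary (odd_denq s oddt).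
exact: (stab_covolume hrho oddj u0 hcr hrat).
Qed.
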